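(* There exists a $K_1$ such that for every $K>K_1$ there exist a constant $c>c_0$ and a function $q\in C^2(\mathbb{R})$ such that $\mathcal{E}(q)=K$ and, for all $z\in\mathbb{R}$, $$c^2q''(z)= \int_0^\delta \Bigl(f(q(z+\xi)-q(z),\xi) - f(q(z)-q(z-\xi),\xi)\Bigr)\,d\xi .$$ Furthermore, $q$ is increasing if $V$ is superquadratic on $[0,\infty)$ (i.e. $I=[0,\infty)$), and $q$ is decreasing if $V$ is superquadratic on $(-\infty,0]$ (i.e. $I=(-\infty,0]$).
   Context: Fix $\delta>0$. Let $V:\mathbb{R}\to\mathbb{R}$ be $C^2$, and let $I$ be one of the half-lines $(-\infty,0]$, $[0,\infty)$. Assume: (H1) On $I$, $V$ is non-increasing (if $I=(-\infty,0]$), respectively non-decreasing (if $I=[0,\infty)$), convex, and superquadratic, meaning that $V(x)/x^2$ is a strictly increasing function of $|x|$ for $x\in I\setminus\{0\}$. Moreover $V(0)=V'(0)=0$, $V''(0)>0$, and $V''(x)\le V''(0)+c_1|x|^{\gamma_1}+c_2|x|^{\gamma_2}$ for $x\in\mathbb{R}$, where $c_1,c_2\ge 1$ and $0<\gamma_1\le\gamma_2$. (H2) $k:\mathbb{R}\to\mathbb{R}$ is even, $m:\mathbb{R}\to\mathbb{R}$ is odd, both $m$ and $k$ vanish only at $0$ and are non-decreasing on $[0,\infty)$, and $\int_0^\delta \frac{\xi^2 k(\xi)}{m(\xi)^{\gamma_2+2}}\,d\xi<\infty$, $\int_0^\delta \frac{k(\xi)}{m(\xi)}\,d\xi<\infty$.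 The micropotential is $W(\eta,\xi)=V\left(\frac{\eta}{m(\xi)}\right)k(\xi)$ for $\xi\ne0$, the force density is $f(\eta,\xi)=\partial_\eta W(\eta,\xi)=V'\left(\frac{\eta}{m(\xi)}\right)\frac{k(\xi)}{m(\xi)}$, and the potential energy is $$\mathcal{E}(q)=\int_{\mathbb{R}}\int_0^\delta W\bigl(q(z+\xi)-q(z),\xi\bigr)\,d\xi\,dz .$$ The sound speed $c_0>0$ is defined by $c_0^2=V''(0)\int_0^\delta \frac{k(\xi)\xi^2}{m(\xi)^2}\,d\xi$. ''Increasing'' and ''decreasing'' are in the non-strict (monotone) sense. *)

(* Defs.v *)
From HB Require Import structures.
From mathcomp Require Import all_boot all_order all_algebra.
From mathcomp Require Import all_classical all_reals all_analysis.
Set Implicit Arguments.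
Unset Strict Implicit.
Unset Printing Implicit Defensive.
Import Order.TTheory GRing.Theory Num.Theory.
Import numFieldNormedType.Exports.
Local Open Scope classical_set_scope.
Local Open Scope ring_scope.

Section Defs.
Variable R : realType.

Definition C2 (g : R -> R) : Prop :=
  [/\ forall x, derivable g x 1,
      forall x, derivable g^`()%classic x 1 &
      continuous g^`(2)%classic].

Definition neg_half_line : interval R := `]-oo, 0].
Definition pos_half_line : interval R := `[0, +oo[.

Record potential_hyp (V : R -> R) (I : interval R)
    (c1 c2 gamma1 gamma2 : R) : Prop := PotentialHyp {
  V_nonincreasing : I = neg_half_line ->
    {in I &, {homo V : x y / x <= y >-> y <= x}};
  V_nondecreasing : I = pos_half_line ->
    {in I &, {homo V : x y / x <= y}};
  V_convex : @convex_function R R^o [set` I] V;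
  V_superquadratic : forall x y, x \in I -> y \in I -> x != 0 -> y != 0 ->
    `|x| < `|y| -> V x / x ^+ 2 < V y / y ^+ 2;
  V_at0 : V 0 = 0;
  V'_at0 : V^`()%classic 0 = 0;
  V''_at0 : 0 < V^`(2)%classic 0;
  c1_ge1 : 1 <= c1;
  c2_ge1 : 1 <= c2;
  gamma1_gt0 : 0 < gamma1;
  gamma1_le_gamma2 : gamma1 <= gamma2;
  V''_growth : forall x : R,
    V^`(2)%classic x <=
      V^`(2)%classic 0 + c1 * `|x| `^ gamma1 + c2 * `|x| `^ gamma2 }.

(* On ]0, delta[ both integrands are positive, since k and m are positive
   there; the condition "< +oo" is thus integrability. *)
Record kernel_hyp (delta gamma2 : R) (k m : R -> R) : Prop := KernelHyp {
  k_even : forall x, k (- x) = k x;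
  m_odd : forall x, m (- x) = - m x;
  k_eq0 : forall x, k x = 0 <-> x = 0;
  m_eq0 : forall x, m x = 0 <-> x = 0;
  k_nondecreasing : {in pos_half_line &, {homo k : x y / x <= y}};
  m_nondecreasing : {in pos_half_line &, {homo m : x y / x <= y}};
  int_growth : (\int[lebesgue_measure]_(xi in `]0%R, delta[)
    (xi ^+ 2 * k xi / m xi `^ (gamma2 + 2))%:E < +oo)%E;
  int_k_over_m : (\int[lebesgue_measure]_(xi in `]0%R, delta[)
    (k xi / m xi)%:E < +oo)%E }.

Definition micropotential (V k m : R -> R) (eta xi : R) : R :=
  V (eta / m xi) * k xi.

Definition force_density (V k m : R -> R) (eta xi : R) : R :=
  (fun e => micropotential V k m e xi)^`()%classic eta.

Lemma force_densityE (V k m : R -> R) (eta xi : R) :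
  (forall x, derivable V x 1) ->
  force_density V k m eta xi = V^`()%classic (eta / m xi) * (k xi / m xi).
Proof.
move=> dV; rewrite /force_density /micropotential.
have -> : (fun e => V (e / m xi) * k xi) =
          (fun e => (V \o (fun e => e * (m xi)^-1)) e * k xi) by [].
have dl : derivable (fun e : R => e * (m xi)^-1) eta 1.
  exact: derivableM.
rewrite derive1Mr; last first.
  by apply/derivable1_diffP/differentiable_comp; apply/derivable1_diffP.
by rewrite derive1_comp// derive1Mr// derive1_id mul1r mulrAC mulrA.
Qed.

Definition potential_energy (delta : R) (V k m q : R -> R) : \bar R :=
  (\int[lebesgue_measure]_z \int[lebesgue_measure]_(xi in `]0%R, delta[)
     (micropotential V k m (q (z + xi) - q z) xi)%:E)%E.

(* Under kernel_hyp the integral is finite and positive, because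
   xi ^+ 2 * k xi / m xi ^+ 2 is at most m delta `^ gamma2 times the first
   integrand of kernel_hyp; the real-valued integral is thus the true one. *)
Definition sound_speed (delta : R) (V k m : R -> R) : R :=
  Num.sqrt (V^`(2)%classic 0 *
    \int[lebesgue_measure]_(xi in `]0%R, delta[) (k xi * xi ^+ 2 / m xi ^+ 2)).

(* Equality in \bar R: in particular the integrand is integrable, as an
   integral equal to a real number has finite positive and negative parts. *)
Definition travelling_wave_eq (delta : R) (V k m : R -> R) (c : R)
    (q : R -> R) : Prop :=
  forall z, (c ^+ 2 * q^`(2)%classic z)%:E =
    (\int[lebesgue_measure]_(xi in `]0%R, delta[)
      (force_density V k m (q (z + xi) - q z) xi -
       force_density V k m (q z - q (z - xi)) xi)%:E)%E.

End Defs.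

(* Main.v *)
(* Up to the reflection [x |-> - x] we may take [I = [0, +oo[]. The derivative [u = q'] is
   sought among the nonnegative functions that are even and nonincreasing on [0, +oo[, as a
   minimiser of [int u^2] under the constraint that the energy of [u] is at least [K].

   Existence: Helly's selection theorem gives a limit almost everywhere of a minimising
   sequence. As the energy is at most [c0^2 / 2 * int u^2] up to a remainder that is
   negligible where the strains are small, Fatou's lemma, applied to
   [(c0^2 / 2 + e) * int u^2] minus the energy, shows that whatever norm is lost in the
   limit carries at most [c0^2 / 2] times that norm of energy. If the infimum is below
   [2 K / c0^2], superquadraticity lets one scale the limit up into a minimiser. For [K]
   large, a wide plateau is a competitor that beats [2 K / c0^2].

   Euler-Lagrange: the gradient [g] of the energy at the minimiser [u] is again even and
   unimodal, hence a multiple of it truncated is an admissible test function, and convexity of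
   the energy yields [(int g^2) (int u^2) <= (int g u)^2]. So [g = c^2 u] with
   [c^2 = int g u / int u^2 >= 2 K / int u^2 > c0^2].

   Regularity: integrating the equation over the set where [u] is larger than [M] shows that
   [u] is bounded, since [c > c0]; a supremum argument on [u (z + h) - u z] makes [u]
   Lipschitz, and then differentiation under the integral gives the travelling wave
   equation. *)
Require Import Defs.
From HB Require Import structures.
From mathcomp Require Import all_boot all_order all_algebra.
From mathcomp Require Import all_classical all_reals all_analysis.
From mathcomp Require Import measurable_realfun ring lra.
Set Implicit Arguments.
Unset Strict Implicit.
Unset Printing Implicit Defensive.
Import Order.TTheory GRing.Theory Num.Theory.
Import numFieldNormedType.Exports.
Local Open Scope classical_set_scope.
Local Open Scope ring_scope.

(** * Strains of even unimodal functions *)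

(** Only [rho x * x ^+ 2] is assumed integrable, not [rho], so every estimate has to gain two powers
    of the bond length [x]. In [dens_ge0], [gradient_bounded] and [lipschitz] this is done by a
    threshold [d] on the strain. Up to [d] the superquadratic remainder carries the small factor
    [phi d]. Above [d] the bond cannot be short, since the strain is of order [sqrt x] when [u] is
    square integrable and of order [x] when [u] is bounded; hence [rho x] is there at most a
    constant times [rho x * x ^+ 2]. Unimodality supplies the compactness: it gives decay at
    infinity uniformly in the norm, excludes translation of the mass, and is preserved by strains
    and by gradients. A unimodal square integrable function may be infinite at [0]. Until
    boundedness is known, functions therefore take values in [\bar R], and inequalities are arranged
    with nonnegative terms on both sides, so that nothing is subtracted. *)

Definition nnm d (T : measurableType d) (R : realType) (h : T -> \bar R) :=
  measurable_fun [set: T] h /\ forall x, (0 <= h x)%E.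

Section NonnegativeMeasurable.
Local Open Scope ereal_scope.
Context d (T : measurableType d) (R : realType) (mu : {measure set T -> \bar R}).
Implicit Types g h : T -> \bar R.

Lemma nnmD g h : nnm g -> nnm h -> nnm (fun x => g x + h x).
Proof.
move=> [mg g0] [mh h0]; split; first exact: emeasurable_funD.
by move=> x; rewrite adde_ge0.
Qed.

Lemma nnmM g h : nnm g -> nnm h -> nnm (fun x => g x * h x).
Proof.
move=> [mg g0] [mh h0]; split; first exact: emeasurable_funM.
by move=> x; rewrite mule_ge0.
Qed.

Lemma nnm_EFin (f : T -> R) : measurable_fun [set: T] f ->
  (forall x, 0 <= f x)%R -> nnm (fun x => (f x)%:E).
Proof. by move=> mf f0; split; [exact/measurable_EFinP|move=> x; rewrite lee_fin]. Qed.

Lemma nnm_cst (c : \bar R) : 0 <= c -> nnm (fun _ : T => c).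
Proof. by move=> c0; split. Qed.

Lemma nnmX h n : nnm h -> nnm (fun x => h x ^+ n).
Proof.
move=> hh; elim: n => [|n ih].
  rewrite (_ : (fun _ => _) = cst 1); last by apply/funext => x; rewrite expe0.
  exact: nnm_cst.
rewrite (_ : (fun _ => _) = (fun x => h x * h x ^+ n)); first exact: nnmM.
by apply/funext => x; rewrite expeS.
Qed.

Lemma nnm_ge0 h : nnm h -> 0 <= \int[mu]_x h x.
Proof. by case=> _ h0; exact: integral_ge0. Qed.

Lemma nnm_intD g h : nnm g -> nnm h ->
  \int[mu]_x (g x + h x) = \int[mu]_x g x + \int[mu]_x h x.
Proof. by move=> [mg g0] [mh h0]; rewrite ge0_integralD. Qed.

Lemma nnm_intZ (c : \bar R) h : 0 <= c -> nnm h ->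
  \int[mu]_x (c * h x) = c * \int[mu]_x h x.
Proof. by move=> c0 [mh h0]; rewrite ge0_integralZl. Qed.

Lemma nnm_le g h : nnm g -> nnm h -> (forall x, g x <= h x) ->
  \int[mu]_x g x <= \int[mu]_x h x.
Proof. by move=> [mg g0] [mh h0] gh; apply: ge0_le_integral. Qed.

Lemma nnm_int0 h : nnm h -> \int[mu]_x h x = 0 -> ae_eq mu setT h (cst 0).
Proof.
move=> [mh h0] H; apply/ae_eq_integral_abs => //.
by under eq_integral do rewrite gee0_abs//.
Qed.

Lemma nnm_ae_eq g h : nnm g -> nnm h -> ae_eq mu setT g h ->
  \int[mu]_x g x = \int[mu]_x h x.
Proof. by move=> [mg g0] [mh h0] gh; exact: ge0_ae_eq_integral. Qed.

End NonnegativeMeasurable.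

Arguments nnm_ge0 {d T R} mu {h}.
Arguments nnm_intD {d T R} mu {g h}.
Arguments nnm_intZ {d T R} mu c {h}.
Arguments nnm_le {d T R} mu {g h}.
Arguments nnm_int0 {d T R} mu {h}.
Arguments nnm_ae_eq {d T R} mu {g h}.

Lemma nnm_comp d1 d2 (T1 : measurableType d1) (T2 : measurableType d2)
  (R : realType) (h : T2 -> \bar R) (f : T1 -> T2) :
  nnm h -> measurable_fun [set: T1] f -> nnm (h \o f).
Proof. by move=> [mh h0] mf; split => [|x]; [exact: measurableT_comp|exact: h0]. Qed.

(* The instance of [SigmaFiniteMeasure] attached to [product_measure1] only covers
   sub-probabilities, hence this alias. *)
Definition plane_measure (R : realType) :
    set (measurableTypeR R * measurableTypeR R)%type -> \bar R :=
  (@lebesgue_measure R \x @lebesgue_measure R)%E.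
HB.instance Definition _ (R : realType) := Measure.on (@plane_measure R).

Lemma plane_measure_sigma_finite (R : realType) : sigma_finite setT (@plane_measure R).
Proof.
have /sigma_finiteP[F [TF ndF Foo]] := sigma_finiteT (@lebesgue_measure R).
exists (fun n => F n `*` F n).
  rewrite -setXTT TF predeqE => -[x y]; split.
    move=> [/= [n _ Fnx] [k _ Fky]]; exists (maxn n k) => //; split.
    - by move: x Fnx; exact/subsetPset/ndF/leq_maxl.
    - by move: y Fky; exact/subsetPset/ndF/leq_maxr.
  by move=> [n _ []/= ? ?]; split; exists n.
move=> k; have [? ?] := Foo k; split; first exact: measurableX.
rewrite /plane_measure product_measure1E// lte_mul_pinfty// ge0_fin_numE//.
Qed.
HB.instance Definition _ (R : realType) :=
  Measure_isSigmaFinite.Build _ _ _ (@plane_measure R) (@plane_measure_sigma_finite R).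

Section Box.
Context {R : realType}.
Local Notation mu := (@lebesgue_measure R).
Local Notation mu2 := (@plane_measure R).

Definition chi (p : R * R) (z : R) : R := if `|z - p.2| < p.1 / 2 then 1 else 0.

(* For [u = q'], [box u (x, s)] is the strain [q (s + x / 2) - q (s - x / 2)]. *)
Definition box (u : R -> \bar R) (p : R * R) : \bar R :=
  (\int[mu]_z ((chi p z)%:E * u z))%E.

(** The adjoint of [box], see [boxT_adj]. Windows of width [p.1 <= 0] contribute nothing, since
    [chi] vanishes for them. *)
Definition boxT (h : R * R -> \bar R) (z : R) : \bar R :=
  (\int[mu2]_p ((chi p z)%:E * h p))%E.

Lemma measurable_chi :
  measurable_fun [set: (R * R) * R] (fun q : (R * R) * R => chi q.1 q.2).
Proof.
apply: measurable_fun_ifT => //.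
apply: measurable_fun_ltr.
  apply: measurableT_comp => //.
  apply: measurable_funB => //.
  exact: measurableT_comp measurable_snd measurable_fst.
apply: measurable_funM => //.
exact: measurableT_comp measurable_fst measurable_fst.
Qed.

Lemma measurable_chi1 z : measurable_fun [set: R * R] (chi ^~ z).
Proof. exact: measurable_fun_pair1 measurable_chi. Qed.

Lemma measurable_chi2 p : measurable_fun [set: R] (chi p).
Proof. exact: measurable_fun_pair2 measurable_chi. Qed.

Lemma chi_ge0 p z : 0 <= chi p z.
Proof. by rewrite /chi; case: ifP. Qed.

Lemma nnm_chi : nnm (fun q : (R * R) * R => (chi q.1 q.2)%:E).
Proof. by apply: nnm_EFin measurable_chi _ => x; exact: chi_ge0. Qed.

Lemma nnm_chi1 z : nnm (fun p : R * R => (chi p z)%:E).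
Proof. by apply: nnm_EFin (measurable_chi1 z) _ => x; exact: chi_ge0. Qed.

Lemma nnm_chi2 p : nnm (fun z : R => (chi p z)%:E).
Proof. by apply: nnm_EFin (measurable_chi2 p) _ => x; exact: chi_ge0. Qed.

Lemma nnm_box u : nnm u -> nnm (box u).
Proof.
move=> nu; split; last by move=> p; rewrite /box; exact: (nnm_ge0 mu (nnmM (nnm_chi2 p) nu)).
have [mf f0] := nnmM nnm_chi (nnm_comp nu measurable_snd).
exact: (measurable_fun_fubini_tonelli_F (m2 := mu) _ mf f0).
Qed.

Lemma nnm_boxT h : nnm h -> nnm (boxT h).
Proof.
move=> nh; split; last by move=> p; rewrite /boxT; exact: (nnm_ge0 mu2 (nnmM (nnm_chi1 p) nh)).
have [mf f0] := nnmM nnm_chi (nnm_comp nh measurable_fst).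
exact: (measurable_fun_fubini_tonelli_G (m1 := mu2) _ mf f0).
Qed.

Lemma boxT_adj h v : nnm h -> nnm v ->
  (\int[mu]_z (boxT h z * v z) = \int[mu2]_p (h p * box v p))%E.
Proof.
move=> nh nv.
have [mf f0] := nnmM (nnmM nnm_chi (nnm_comp nh measurable_fst)) (nnm_comp nv measurable_snd).
have E := @fubini_tonelli _ _ _ _ _ mu2 mu _ mf f0.
transitivity (\int[mu]_y \int[mu2]_x ((chi x y)%:E * h x * v y))%E.
  apply: eq_integral => z _; rewrite muleC /boxT -(nnm_intZ mu2) ?nv.2//; last first.
    exact: nnmM (nnm_chi1 z) nh.
  by apply: eq_integral => p _; rewrite muleC.
rewrite -E; apply: eq_integral => p _.
rewrite /box -(nnm_intZ mu) ?nh.2//; last exact: nnmM (nnm_chi2 p) nv.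
by apply: eq_integral => z _ /=; rewrite muleCA muleA.
Qed.

Lemma chiE (p : R * R) z :
  chi p z = \1_(`]p.2 - p.1 / 2, p.2 + p.1 / 2[%classic) z.
Proof.
rewrite /chi indicE.
have -> : z \in `]p.2 - p.1 / 2, p.2 + p.1 / 2[%classic = (`|z - p.2| < p.1 / 2).
  by apply/idP/idP; rewrite inE/= in_itv/= ltr_distl.
by case: ifP.
Qed.

End Box.

Section BoxIntegrals.
Context {R : realType}.
Local Notation mu := (@lebesgue_measure R).
Local Notation mu2 := (@plane_measure R).

Lemma integral_chi2 (p : R * R) : 0 < p.1 -> (\int[mu]_z (chi p z)%:E = p.1%:E)%E.
Proof.
move=> p0; under eq_integral do rewrite chiE.
rewrite integral_indic// setIT -[LHS]/(mu `]p.2 - p.1 / 2, p.2 + p.1 / 2[%classic).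
rewrite lebesgue_measure_itv/= lte_fin ifT; first by rewrite -EFinB; congr EFin; lra.
lra.
Qed.

Lemma plane_tonelli (h : R * R -> \bar R) : nnm h ->
  (\int[mu2]_p h p = \int[mu]_x \int[mu]_y h (x, y))%E.
Proof. by move=> [mh h0]; exact: (fubini_tonelli1 (m1 := mu) (m2 := mu) h mh h0). Qed.

Lemma plane_swap (h : R * R -> \bar R) : nnm h ->
  (\int[mu]_x \int[mu]_y h (x, y) = \int[mu]_y \int[mu]_x h (x, y))%E.
Proof. by move=> [mh h0]; exact: (fubini_tonelli (m1 := mu) (m2 := mu) h mh h0). Qed.

Lemma chi_sym (x y z : R) : chi (x, y) z = chi (x, z) y.
Proof. by rewrite /chi/= distrC. Qed.

(** By [chi_sym] centre and point are interchangeable in a window, so each [z] lies in the windows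
    of width [x] for a set of centres of measure [x]. Tonelli turns this into the factor [x]. *)
Lemma integral_box (w : R -> \bar R) u : nnm w -> (forall x, x <= 0 -> w x = 0%E) -> nnm u ->
  (\int[mu2]_p (w p.1 * box u p) = (\int[mu]_x (w x * x%:E)) * \int[mu]_z u z)%E.
Proof.
move=> nw w0 nu.
rewrite plane_tonelli; last exact: nnmM (nnm_comp nw measurable_fst) (nnm_box nu).
rewrite /=.
have E x : 0 < x -> (\int[mu]_y box u (x, y) = x%:E * \int[mu]_z u z)%E.
  move=> x0.
  have ng := nnmM (nnm_comp nnm_chi (measurable_fun_pair (measurableT_comp
    (pair1_measurable x) measurable_fst) measurable_snd)) (nnm_comp nu measurable_snd).
  transitivity (\int[mu]_y \int[mu]_z ((chi (x, y) z)%:E * u z))%E => //.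
  etransitivity; [exact: (plane_swap ng)|rewrite /=].
  rewrite -(nnm_intZ mu)// ?lee_fin ?ltW//; apply: eq_integral => z _.
  under eq_integral do rewrite muleC chi_sym.
  by rewrite (nnm_intZ mu) ?integral_chi2// 1?muleC ?nu.2//; exact: nnm_chi2.
have -> : (\int[mu]_x (w x * x%:E) = \int[mu]_x (w x * `|x|%:E))%E.
  apply: eq_integral => x _; have [x0|x0] := leP 0 x; first by rewrite ger0_norm.
  by rewrite w0 ?mul0e// ltW.
have nx : nnm (fun x : R => `|x|%:E).
  by apply: nnm_EFin => //; exact: measurableT_comp.
rewrite muleC -(nnm_intZ mu); last 2 first.
- exact: (nnm_ge0 mu nu).
- exact: nnmM.
apply: eq_integral => x _; rewrite (nnm_intZ mu) ?nw.2//; last first.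
  exact: nnm_comp (nnm_box nu) (pair1_measurable x).
have [x0|x0] := leP x 0; first by rewrite w0// !mul0e mule0.
by rewrite E// gtr0_norm// [RHS]muleC muleA.
Qed.

End BoxIntegrals.

(** * Reflections and translations of Lebesgue integrals *)

Section LebesgueShift.
Context {R : realType}.
Local Notation mu := (@lebesgue_measure R).

Lemma integral_opp (f : R -> \bar R) : nnm f ->
  (\int[mu]_x f (- x)%R = \int[mu]_x f x)%E.
Proof.
move=> [mf f0].
have := @ge0_integral_pushforward _ _ _ _ R (-%R : measurableTypeR R -> measurableTypeR R)
  (@oppr_measurable R setT) mu setT f measurableT mf (fun y _ => f0 y).
rewrite preimage_setT => <-.
by apply: eq_measure_integral => //= A mA AS; exact: lebesgue_measureN.
Qed.

Lemma lebesgue_measure_shift (h : R) (A : set R) : measurable A ->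
  pushforward mu ((fun x => x + h) : measurableTypeR R -> measurableTypeR R) A = mu A.
Proof.
have mh : measurable_fun [set: R] (fun x : R => x + h) by exact: measurable_funD.
move=> mA; apply/esym/lebesgue_measure_unique => //= _ [[a b]] _ <-.
rewrite /pushforward.
have -> : (fun x => x + h) @^-1` `]a, b]%classic = `]a - h, b - h]%classic.
  by apply/seteqP; split => x /=; rewrite !in_itv/= ltrBlDr lerBrDr.
rewrite !lebesgue_measure_itv/= !lte_fin ltrD2r !EFinB; case: ifP => // _.
by rewrite -!EFinB; congr EFin; ring.
Qed.

Lemma integral_shift (h : R) (f : R -> \bar R) : nnm f ->
  (\int[mu]_x f (x + h)%R = \int[mu]_x f x)%E.
Proof.
move=> [mf f0].
have mh : measurable_fun [set: R] (fun x : R => x + h) by exact: measurable_funD.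
have := @ge0_integral_pushforward _ _ _ _ R ((fun x => x + h) : measurableTypeR R -> measurableTypeR R)
  mh mu setT f measurableT mf (fun y _ => f0 y).
rewrite preimage_setT => <-.
by apply: eq_measure_integral => //= A mA AS; exact: lebesgue_measure_shift.
Qed.

End LebesgueShift.

Section Unimodal.
Context {R : realType}.
Local Notation mu := (@lebesgue_measure R).
Local Notation mu2 := (@plane_measure R).

(* In particular [u] is even. *)
Definition unimodal (u : R -> \bar R) := forall x y, `|x| <= `|y| -> (u y <= u x)%E.

Lemma unimodal_opp u x : unimodal u -> u (- x) = u x.
Proof. by move=> uu; apply/eqP; rewrite eq_le !uu ?normrN. Qed.

(** The superlevel sets are intervals. *)
Lemma unimodal_measurable u : unimodal u -> measurable_fun [set: R] u.
Proof.
move=> uu; apply: (measurability _ (ErealGenOInfty.measurableE R)) => //.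
move=> _ [_ [c ->] <-]; apply: is_interval_measurable.
move=> x z [_ /= xc] [_ zc] y /andP[xy yz]; split => //=; move: xc zc; rewrite !in_itv/= !andbT => xc zc.
have [y0|y0] := leP 0 y.
  by apply: lt_le_trans zc _; apply: uu; rewrite !ger0_norm// (le_trans y0 yz).
apply: lt_le_trans xc _; apply: uu.
by rewrite !ler0_norm ?lerN2// ?(ltW y0)// (le_trans xy)// ltW.
Qed.

Lemma unimodal_nnm u : unimodal u -> (forall x, (0 <= u x)%E) -> nnm u.
Proof. by move=> uu u0; split => //; exact: unimodal_measurable. Qed.

Lemma box_opp u x s : nnm u -> unimodal u -> box u (x, - s) = box u (x, s).
Proof.
move=> nu uu; rewrite /box -integral_opp; last exact: nnmM (nnm_chi2 _) nu.
apply: eq_integral => z _; congr (_ * _)%E; last exact: unimodal_opp.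
by rewrite /chi/= -opprD normrN.
Qed.

(** With [t = u (s + x / 2)], a point only in the window farther from [0] has [u <= t], and a point
    only in the nearer one has [u >= t]. Integrating gives the claim, because both windows have the
    same length and [t] is finite; finiteness of [u] off [0] is needed for this cancellation. *)
Lemma box_unimodal u x : nnm u -> unimodal u -> (forall z, z != 0 -> (u z < +oo)%E) ->
  unimodal (fun s => box u (x, s)).
Proof.
move=> nu uu ufin s s'.
have [x0|x0] := leP x 0.
  move=> _; rewrite /box.
  suff E r : (\int[mu]_z ((chi (x, r) z)%:E * u z) = 0)%E by rewrite !E.
  apply: integral0_eq => z _; rewrite /chi/= ifF ?mul0e//.
  by apply/negbTE; rewrite -leNgt (@le_trans _ _ 0)//; lra.
wlog s0 : s s' / 0 <= s /\ 0 <= s' => [wl|].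
  have E t : box u (x, t) = box u (x, `|t|).
    by have [t0|t0] := leP 0 t; [rewrite ger0_norm|rewrite ltr0_norm// box_opp].
  by rewrite (E s) (E s'); move: wl => /(_ `|s| `|s'|); rewrite !normr_id; apply; split.
move: s0 => [s0 s'0]; rewrite !ger0_norm// => ss'.
pose t := u (s + x / 2).
have tfin : t \is a fin_num.
  by rewrite ge0_fin_numE ?nu.2// ufin// gt_eqF//; lra.
have t0 : (0 <= t)%E by exact: nu.2.
have nt : nnm (fun _ : R => t) by exact: nnm_cst.
have : (\int[mu]_z ((chi (x, s') z)%:E * u z + (chi (x, s) z)%:E * t)
     <= \int[mu]_z ((chi (x, s) z)%:E * u z + (chi (x, s') z)%:E * t))%E.
  apply: nnm_le => [| |z].
  - exact: (nnmD (nnmM (nnm_chi2 _) nu) (nnmM (nnm_chi2 _) nt)).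
  - exact: (nnmD (nnmM (nnm_chi2 _) nu) (nnmM (nnm_chi2 _) nt)).
  rewrite /chi/=; case: ifPn => z1; case: ifPn => z2; rewrite ?mul1e ?mul0e ?adde0 ?add0e//.
  - apply: uu; move: z1 z2; rewrite ltr_distl -leNgt ler_normr => /andP[z1 z3] z2.
    by rewrite [leLHS]ger0_norm ?ler_normr; [apply/orP; left; case/orP: z2; lra|lra].
  - apply: uu; move: z2; rewrite ltr_distl => /andP[z2 z3].
    by rewrite [leRHS]ger0_norm ?ler_norml; [apply/andP; split; lra|lra].
rewrite !nnm_intD//; try by apply: nnmM => //; exact: nnm_chi2.
under [X in (_ + X <= _)%E]eq_integral do rewrite muleC.
under [X in (_ <= _ + X)%E]eq_integral do rewrite muleC.
rewrite !nnm_intZ//; [|exact: nnm_chi2|exact: nnm_chi2].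
rewrite !integral_chi2// leeD2rE//.
by rewrite fin_numM.
Qed.

Lemma boxT_iter (h : R * R -> \bar R) z : nnm h ->
  boxT h z = (\int[mu]_x box (fun s => h (x, s)) (x, z))%E.
Proof.
move=> nh; rewrite /boxT plane_tonelli; last exact: nnmM (nnm_chi1 z) nh.
by apply: eq_integral => x _; apply: eq_integral => s _; rewrite chi_sym.
Qed.

(** By [boxT_iter] each slice at fixed width is a moving average of a unimodal function, so
    [box_unimodal] applies slice by slice. *)
Lemma boxT_unimodal (h : R * R -> \bar R) : nnm h ->
  (forall x, unimodal (fun s => h (x, s))) -> (forall p, (h p < +oo)%E) ->
  unimodal (boxT h).
Proof.
move=> nh uh hfin z z' zz'; rewrite (boxT_iter z nh) (boxT_iter z' nh).
have nb y : nnm (fun x => box (fun s => h (x, s)) (x, y)).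
  have [mf f0] := nnmM (nnm_chi1 y) nh.
  rewrite (_ : (fun _ => _) = fun x => (\int[mu]_s ((chi (x, s) y)%:E * h (x, s)))%E); last first.
    by apply/funext => x; apply: eq_integral => s _; rewrite chi_sym.
  split; first exact: (measurable_fun_fubini_tonelli_F (m2 := mu) _ mf f0).
  by move=> x; apply: integral_ge0 => s _; exact: f0.
apply: (nnm_le mu (nb z') (nb z)) => x; apply: box_unimodal => //.
exact: nnm_comp nh (pair1_measurable x).
Qed.

Lemma chi_le1 (p : R * R) (z : R) : chi p z <= 1.
Proof. by rewrite /chi; case: ifP. Qed.

Lemma box_le_int u (p : R * R) : nnm u -> (box u p <= \int[mu]_z u z)%E.
Proof.
move=> nu; apply: nnm_le => //; first exact: nnmM (nnm_chi2 _) nu.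
move=> z; rewrite -[leRHS]mul1e lee_wpmul2r ?nu.2// lee_fin.
exact: chi_le1.
Qed.

Lemma box_le u v (p : R * R) : nnm u -> nnm v -> (forall z, (u z <= v z)%E) ->
  (box u p <= box v p)%E.
Proof.
move=> nu nv uv; apply: nnm_le; [exact: nnmM (nnm_chi2 _) nu|exact: nnmM (nnm_chi2 _) nv|].
by move=> z; rewrite lee_wpmul2l// ?lee_fin ?chi_ge0.
Qed.

Lemma boxD u v (p : R * R) : nnm u -> nnm v ->
  box (fun z => u z + v z)%E p = (box u p + box v p)%E.
Proof.
move=> nu nv; rewrite /box -nnm_intD//; [|exact: nnmM (nnm_chi2 _) nu|exact: nnmM (nnm_chi2 _) nv].
by apply: eq_integral => z _; rewrite ge0_muleDr ?nu.2 ?nv.2.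
Qed.

Lemma boxZ c u (p : R * R) : (0 <= c)%E -> nnm u -> box (fun z => c * u z)%E p = (c * box u p)%E.
Proof.
move=> c0 nu; rewrite /box -nnm_intZ//; last exact: nnmM (nnm_chi2 _) nu.
by apply: eq_integral => z _; rewrite muleCA.
Qed.

Lemma box_cst (c : \bar R) (p : R * R) : 0 < p.1 -> (0 <= c)%E -> box (fun=> c) p = (c * p.1%:E)%E.
Proof.
move=> p0 c0; rewrite /box -integral_chi2// -nnm_intZ//; last exact: nnm_chi2.
by apply: eq_integral => z _; rewrite muleC.
Qed.

Lemma nnm_sq (u : R -> \bar R) : nnm u -> nnm (fun z => u z ^+ 2)%E.
Proof. exact: nnmX. Qed.

(* Cauchy-Schwarz in the form [2 t u <= t^2 + u^2], before optimising over [t]. *)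
Lemma box_young u (p : R * R) t : nnm u -> 0 < p.1 -> 0 <= t ->
  ((2 * t)%:E * box u p <= (t ^+ 2 * p.1)%:E + box (fun z => u z ^+ 2) p)%E.
Proof.
move=> nu p0 t0; have t2 : (0 <= (t ^+ 2)%:E :> \bar R)%E by rewrite lee_fin sqr_ge0.
rewrite -boxZ//; last by rewrite lee_fin; lra.
rewrite [(t ^+ 2 * p.1)%:E]EFinM -box_cst// -boxD//; last exact: nnm_sq.
apply: box_le.
- by apply: nnmM nu; apply: nnm_cst; rewrite lee_fin; lra.
- by apply: nnmD (nnm_sq nu); exact: nnm_cst.
move=> z; have := nu.2 z; case: (u z) => [r| |]// r0; last first.
  by rewrite expe2 mulyy addey// leey.
rewrite -EFinM -EFin_expe -EFinD lee_fin; have := sqr_ge0 (t - r); nra.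
Qed.

Lemma box_fin u (p : R * R) : nnm u -> 0 < p.1 -> (\int[mu]_z (u z ^+ 2) < +oo)%E ->
  box u p \is a fin_num.
Proof.
move=> nu p0 Tu; have := box_young nu p0 ler01.
rewrite ge0_fin_numE ?(nnm_box nu).2// => H.
have : ((2 * 1)%:E * box u p < +oo)%E.
  apply: le_lt_trans H _; rewrite lte_add_pinfty ?ltry//.
  exact: le_lt_trans (box_le_int p (nnm_sq nu)) Tu.
by case: (box u p) => [r _| |//]; rewrite ?ltry// gt0_muley ?lte_fin//; lra.
Qed.

Lemma box_CS u (p : R * R) : nnm u -> 0 < p.1 -> (\int[mu]_z (u z ^+ 2) < +oo)%E ->
  fine (box u p) ^+ 2 <= p.1 * fine (box (fun z => u z ^+ 2)%E p).
Proof.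
move=> nu p0 Tu.
have fb := box_fin nu p0 Tu.
have fs : box (fun z => u z ^+ 2)%E p \is a fin_num.
  rewrite ge0_fin_numE ?(nnm_box (nnm_sq nu)).2//.
  exact: le_lt_trans (box_le_int p (nnm_sq nu)) Tu.
have a0 : 0 <= fine (box u p) by rewrite fine_ge0// (nnm_box nu).2.
have := @box_young u p (fine (box u p) / p.1) nu p0 (divr_ge0 a0 (ltW p0)).
rewrite -{2}(fineK fb) -[X in (_ <= _ + X)%E](fineK fs) -EFinM -EFinD lee_fin.
move: (fine _) a0 => a a0; move: (fine _) => S.
rewrite -(ler_pM2l p0) mulrDr => H.
have E : p.1 * (2 * (a / p.1) * a) = 2 * a ^+ 2 by field; rewrite gt_eqF.
have E' : p.1 * ((a / p.1) ^+ 2 * p.1) = a ^+ 2 by field; rewrite gt_eqF.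
by move: H; rewrite E E'; lra.
Qed.

(** On the window of half-width [|z|] about [0], [u] is at least [u z]. This is the decay at
    infinity that is uniform in the norm. *)
Lemma unimodal_bound u z : nnm u -> unimodal u ->
  ((2 * `|z|)%:E * u z ^+ 2 <= \int[mu]_y (u y ^+ 2))%E.
Proof.
move=> nu uu; have [->|z0] := eqVneq z 0.
  by rewrite normr0 mulr0 mul0e (nnm_ge0 mu (nnm_sq nu)).
have z2 : 0 < (2 * `|z|, 0 : R).1 by rewrite /= mulr_gt0// normr_gt0.
rewrite -(integral_chi2 z2)/= muleC -nnm_intZ; [|exact: (nnm_sq nu).2|exact: nnm_chi2].
apply: nnm_le; [|exact: nnm_sq|].
  by apply: nnmM (nnm_chi2 _); apply: nnm_cst; exact: (nnm_sq nu).2.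
move=> y; rewrite /chi/= subr0; case: ifPn => yz; last by rewrite mule0 (nnm_sq nu).2.
rewrite mule1; apply: lee_pmul; rewrite ?nu.2//; apply: uu;
  by apply/ltW; apply: lt_le_trans yz _; lra.
Qed.

Lemma unimodal_fin u z : nnm u -> unimodal u -> (\int[mu]_y (u y ^+ 2) < +oo)%E ->
  z != 0 -> u z \is a fin_num.
Proof.
move=> nu uu Tu z0; rewrite ge0_fin_numE ?nu.2//.
have := le_lt_trans (unimodal_bound z nu uu) Tu.
have : (0 <= u z)%E by exact: nu.2.
case: (u z) => [r _ _| _ |//]; first by rewrite ltry.
by rewrite expe2 mulyy gt0_muley ?ltxx// lte_fin mulr_gt0// normr_gt0.
Qed.

End Unimodal.

(** * The energy *)

(* The micropotential [F] and its derivative [f] are cut off outside ]0, delta[; [kap] is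
   the stiffness at [0], and [rho * phi] controls the superquadratic remainder. *)
Record interaction (R : realType) (delta : R) (F f : R -> R -> R)
    (kap rho phi : R -> R) (C0 : R) : Prop := Interaction {
  i_delta_gt0 : 0 < delta;
  i_mF : measurable_fun [set: R * R] (fun p => F p.1 p.2);
  i_mf : measurable_fun [set: R * R] (fun p => f p.1 p.2);
  i_mkap : measurable_fun [set: R] kap;
  i_mrho : measurable_fun [set: R] rho;
  i_kap_ge0 : forall x, 0 <= kap x;
  i_rho_ge0 : forall x, 0 <= rho x;
  i_kap_out : forall x, ~~ (0 < x < delta) -> kap x = 0;
  i_rho_out : forall x, ~~ (0 < x < delta) -> rho x = 0;
  i_F_out : forall a x, ~~ (0 < x < delta) -> F a x = 0;
  i_f_out : forall a x, ~~ (0 < x < delta) -> f a x = 0;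
  i_C0_ge0 : 0 <= C0;
  i_kap_rho : forall x, kap x <= C0 * rho x;
  i_rho_int : (\int[lebesgue_measure]_x (rho x * x ^+ 2)%:E < +oo)%E;
  i_phi_ge0 : forall a, 0 <= a -> 0 <= phi a;
  i_phi_nd : forall a b, 0 <= a -> a <= b -> phi a <= phi b;
  i_phi_small : forall e, 0 < e -> exists2 d, 0 < d & phi d <= e;
  i_F_lb : forall a x, 0 <= a -> kap x / 2 * a ^+ 2 <= F a x;
  i_F_ub : forall a x, 0 <= a -> F a x <= (kap x + rho x * phi a) / 2 * a ^+ 2;
  i_f_ge0 : forall a x, 0 <= a -> 0 <= f a x;
  i_f_ub : forall a x, 0 <= a -> f a x <= (kap x + rho x * phi a) * a;
  i_F_f : forall a x, 0 <= a -> 2 * F a x <= f a x * a;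
  i_F_tangent : forall a b x, 0 <= a -> 0 <= b -> F a x + f a x * (b - a) <= F b x;
  i_f_nd : forall a b x, 0 <= a -> a <= b -> f a x <= f b x;
  i_f_lip : forall a b x, 0 <= a -> a <= b ->
    f b x - f a x <= (kap x + rho x * phi b) * (b - a);
  i_F_scale : forall s a x, 1 <= s -> 0 <= a -> s ^+ 2 * F a x <= F (s * a) x;
  i_F_cont : forall x, continuous (F ^~ x);
  i_F_strict : forall x, 0 < x < delta -> kap x / 2 * x ^+ 2 < F x x }.

Section Energy.
Context {R : realType}.
Local Notation mu := (@lebesgue_measure R).
Local Notation mu2 := (@plane_measure R).
Variables (delta : R) (F f : R -> R -> R) (kap rho phi : R -> R) (C0 : R).
Hypothesis I : interaction delta F f kap rho phi C0.

(** [fine] would send an infinite value to [0]; [box_fin] rules this out for positive widths when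
    the norm is finite. *)
Definition strain (u : R -> \bar R) (p : R * R) : R := fine (box u p).
Definition norm2 (u : R -> \bar R) : \bar R := (\int[mu]_z (u z ^+ 2))%E.
Definition energy (u : R -> \bar R) : \bar R :=
  (\int[mu2]_p (F (strain u p) p.1)%:E)%E.

Lemma energyE u : energy u = (\int[mu2]_p (F (strain u p) p.1)%:E)%E.
Proof. by []. Qed.

Lemma strain_ge0 u p : nnm u -> 0 <= strain u p.
Proof. by move=> nu; rewrite /strain fine_ge0// (nnm_box nu).2. Qed.

Lemma measurable_strain u : nnm u -> measurable_fun [set: R * R] (strain u).
Proof.
move=> nu; apply: measurableT_comp (nnm_box nu).1; exact: fine_measurable.
Qed.

Lemma F_ge0 a x : 0 <= a -> 0 <= F a x.
Proof.
move=> a0; apply: le_trans (i_F_lb I x a0).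
by rewrite mulr_ge0 ?sqr_ge0// divr_ge0// (i_kap_ge0 I).
Qed.

Lemma nnm_F u : nnm u -> nnm (fun p : R * R => (F (strain u p) p.1)%:E).
Proof.
move=> nu; apply: nnm_EFin => [|p]; last exact: F_ge0 (strain_ge0 _ nu).
exact: measurableT_comp (i_mF I) (measurable_fun_pair (measurable_strain nu) measurable_fst).
Qed.

Lemma nnm_f u : nnm u -> nnm (fun p : R * R => (f (strain u p) p.1)%:E).
Proof.
move=> nu; apply: nnm_EFin => [|p]; last exact: (i_f_ge0 I _ (strain_ge0 _ nu)).
exact: measurableT_comp (i_mf I) (measurable_fun_pair (measurable_strain nu) measurable_fst).
Qed.

(** The explicit factor [p.1] is the one produced by [box_CS]; integration over the centres gives
    another, whence the second moment of the weight. *)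
Lemma integral_box_sq (w : R -> R) u : measurable_fun [set: R] w ->
  (forall x, 0 <= w x) -> (forall x, ~~ (0 < x < delta) -> w x = 0) -> nnm u ->
  (\int[mu2]_p ((w p.1 * p.1)%:E * box (fun z => u z ^+ 2) p)
   = (\int[mu]_x (w x * x ^+ 2)%:E) * norm2 u)%E.
Proof.
move=> mw w0 wout nu.
have wx x : 0 <= w x * x.
  have [x0|x0] := leP 0 x; first by rewrite mulr_ge0.
  by rewrite wout ?mul0r// negb_and -leNgt (ltW x0).
rewrite (@integral_box R (fun x => (w x * x)%:E) (fun z => u z ^+ 2)%E); last 3 first.
- by apply: nnm_EFin => //; exact: measurable_funM.
- by move=> x x0; rewrite wout ?mul0r// negb_and -leNgt x0.
- exact: nnm_sq.
by congr (_ * _)%E; apply: eq_integral => x _; rewrite -EFinM -mulrA expr2.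
Qed.

Definition beta := fine (\int[mu]_x (rho x * x ^+ 2)%:E).
(** The square of the sound speed, by [sound_speedE]. *)
Definition csq := fine (\int[mu]_x (kap x * x ^+ 2)%:E).

Lemma nnm_wx2 (w : R -> R) : measurable_fun [set: R] w ->
  (forall x, 0 <= w x) -> nnm (fun x => (w x * x ^+ 2)%:E).
Proof.
move=> mw w0; apply: nnm_EFin => [|x]; last by rewrite mulr_ge0// sqr_ge0.
by apply: measurable_funM => //; exact: measurable_funX.
Qed.

Lemma betaE : (\int[mu]_x (rho x * x ^+ 2)%:E = beta%:E)%E.
Proof.
rewrite fineK// ge0_fin_numE ?(i_rho_int I)//.
by have [] := nnm_wx2 (i_mrho I) (i_rho_ge0 I); move=> _ ?; exact: integral_ge0.
Qed.

Lemma beta_ge0 : 0 <= beta.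
Proof. by rewrite -lee_fin -betaE (nnm_ge0 mu (nnm_wx2 (i_mrho I) (i_rho_ge0 I))). Qed.

Lemma csqE : (\int[mu]_x (kap x * x ^+ 2)%:E = csq%:E)%E.
Proof.
have nk := nnm_wx2 (i_mkap I) (i_kap_ge0 I).
rewrite fineK// ge0_fin_numE; last exact: (nnm_ge0 mu nk).
apply: (@le_lt_trans _ _ (C0%:E * beta%:E)%E); last by rewrite -EFinM ltry.
rewrite -betaE -nnm_intZ ?lee_fin ?(i_C0_ge0 I)//; last exact: nnm_wx2 (i_mrho I) (i_rho_ge0 I).
have nr := nnm_wx2 (i_mrho I) (i_rho_ge0 I).
have C00 : (0 <= C0%:E)%E by rewrite lee_fin (i_C0_ge0 I).
apply: (nnm_le mu nk (nnmM (nnm_cst _ C00) nr)) => x.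
by rewrite -EFinM lee_fin [leRHS]mulrA ler_wpM2r ?sqr_ge0// (i_kap_rho I).
Qed.

Lemma csq_ge0 : 0 <= csq.
Proof. by rewrite -lee_fin -csqE (nnm_ge0 mu (nnm_wx2 (i_mkap I) (i_kap_ge0 I))). Qed.

End Energy.

(** * Lower limits and Fatou's lemma *)

Section Fatou.
Context {R : realType}.

Lemma limn_einf_sup_einfs (y : nat -> \bar R) :
  limn_einf y = ereal_sup (range (einfs y)).
Proof. by rewrite limn_einf_lim; apply/cvg_lim => //; exact: cvg_einfs_sup. Qed.

Lemma limn_einf_ge_near (x : R) (y : nat -> R) e :
  (x%:E <= limn_einf (EFin \o y))%E -> 0 < e -> \forall n \near \oo, x - e < y n.
Proof.
rewrite limn_einf_sup_einfs => xy e0.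
have /ereal_sup_gt[_ [N _ <-] xN] : ((x - e)%:E < ereal_sup (range (einfs (EFin \o y))))%E.
  by apply: lt_le_trans xy; rewrite lte_fin ltrBlDr ltrDl.
exists N => // n /= Nn; rewrite -lte_fin; apply: lt_le_trans xN _.
by apply: ereal_inf_lbound; exists n.
Qed.

Lemma limn_einf_near_ge (x : R) (y : nat -> R) :
  (forall e, 0 < e -> \forall n \near \oo, x - e <= y n) ->
  (x%:E <= limn_einf (EFin \o y))%E.
Proof.
move=> H; rewrite limn_einf_sup_einfs; apply/lee_subgt0Pr => e e0.
have [N _ HN] := H e e0.
rewrite -EFinB; apply: (@le_trans _ _ (einfs (EFin \o y) N)).
  by apply: le_ereal_inf_tmp => _ [n /= Nn <-]; rewrite lee_fin HN.
by apply: ereal_sup_ubound; exists N.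
Qed.

(** Only a lower bound on the lower limit is required: [strain2], one term of the density in
    [lsc_eps], is lower semicontinuous but need not converge. *)
Lemma fatou_ae d (T : measurableType d) (mu : {measure set T -> \bar R})
    (g : nat -> T -> \bar R) (G : T -> \bar R) :
  (forall n, nnm (g n)) -> nnm G ->
  {ae mu, forall x, (G x <= limn_einf (g ^~ x))%E} ->
  (\int[mu]_x G x <= limn_einf (fun n => \int[mu]_x g n x))%E.
Proof.
move=> ng nG aeG.
have mg n : measurable_fun [set: T] (g n) by have [] := ng n.
have g0 n x : (0 <= g n x)%E by have [] := ng n.
have ml : measurable_fun [set: T] (fun x => limn_einf (g ^~ x)).
  rewrite (_ : (fun _ => _) = fun x => (- limn_esup (fun n => - g n x))%E); last first.
    by apply/funext => x.
  apply: measurableT_comp => //; apply: measurable_fun_limn_esup => n.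
  exact: measurableT_comp.
have l0 x : (0 <= limn_einf (g ^~ x))%E.
  rewrite limn_einf_sup_einfs; apply: (@le_trans _ _ (einfs (g ^~ x) 0)).
    by apply: le_ereal_inf_tmp => _ [n /= _ <-].
  by apply: ereal_sup_ubound; exists 0%N.
apply: (@le_trans _ _ (\int[mu]_x limn_einf (g ^~ x))%E).
  apply: ae_ge0_le_integral => //.
  - by move=> x _; exact: nG.2.
  - exact: nG.1.
  - by apply: filterS aeG => x ? _.
exact: (fatou mu measurableT mg (fun n x _ => g0 n x)).
Qed.

Lemma limn_einf_le_cvg (y c : nat -> \bar R) (l : \bar R) :
  (forall n, (y n <= c n)%E) -> c n @[n --> \oo] --> l -> (limn_einf y <= l)%E.
Proof.
move=> yc cl; rewrite -(cvg_limn_einf_sup cl).1 !limn_einf_sup_einfs.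
apply: ge_ereal_sup => _ [N _ <-].
apply: (@le_trans _ _ (einfs c N)); last by apply: ereal_sup_ubound; exists N.
apply: le_ereal_inf_tmp => _ [n /= Nn <-]; apply: le_trans (yc n).
by apply: ereal_inf_lbound; exists n.
Qed.

End Fatou.

(** * Strains: Cauchy-Schwarz, decay and truncation *)

Section StrainBounds.
Context {R : realType}.
Local Notation mu := (@lebesgue_measure R).
Local Notation mu2 := (@plane_measure R).

Definition strain2 (u : R -> \bar R) (p : R * R) : R := fine (box (fun z => u z ^+ 2)%E p).

Lemma box2_fin u (p : R * R) : nnm u -> (norm2 u < +oo)%E ->
  box (fun z => u z ^+ 2)%E p = (strain2 u p)%:E.
Proof.
move=> nu Tu; rewrite /strain2 fineK// ge0_fin_numE ?(nnm_box (nnm_sq nu)).2//.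
exact: le_lt_trans (box_le_int p (nnm_sq nu)) Tu.
Qed.

Lemma strain2_ge0 u (p : R * R) : nnm u -> 0 <= strain2 u p.
Proof. by move=> nu; rewrite /strain2 fine_ge0// (nnm_box (nnm_sq nu)).2. Qed.

Lemma measurable_strain2 u : nnm u -> measurable_fun [set: R * R] (strain2 u).
Proof.
move=> nu; apply: measurableT_comp (nnm_box (nnm_sq nu)).1; exact: fine_measurable.
Qed.

Lemma strain2_le u (p : R * R) r : nnm u -> (norm2 u <= r%:E)%E -> strain2 u p <= r.
Proof.
move=> nu Tu; rewrite -lee_fin -box2_fin//; last by rewrite (le_lt_trans Tu)// ltry.
exact: le_trans (box_le_int p (nnm_sq nu)) Tu.
Qed.

Lemma strain_CS u (p : R * R) : nnm u -> (norm2 u < +oo)%E -> 0 < p.1 ->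
  strain u p ^+ 2 <= p.1 * strain2 u p.
Proof. by move=> nu Tu p0; exact: box_CS. Qed.

(** The window stays in [|z| >= Z - delta], where [u] is at most a value [c] with
    [2 * (Z - delta) * c ^+ 2 <= r] by [unimodal_bound]. Cauchy-Schwarz then bounds the squared
    strain by [(p.1 * c) ^+ 2]. *)
Lemma strain_far delta u (p : R * R) r Z : nnm u -> unimodal u -> (norm2 u <= r%:E)%E ->
  0 < p.1 < delta -> delta < Z -> Z <= `|p.2| ->
  2 * (Z - delta) * strain u p ^+ 2 <= delta ^+ 2 * r.
Proof.
move=> nu uu Tu /andP[p0 pd] Zd Zp.
have Tu' : (norm2 u < +oo)%E by rewrite (le_lt_trans Tu)// ltry.
have r0 : 0 <= r by rewrite -lee_fin (le_trans _ Tu)// (nnm_ge0 mu (nnm_sq nu)).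
have z0 : Z - delta != 0 by rewrite gt_eqF// subr_gt0.
have uZ : u (Z - delta) = (fine (u (Z - delta)))%:E by rewrite fineK// (unimodal_fin nu uu).
set c := fine _ in uZ.
have cr : 2 * (Z - delta) * c ^+ 2 <= r.
  rewrite -lee_fin (le_trans _ Tu)//; have := unimodal_bound (Z - delta) nu uu.
  by rewrite uZ gtr0_norm ?subr_gt0// -EFin_expe -EFinM.
have S2 : strain2 u p <= c ^+ 2 * p.1.
  rewrite -lee_fin -box2_fin// EFinM -box_cst ?lee_fin ?sqr_ge0//.
  apply: nnm_le => //.
  - exact: nnmM (nnm_chi2 _) (nnm_sq nu).
  - by apply: nnmM (nnm_chi2 _) _; apply: nnm_cst; rewrite lee_fin sqr_ge0.
  move=> z; rewrite /chi; case: ifPn => [zp|_]; last by rewrite !mul0e.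
  rewrite !mul1e EFin_expe -uZ !expe2.
  have H : (u z <= u (Z - delta)%R)%E.
    apply: uu; rewrite gtr0_norm ?subr_gt0//.
    have := lerB_dist p.2 z; rewrite distrC; lra.
  by apply: lee_pmul; rewrite ?nu.2.
have := strain_CS nu Tu' p0.
move: (strain u p) (strain2 u p) S2 => a S S2 aS.
have S3 : a ^+ 2 <= c ^+ 2 * p.1 ^+ 2.
  by apply: le_trans aS _; rewrite expr2; apply: le_trans (ler_wpM2l (ltW p0) S2) _; rewrite mulrCA.
have S4 : p.1 ^+ 2 <= delta ^+ 2 by rewrite ler_sqr ?nnegrE; lra.
apply: (@le_trans _ _ (2 * (Z - delta) * (c ^+ 2 * p.1 ^+ 2))).
  by rewrite ler_wpM2l//; lra.
rewrite mulrA mulrC; apply: ler_pM; rewrite ?sqr_ge0// mulr_ge0 ?sqr_ge0//; lra.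
Qed.

(** Pointwise [u] is at most its truncation plus [u ^+ 2 / M], so truncating costs at most [r / M],
    uniformly over all [u] of norm at most [r]. This uniform integrability reduces [strain_cvg] to
    dominated convergence. *)
Lemma strain_trunc u (p : R * R) r M : nnm u -> (norm2 u <= r%:E)%E -> 0 < p.1 -> 0 < M ->
  let t := strain (fun z => mine (u z) M%:E) p in t <= strain u p <= t + r / M.
Proof.
move=> nu Tu p0 M0 /=.
have Tu' : (norm2 u < +oo)%E by rewrite (le_lt_trans Tu)// ltry.
have nt : nnm (fun z => mine (u z) M%:E).
  split; first by apply: measurable_mine => //; exact: nu.1.
  by move=> z; rewrite le_min nu.2 lee_fin ltW.
have le1 : (box (fun z => mine (u z) M%:E) p <= box u p)%E.
  by apply: box_le => // z; rewrite ge_min lexx.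
have fu := box_fin nu p0 Tu'.
have ft : box (fun z => mine (u z) M%:E) p \is a fin_num.
  by rewrite ge0_fin_numE ?(nnm_box nt).2// (le_lt_trans le1)// ltey_eq fu.
apply/andP; split; first by rewrite /strain fine_le.
have nM : nnm (fun z => (M^-1)%:E * u z ^+ 2)%E.
  by apply: nnmM (nnm_sq nu); apply: nnm_cst; rewrite lee_fin invr_ge0 ltW.
have : (box u p <= box (fun z => mine (u z) M%:E + (M^-1)%:E * u z ^+ 2) p)%E.
  apply: box_le => // [|z]; first exact: nnmD.
  have := nu.2 z; case: (u z) => [a| |]// a0; last first.
    by rewrite expe2 mulyy gt0_muley ?lte_fin ?invr_gt0// addey ?leey// minye.
  rewrite -EFin_expe -EFinM -EFin_min -EFinD lee_fin.
  have [aM|aM] := leP a M; first by rewrite lerDl mulr_ge0 ?sqr_ge0 ?invr_ge0 ?ltW.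
  apply: (@le_trans _ _ (M^-1 * a ^+ 2)); last by rewrite lerDr ltW.
  by rewrite expr2 mulrA ler_peMl// mulrC ler_pdivlMr// mul1r ltW.
rewrite boxD// boxZ//; [|by rewrite lee_fin invr_ge0 ltW|exact: nnm_sq].
rewrite box2_fin// -(fineK fu) -(fineK ft) -EFinM -EFinD lee_fin => H.
apply: le_trans H _; rewrite lerD2l [leLHS]mulrC ler_wpM2r ?invr_ge0 ?(ltW M0)//.
exact: strain2_le.
Qed.

End StrainBounds.

(** * Lower semicontinuity and existence of minimisers *)

Section Helly.
Context {R : realType}.
Local Notation mu := (@lebesgue_measure R).

(** An ultrafilter finer than the eventual filter gives all columns a limit at once, by compactness.
    For each [N] an index [n >= N] at which the first [N + 1] columns are close to their limits
    exists, because finitely many sets of the ultrafilter meet. The selection [s] need not be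
    increasing: [n <= s n] suffices for limits. *)
Lemma diagonal_cvg (g : nat -> nat -> R) (B : nat -> R) :
  (forall n k, 0 <= g n k <= B k) ->
  exists (l : nat -> R) (s : nat -> nat), [/\ forall n, (n <= s n)%N &
    forall k, g (s n) k @[n --> \oo] --> l k].
Proof.
move=> gB.
have [U [UU Uoo]] := ultraFilterLemma eventually_filter.
have PU : ProperFilter U by exact: ultra_proper.
have cl k : exists l : R, g n k @[n --> U] --> l.
  have FF : ProperFilter (g n k @[n --> U]) by exact: fmap_proper_filter.
  have [|l [_ cl]] := @segment_compact R 0 (B k) _ FF.
    have : \forall n \near U, `[0, B k]%classic (g n k) by apply: nearW => n /=; rewrite in_itv/=; exact: gB.
    exact.
  exists l => A Al; have [//|UA] := in_ultra_setVsetC ((g ^~ k) @^-1` A) UU.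
  by have [y []] := cl (~` A) A UA Al.
have [l lP] := choice cl; exists l.
have ex N : exists n, (N <= n)%N /\ forall k, (k <= N)%N -> `|l k - g n k| < N.+1%:R^-1.
  suff /filter_ex[n [n1 n2]] : U ([set n | (N <= n)%N] `&`
      [set n | forall k, (k <= N)%N -> `|l k - g n k| < N.+1%:R^-1]) by exists n.
  apply: filterI; first by apply: Uoo; exists N.
  have H : \forall n \near U, forall i : 'I_N.+1, `|l i - g n i| < N.+1%:R^-1.
    apply: filter_forall => i. 
    by have /cvgrPdist_lt := lP i; apply; rewrite invr_gt0.
  by apply: filterS H => n H k kN; have := H (Ordinal (n := N.+1) (m := k) kN).
have [s sP] := choice ex; exists s; split => [n|k]; first by have [] := sP n.
apply/cvgrPdist_lt => e e0.
near=> n.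
have [_ /(_ k)] := sP n; move=> H; apply: lt_trans (H _) _; first by near: n; exists k.
near: n; exact: near_infty_natSinv_lt (PosNum e0).
Unshelve. all: by end_near. Qed.

(** The bound is asked for off [0] only: it comes from [unimodal_bound], which says nothing at
    [0]. *)
Lemma helly (v : nat -> R -> \bar R) (B : R -> R) :
  (forall n, unimodal (v n)) -> (forall n x, (0 <= v n x)%E) ->
  (forall n x, x != 0 -> (v n x <= (B x)%:E)%E) ->
  exists (u : R -> \bar R) (s : nat -> nat),
    [/\ forall n, (n <= s n)%N, unimodal u, forall x, (0 <= u x)%E &
        {ae mu, forall x, v (s n) x @[n --> \oo] --> u x}].
Proof.
move=> uv v0 vB.
(* An enumeration of the positive rationals; codes of anything else are sent to [1], so that [r k]
   is always positive. *)
pose r k : R := if (unpickle k : option rat) is Some q then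
  (if 0 < q then ratr q else 1) else 1.
have r0 k : 0 < r k.
  by rewrite /r; case: unpickle => // q; case: ifPn => // q0; rewrite ltr0q.
have rd x y : 0 <= x -> x < y -> exists k, x < r k < y.
  move=> x0 xy; have [q] := rat_in_itvoo xy; rewrite in_itv/= => /andP[xq qy].
  exists (pickle q); rewrite /r pickleK ifT ?xq//.
  by rewrite -(ltr0q R) (le_lt_trans x0).
have vfin n x : x != 0 -> v n x \is a fin_num.
  by move=> x0; rewrite ge0_fin_numE//; apply: le_lt_trans (vB _ _ x0) _; rewrite ltry.
have vE n x : x != 0 -> v n x = (fine (v n x))%:E by move=> x0; rewrite fineK// vfin.
pose g n k := fine (v n (r k)).
have rn0 k : r k != 0 by rewrite gt_eqF.
have [l [s [sn gl]]] : exists (l : nat -> R) (s : nat -> nat),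
    [/\ forall n, (n <= s n)%N & forall k, g (s n) k @[n --> \oo] --> l k].
  apply: (diagonal_cvg (B := fun k => B (r k))) => n k.
  by rewrite fine_ge0//= -lee_fin -vE// vB.
have l0 k : 0 <= l k.
  apply: (ler_cvg_to (cvg_cst (0 : R)) (gl k)).
  by apply: nearW => n; rewrite fine_ge0.
have lmono j k : r j <= r k -> l k <= l j.
  move=> jk; apply: (ler_cvg_to (gl k) (gl j)).
  apply: nearW => n; rewrite -lee_fin -!vE//; apply: uv; by rewrite !gtr0_norm.
(* The supremum over sample points strictly beyond [|x|] makes [u] right continuous in [|x|], so
   convergence can only fail at jumps from the left. *)
pose u (x : R) := ereal_sup [set (l k)%:E | k in [set k | `|x| < r k]].
have uu : unimodal u.
  move=> x y xy; apply: ge_ereal_sup => _ [k /= yk <-].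
  apply: ereal_sup_ubound; exists k => //=; exact: le_lt_trans yk.
have u0 x : (0 <= u x)%E.
  have [k /andP[xk _]] := rd `|x| (`|x| + 1) (normr_ge0 _) ltac:(by rewrite ltrDl).
  apply: (@le_trans _ _ (l k)%:E); first by rewrite lee_fin.
  by apply: ereal_sup_ubound; exists k.
have ul k x : r k <= `|x| -> (u x <= (l k)%:E)%E.
  move=> kx; apply: ge_ereal_sup => _ [j /= xj <-].
  by rewrite lee_fin lmono// (le_trans kx)// ltW.
have ufin x : x != 0 -> u x \is a fin_num.
  move=> x0; have [k /andP[_ kx]] := rd 0 `|x| (lexx 0) ltac:(by rewrite normr_gt0).
  by rewrite ge0_fin_numE//; apply: le_lt_trans (ul k x (ltW kx)) _; rewrite ltry.
exists u, s; split => //.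
(* The jumps of [u] as [|x|] is approached from [0]. A rational in the gap together with the sign of
   [x] determines [x], so [N] is countable. *)
pose N := [set x : R | x != 0 /\ exists q : rat, (u x < (ratr q)%:E)%E /\
  forall y, 0 < y -> y < `|x| -> ((ratr q)%:E <= u y)%E].
have cN : countable N.
  have /choice[q qP] : forall x, exists q : rat, N x -> (u x < (ratr q)%:E)%E /\
      forall y, 0 < y -> y < `|x| -> ((ratr q)%:E <= u y)%E.
    move=> x; have [[_ [q qx]]|nx] := pselect (N x); first by exists q.
    by exists 0.
  apply/countable_injP; exists (fun x => pickle (0 < x, q x)) => x y.
  rewrite !inE => Nx Ny /(pcan_inj pickleK)[sxy qxy].
  have [[x0 _] [y0 _]] := (Nx, Ny).
  have [ux qx] := qP x Nx; have [uy qy] := qP y Ny.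
  have lt_abs z t : N z -> N t -> q z = q t -> `|z| < `|t| -> False.
    move=> Nz Nt zt lzt; have [uz _] := qP z Nz; have [_ qt] := qP t Nt.
    have [z0 _] := Nz.
    have := qt `|z|; rewrite normr_gt0 => /(_ z0 lzt); rewrite -zt leNgt.
    suff -> : u `|z| = u z by rewrite uz.
    by apply/eqP; rewrite eq_le !uu ?normr_id.
  have [xy|xy|] := ltgtP `|x| `|y|.
  - by case: (lt_abs x y).
  - by case: (lt_abs y x).
  move: sxy; have [xp|xn] := ltP 0 x; have [yp|yn] := ltP 0 y => // _.
    by rewrite !gtr0_norm.
  by rewrite !ler0_norm// => /oppr_inj.
have neg A : countable A -> mu.-negligible A.
  move=> cA; exists A; split => //; last exact: countable_lebesgue_measure0.
  exact: countable_measurable.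
apply: (negligibleS _ (negligibleU (neg _ cN) (neg _ (finite_set_countable (finite_set1 0))))).
move=> x /= nx; apply: contrapT => /not_orP[Nx /eqP x0]; apply: nx.
rewrite -(fineK (ufin x x0)); apply/fine_cvgP; split.
  by apply: nearW => n; exact: vfin.
apply/cvgrPdist_lt => e e0.
(* Sample points on either side of [|x|] squeeze [v (s n) x]: the outer one exists by definition of
   the supremum, the inner one because [x] is not a jump. *)
have [k1 xk1 lk1] : exists2 k, `|x| < r k & fine (u x) - e < l k.
  have : ((fine (u x) - e)%:E < u x)%E.
    by rewrite -[ltRHS](fineK (ufin x x0)) lte_fin ltrBlDr ltrDl.
  by move=> /ereal_sup_gt[_ [k /= xk <-]]; rewrite lte_fin; exists k.
have [k2 xk2 lk2] : exists2 k, r k < `|x| & l k < fine (u x) + e.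
  have [q] := @rat_in_itvoo R (fine (u x)) (fine (u x) + e) ltac:(by rewrite ltrDl).
  rewrite in_itv/= => /andP[q1 q2].
  have : exists y, [/\ 0 < y, y < `|x| & (u y < (ratr q)%:E)%E].
    apply: contrapT => /forallNP H; apply: Nx; split => //; exists q; split.
      by rewrite -(fineK (ufin x x0)) lte_fin.
    by move=> y y0 yx; rewrite leNgt; apply/negP => uy; apply: (H y).
  move=> [y [y0 yx uy]]; have [k /andP[yk kx]] := rd y `|x| (ltW y0) yx.
  exists k => //; apply: lt_trans q2; rewrite -lte_fin; apply: le_lt_trans uy.
  by apply: ereal_sup_ubound; exists k => //=; rewrite gtr0_norm.
have H1 : \forall n \near \oo, fine (u x) - e < g (s n) k1.
  have := gl k1 => /cvgr_gt; exact.
have H2 : \forall n \near \oo, g (s n) k2 < fine (u x) + e.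
  have := gl k2 => /cvgr_lt; exact.
near=> n.
have h1 : fine (u x) - e < g (s n) k1 by near: n.
have h2 : g (s n) k2 < fine (u x) + e by near: n.
have h3 : g (s n) k1 <= fine (v (s n) x).
  by rewrite -lee_fin -!vE//; apply: uv; rewrite [leRHS]gtr0_norm// ltW.
have h4 : fine (v (s n) x) <= g (s n) k2.
  by rewrite -lee_fin -!vE//; apply: uv; rewrite [leLHS]gtr0_norm// ltW.
by rewrite /= ltr_distlC; apply/andP; split; lra.
Unshelve. all: by end_near. Qed.

End Helly.

#[global] Instance lebesgue_ae_filter (R : realType) :
  Filter (almost_everywhere (@lebesgue_measure R)) := ae_filter_ringOfSetsType _.

(** * Convergence of strains *)

Section StrainLimits.
Context {R : realType}.
Local Notation mu := (@lebesgue_measure R).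
Local Notation mu2 := (@plane_measure R).
Variables (v : nat -> R -> \bar R) (u : R -> \bar R) (r : R).
Hypothesis nv : forall n, nnm (v n).
Hypothesis nu : nnm u.
Hypothesis vr : forall n, (norm2 (v n) <= r%:E)%E.
Hypothesis vu : {ae mu, forall x, v n x @[n --> \oo] --> u x}.

Lemma cvge_sq (y : nat -> \bar R) (l : \bar R) : (forall n, (0 <= y n)%E) -> (0 <= l)%E ->
  y n @[n --> \oo] --> l -> (y n ^+ 2)%E @[n --> \oo] --> (l ^+ 2)%E.
Proof.
move=> y0 l0 yl.
under eq_fun do rewrite expe2.
rewrite expe2; apply: cvgeM => //.
by case: l l0 {yl} => // r _; exact: mule_def_fin.
Qed.

Lemma cvge_min_cst (y : nat -> \bar R) (l : \bar R) (M : R) : (0 <= l)%E ->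
  y n @[n --> \oo] --> l -> mine (y n) M%:E @[n --> \oo] --> mine l M%:E.
Proof.
case: l => [l _|_|//].
  move=> /fine_cvgP[yfin yl]; rewrite -EFin_min; apply/fine_cvgP; split.
    by apply: filterS yfin => n /fineK <-; rewrite -EFin_min.
  apply/cvgrPdist_lt => e e0; move/cvgrPdist_lt : yl => /(_ e e0) yl.
  near=> n.
  have yn : y n \is a fin_num by near: n.
  have : `|l - fine (y n)| < e by near: n.
  rewrite /= -(fineK yn) -EFin_min/= !ltr_distlC => /andP[h1 h2].
  by case: (leP (fine (y n)) M); case: (leP l M) => h3 h4; apply/andP; split; lra.
move=> /cvgeyPge/(_ M) yM; rewrite minye; apply: cvg_near_cst.
by apply: filterS yM => n Mn; apply/eqP; rewrite eq_le ge_min lexx orbT le_min Mn lexx.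
Unshelve. all: by end_near. Qed.

Lemma norm2_limit : (norm2 u <= limn_einf (fun n => norm2 (v n)))%E.
Proof.
apply: fatou_ae => [n| |]; [exact: nnm_sq|exact: nnm_sq|].
move: vu; apply: filterS => x vux.
have H := cvge_sq (fun n => (nv n).2 x) (nu.2 x) vux.
by rewrite (cvg_limn_einf_sup H).1.
Qed.

Lemma norm2_limit_le : (norm2 u <= r%:E)%E.
Proof.
apply: le_trans norm2_limit _.
exact: (limn_einf_le_cvg (c := fun=> r%:E) vr (cvg_cst _)).
Qed.

Lemma strain2_liminf (p : R * R) e : 0 < e ->
  \forall n \near \oo, strain2 u p - e < strain2 (v n) p.
Proof.
apply: limn_einf_ge_near.
have fin w : (norm2 w <= r%:E)%E -> (norm2 w < +oo)%E.
  by move=> H; apply: le_lt_trans H _; rewrite ltry.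
rewrite (_ : _ \o _ = fun n => box (fun z => v n z ^+ 2)%E p); last first.
  by apply/funext => n; rewrite box2_fin// fin.
rewrite -box2_fin//; last exact: fin norm2_limit_le.
apply: fatou_ae => [n| |].
- exact: nnmM (nnm_chi2 _) (nnm_sq (nv n)).
- exact: nnmM (nnm_chi2 _) (nnm_sq nu).
move: vu; apply: filterS => x vux.
have H := cvge_sq (fun n => (nv n).2 x) (nu.2 x) vux.
by have /cvg_limn_einf_sup[-> _] : ((chi p x)%:E * v n x ^+ 2)%E @[n --> \oo]
  --> ((chi p x)%:E * u x ^+ 2)%E by exact: cvgeZl.
Qed.

(** Truncated at [M], the integrands are dominated by [M * chi]; the rest is at most [r / M < e / 2]
    uniformly in [n]. Thus the strains converge even if norm is lost in the limit. *)
Lemma strain_cvg (p : R * R) : 0 < p.1 -> strain (v n) p @[n --> \oo] --> strain u p.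
Proof.
move=> p0; apply/cvgrPdist_lt => e e0.
have r0 : 0 <= r by rewrite -lee_fin (le_trans _ (vr 0))// (nnm_ge0 mu (nnm_sq (nv 0))).
pose M := 2 * r / e + 1.
have M0 : 0 < M by rewrite ltr_wpDl// divr_ge0 ?mulr_ge0// ltW.
have rM : r / M < e / 2.
  rewrite ltr_pdivrMr// /M mulrDr mulr1 mulrA.
  have -> : e / 2 * (2 * r) / e = r by field; rewrite gt_eqF.
  by rewrite ltrDl divr_gt0.
pose t (w : R -> \bar R) := strain (fun z => mine (w z) M%:E) p.
have nt (w : R -> \bar R) : nnm w -> nnm (fun z : R => mine (w z) M%:E).
  move=> nw; split; first by apply: measurable_mine => //; exact: nw.1.
  by move=> z; rewrite le_min nw.2 lee_fin ltW.
have nMc : nnm (fun z => (chi p z)%:E * M%:E)%E.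
  by apply: nnmM (nnm_chi2 _) _; apply: nnm_cst; rewrite lee_fin ltW.
have intM : (\int[mu]_z ((chi p z)%:E * M%:E) = (M * p.1)%:E)%E.
  by rewrite EFinM -box_cst// lee_fin ltW.
have tcvg : t (v n) @[n --> \oo] --> t u.
  have [|||||_ _] := @dominated_convergence _ _ R mu setT measurableT
    (fun n z => (chi p z)%:E * mine (v n z) M%:E)%E
    (fun z => (chi p z)%:E * mine (u z) M%:E)%E (fun z => (chi p z)%:E * M%:E)%E.
  - by move=> n; have [] := nnmM (nnm_chi2 p) (nt _ (nv n)).
  - by have [] := nnmM (nnm_chi2 p) (nt _ nu).
  - move: vu; apply: filterS => z vuz _; apply: cvgeZl => //.
    exact: cvge_min_cst (nu.2 z) vuz.
  - apply/integrableP; split; first by have [] := nMc.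
    under eq_integral do rewrite gee0_abs ?nMc.2//.
    by rewrite intM ltry.
  - apply: aeW => z n _; rewrite gee0_abs; last by have [_] := nnmM (nnm_chi2 p) (nt _ (nv n)); exact.
    by rewrite lee_wpmul2l ?lee_fin ?chi_ge0// ge_min lexx orbT.
  move=> H; apply: fine_cvg; apply: cvg_trans H _ => /=.
  rewrite /t /strain fineK// ge0_fin_numE; last by have [_] := nnm_box (nt _ nu); exact.
  apply: (@le_lt_trans _ _ (M * p.1)%:E); last by rewrite ltry.
  rewrite -intM; apply: (nnm_le mu (nnmM (nnm_chi2 p) (nt _ nu)) nMc) => z.
  by rewrite lee_wpmul2l ?lee_fin ?chi_ge0// ge_min lexx orbT.
have tv w : nnm w -> (norm2 w <= r%:E)%E -> t w <= strain w p <= t w + r / M.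
  by move=> nw wr; exact: strain_trunc.
have /cvgrPdist_lt/(_ (e / 2) ltac:(by rewrite divr_gt0))H := tcvg.
near=> n.
have := tv _ (nv n) (vr n); have := tv _ nu norm2_limit_le.
have : `|t u - t (v n)| < e / 2 by near: n.
rewrite !ltr_distlC => /andP[h1 h2] /andP[h3 h4] /andP[h5 h6].
apply/andP; split; lra.
Unshelve. all: by end_near. Qed.

End StrainLimits.

Ltac nneg := repeat first [ assumption | exact: ltW | done | exact: sqr_ge0
  | apply: divr_ge0 | apply: mulr_ge0 | apply: addr_ge0 ].

(** * Energy bounds and lower semicontinuity with loss of norm *)

Section LowerSemicontinuity.
Context {R : realType}.
Local Notation mu := (@lebesgue_measure R).
Local Notation mu2 := (@plane_measure R).
Variables (delta : R) (F f : R -> R -> R) (kap rho phi : R -> R) (C0 : R).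
Hypothesis I : interaction delta F f kap rho phi C0.
Local Notation energy := (energy F).
Local Notation csq := (csq kap).
Local Notation beta := (beta rho).

Lemma norm2_fin u r : (norm2 u <= r%:E)%E -> (norm2 u < +oo :> \bar R)%E.
Proof. by move=> ur; apply: le_lt_trans ur _; rewrite ltry. Qed.

Lemma norm2_ge0 (u : R -> \bar R) : nnm u -> (0 <= norm2 u)%E.
Proof. by move=> nu; exact: (nnm_ge0 mu (nnm_sq nu)). Qed.

Lemma strain_le u (p : R * R) r : nnm u -> (norm2 u <= r%:E)%E -> 0 < p.1 < delta ->
  strain u p ^+ 2 <= p.1 * r /\ strain u p <= Num.sqrt (delta * r).
Proof.
move=> nu ur /andP[p0 pd].
have r0 : 0 <= r by rewrite -lee_fin (le_trans _ ur)// norm2_ge0.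
have H : strain u p ^+ 2 <= p.1 * r.
  apply: le_trans (strain_CS nu (norm2_fin ur) p0) _.
  by rewrite ler_pM2l// strain2_le.
split=> //; rewrite -(ger0_norm (strain_ge0 p nu)) -sqrtr_sqr ler_wsqrtr//.
by apply: le_trans H _; rewrite ler_wpM2r// ltW.
Qed.

Lemma integral_strain2 (w : R -> R) u : measurable_fun [set: R] w ->
  (forall x, 0 <= w x) -> (forall x, ~~ (0 < x < delta) -> w x = 0) -> nnm u ->
  (norm2 u < +oo)%E ->
  (\int[mu2]_p (w p.1 * p.1 * strain2 u p)%:E = (\int[mu]_x (w x * x ^+ 2)%:E) * norm2 u)%E.
Proof.
move=> mw w0 wout nu Tu; rewrite -(integral_box_sq mw w0 wout nu).
by apply: eq_integral => p _; rewrite box2_fin// EFinM.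
Qed.

Lemma nnm_wstrain2 (w : R -> R) u : measurable_fun [set: R] w ->
  (forall x, 0 <= w x) -> (forall x, ~~ (0 < x < delta) -> w x = 0) -> nnm u ->
  nnm (fun p : R * R => (w p.1 * p.1 * strain2 u p)%:E).
Proof.
move=> mw w0 wout nu; apply: nnm_EFin => [|p].
  apply: measurable_funM; last exact: measurable_strain2.
  by apply: measurable_funM => //; exact: measurableT_comp mw measurable_fst.
rewrite mulr_ge0 ?strain2_ge0//.
have [x0|x0] := leP 0 p.1; first by rewrite mulr_ge0.
by rewrite wout ?mul0r// negb_and -leNgt (ltW x0).
Qed.

Lemma w_facts (a b : R) : 0 <= a -> 0 <= b ->
  [/\ measurable_fun [set: R] (fun x => a * kap x + b * rho x),
      forall x, 0 <= a * kap x + b * rho x,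
      forall x, ~~ (0 < x < delta) -> a * kap x + b * rho x = 0 &
      (\int[mu]_x ((a * kap x + b * rho x) * x ^+ 2)%:E = (a * csq + b * beta)%:E)%E].
Proof.
move=> a0 b0.
have nk := nnm_wx2 (i_mkap I) (i_kap_ge0 I).
have nr := nnm_wx2 (i_mrho I) (i_rho_ge0 I).
split=> [|x|x xo|].
- apply: measurable_funD; apply: measurable_funM => //; [exact: i_mkap I|exact: i_mrho I].
- by rewrite addr_ge0// mulr_ge0// ?(i_kap_ge0 I) ?(i_rho_ge0 I).
- by rewrite (i_kap_out I)// (i_rho_out I)// !mulr0 addr0.
transitivity (\int[mu]_x (a%:E * (kap x * x ^+ 2)%:E + b%:E * (rho x * x ^+ 2)%:E))%E.
  by apply: eq_integral => x _; rewrite -!EFinM -EFinD; congr EFin; ring.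
rewrite (nnm_intD mu (nnmM (nnm_cst _ _) nk) (nnmM (nnm_cst _ _) nr)) ?lee_fin//.
by rewrite (nnm_intZ mu)// (nnm_intZ mu)// (csqE I) (betaE I).
Qed.

(** No strain exceeds [Num.sqrt (delta * r)], so [phi] can be frozen at that value; the quadratic
    density that remains integrates to [csq] and [beta] times the norm. *)
Lemma energy_le u r : nnm u -> (norm2 u <= r%:E)%E ->
  (energy u <= ((csq + beta * phi (Num.sqrt (delta * r))) / 2)%:E * norm2 u)%E.
Proof.
move=> nu ur; set A := Num.sqrt _.
have A0 : 0 <= A by exact: sqrtr_ge0.
have h0 : 0 <= (2 : R)^-1 by rewrite invr_ge0.
have h1 : 0 <= phi A / 2 by rewrite divr_ge0// (i_phi_ge0 I).
have [mw w0 wout wE] := w_facts h0 h1.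
have -> : (csq + beta * phi A) / 2 = 2^-1 * csq + phi A / 2 * beta by field.
rewrite -wE -(integral_strain2 mw w0 wout nu (norm2_fin ur)).
apply: (nnm_le mu2 (nnm_F I nu) (nnm_wstrain2 mw w0 wout nu)) => p.
rewrite lee_fin; have [pin|pout] := boolP (0 < p.1 < delta); last first.
  by rewrite (i_F_out I)// wout// !mul0r.
have [_ sA] := strain_le nu ur pin; move/andP: pin => [p0 _].
have s0 := strain_ge0 p nu.
apply: le_trans (i_F_ub I _ s0) _.
have -> : 2^-1 * kap p.1 + phi A / 2 * rho p.1 = (kap p.1 + rho p.1 * phi A) / 2 by field.
rewrite -[leRHS]mulrA; apply: ler_pM.
- by rewrite divr_ge0// addr_ge0 ?(i_kap_ge0 I)// mulr_ge0 ?(i_rho_ge0 I)// (i_phi_ge0 I).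
- exact: sqr_ge0.
- by rewrite ler_pM2r ?invr_gt0// lerD2l ler_wpM2l ?(i_rho_ge0 I)// (i_phi_nd I).
- exact: (strain_CS nu (norm2_fin ur) p0).
Qed.

Lemma energy_lty u : nnm u -> (norm2 u < +oo)%E -> (energy u < +oo)%E.
Proof.
move=> nu Tu.
have uE : norm2 u = (fine (norm2 u))%:E by rewrite fineK// ge0_fin_numE// norm2_ge0.
apply: le_lt_trans (@energy_le u (fine (norm2 u)) nu _) _; first by rewrite -uE.
by rewrite uE -EFinM ltry.
Qed.

Section Lsc.
Variables (v : nat -> R -> \bar R) (u : R -> \bar R) (r : nat -> R) (rmax rlim K : R).
Hypothesis nv : forall n, nnm (v n).
Hypothesis uv : forall n, unimodal (v n).
Hypothesis nu : nnm u.
Hypothesis uu : unimodal u.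
Hypothesis vr : forall n, (norm2 (v n) <= (r n)%:E)%E.
Hypothesis rr : forall n, r n <= rmax.
Hypothesis rl : r n @[n --> \oo] --> rlim.
Hypothesis vK : forall n, (K%:E <= energy (v n))%E.
Hypothesis vu : {ae mu, forall x, v n x @[n --> \oo] --> u x}.

Let vrm n : (norm2 (v n) <= rmax%:E)%E.
Proof. by apply: le_trans (vr n) _; rewrite lee_fin. Qed.

Let urm : (norm2 u <= rmax%:E)%E.
Proof. exact: (norm2_limit_le nv nu vrm vu). Qed.

Let rmax0 : 0 <= rmax.
Proof. by rewrite -lee_fin (le_trans _ urm)// norm2_ge0. Qed.

Let w e x := 2^-1 * kap x + e * rho x.
(** The integral of [cut] is finite and does not depend on the function, so it cancels in [lsc_eps];
    its only purpose is to make [dens] nonnegative, as Fatou's lemma requires. *)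
Let cut Cb Z (p : R * R) := Cb * (rho p.1 * p.1 ^+ 2) * chi (2 * Z, 0) p.2.
Let dens e Cb Z (z : R -> \bar R) (p : R * R) :=
  w e p.1 * p.1 * strain2 z p + cut Cb Z p - F (strain z p) p.1.

(* Outside a region where the short-range strains and the far strains are small, the
   superquadratic part of the energy density is absorbed by [e * rho]. *)
Lemma dens_ge0 e : 0 < e -> exists Cb Z, [/\ 0 <= Cb, 0 < Z &
  forall z p, nnm z -> unimodal z -> (norm2 z <= rmax%:E)%E -> 0 <= dens e Cb Z z p].
Proof.
move=> e0; have d0 := i_delta_gt0 I.
have [d d_gt0 phid] := i_phi_small I (mulr_gt0 (@ltr0Sn R 1) e0).
set A := Num.sqrt (delta * rmax).
have A0 : 0 <= A by exact: sqrtr_ge0.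
have phA := i_phi_ge0 I A0.
(* A strain above [d] satisfies [d ^+ 2 < p.1 * rmax], hence [p.1 >= eta]; by [strain_far] and the
   choice of [q] it cannot occur at a centre beyond [Z]. On the region that is left,
   [p.1 ^+ 2 / eta ^+ 2 >= 1] lets [cut] dominate the remainder, which gives the constant [Cb]
   below. *)
pose eta := d ^+ 2 / (rmax + 1).
have eta0 : 0 < eta by rewrite divr_gt0 ?exprn_gt0// ltr_wpDl.
pose q := delta ^+ 2 * rmax / (2 * d ^+ 2).
have q0 : 0 <= q by rewrite /q; nneg.
pose Z := delta + q + 1.
have Z0 : 0 < Z by rewrite /Z; lra.
have Zd : delta < Z by rewrite /Z; lra.
exists (phi A * A ^+ 2 / (2 * eta ^+ 2)), Z; split.
- nneg.
- by [].
move=> z p nz uz zr; rewrite /dens/cut.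
have [pin|pout] := boolP (0 < p.1 < delta); last first.
  by rewrite /w (i_kap_out I)// (i_rho_out I)// (i_F_out I)// !(mulr0, mul0r, addr0, subr0).
have [sr sA] := strain_le nz zr pin.
have s0 := strain_ge0 p nz; have /andP[p0 pd] := pin.
have CS := strain_CS nz (norm2_fin zr) p0.
have k0 := i_kap_ge0 I p.1; have r0 := i_rho_ge0 I p.1.
have Fub := i_F_ub I p.1 s0.
set a := strain z p in sr sA s0 CS Fub *; set S := strain2 z p in CS *.
have H1 : w e p.1 * p.1 * S >= (kap p.1 + rho p.1 * (2 * e)) / 2 * a ^+ 2.
  have -> : w e p.1 * p.1 * S = (kap p.1 + rho p.1 * (2 * e)) / 2 * (p.1 * S) by rewrite /w; field.
  by rewrite ler_wpM2l//; nneg.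
have chi0 := chi_ge0 (2 * Z, 0) p.2.
have cut0 : 0 <= phi A * A ^+ 2 / (2 * eta ^+ 2) * (rho p.1 * p.1 ^+ 2) * chi (2 * Z, 0) p.2.
  by nneg.
have [ad|da] := leP a d.
  have H2 : phi a <= 2 * e by apply: le_trans (i_phi_nd I s0 ad) phid.
  have H3 : (kap p.1 + rho p.1 * phi a) / 2 * a ^+ 2 <=
            (kap p.1 + rho p.1 * (2 * e)) / 2 * a ^+ 2.
    by rewrite ler_wpM2r ?sqr_ge0// ler_pM2r ?invr_gt0// lerD2l ler_wpM2l.
  lra.
have etax : eta <= p.1.
  rewrite /eta ler_pdivrMr ?ltr_wpDl//.
  have : d ^+ 2 <= a ^+ 2 by rewrite ler_sqr ?nnegrE// ltW.
  by rewrite mulrDr mulr1; move: (p.1 * rmax) sr => qq; lra.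
have sZ : `|p.2| < Z.
  rewrite ltNge; apply/negP => Zp.
  have := strain_far nz uz zr pin Zd Zp; apply/negP; rewrite -ltNge -/a.
  have : d ^+ 2 < a ^+ 2 by rewrite ltr_sqr ?nnegrE// ltW.
  have -> : 2 * (Z - delta) = delta ^+ 2 * rmax / d ^+ 2 + 2.
    by rewrite /Z /q; field; rewrite gt_eqF.
  move=> da2; apply: (@lt_le_trans _ _ ((delta ^+ 2 * rmax / d ^+ 2 + 2) * d ^+ 2)).
    rewrite mulrDl divfK ?ltrDl ?mulr_gt0 ?exprn_gt0// gt_eqF ?exprn_gt0//.
  by rewrite ler_wpM2l ?(ltW da2)//; nneg.
rewrite /chi/= subr0 ifT ?mulr1; last by rewrite mulrC mulKf.
have H4 : rho p.1 * phi a / 2 * a ^+ 2 <= phi A * A ^+ 2 / (2 * eta ^+ 2) * (rho p.1 * p.1 ^+ 2).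
  have E1 : phi a * a ^+ 2 <= phi A * A ^+ 2.
    apply: ler_pM; rewrite ?sqr_ge0 ?(i_phi_ge0 I) ?(i_phi_nd I)//.
    by rewrite ler_sqr ?nnegrE.
  have E2 : 1 <= p.1 ^+ 2 / eta ^+ 2.
    by rewrite ler_pdivlMr ?exprn_gt0// mul1r ler_sqr ?nnegrE// ltW.
  have -> : phi A * A ^+ 2 / (2 * eta ^+ 2) * (rho p.1 * p.1 ^+ 2) =
     rho p.1 / 2 * (phi A * A ^+ 2 * (p.1 ^+ 2 / eta ^+ 2)).
    by field; rewrite gt_eqF.
  have -> : rho p.1 * phi a / 2 * a ^+ 2 = rho p.1 / 2 * (phi a * a ^+ 2) by field.
  rewrite ler_wpM2l ?divr_ge0//; apply: le_trans E1 _.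
  by rewrite ler_peMr//; nneg.
have H5 : rho p.1 * (2 * e) / 2 * a ^+ 2 >= 0.
  by nneg.
lra.
Qed.

Let bnd Cb Z : R := Cb * beta * (2 * Z).

Lemma nnm_cut Cb Z : 0 <= Cb -> nnm (fun p => (cut Cb Z p)%:E).
Proof.
move=> Cb0; apply: nnm_EFin => [|p]; last first.
  have [rh ch] := (i_rho_ge0 I p.1, chi_ge0 (2 * Z, 0) p.2).
  by rewrite /cut; nneg.
apply: measurable_funM.
  apply: measurable_funM => //; apply: measurable_funM.
    exact: measurableT_comp (i_mrho I) measurable_fst.
  by apply: measurable_funX; exact: measurable_fst.
exact: measurableT_comp (measurable_chi2 (2 * Z, 0)) measurable_snd.
Qed.

Lemma integral_cut Cb Z : 0 <= Cb -> 0 < Z ->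
  (\int[mu2]_p (cut Cb Z p)%:E = (bnd Cb Z)%:E)%E.
Proof.
move=> Cb0 Z0; rewrite plane_tonelli; last exact: nnm_cut.
have nr := nnm_wx2 (i_mrho I) (i_rho_ge0 I).
have Z2 : 0 < (2 * Z, 0 : R).1 by rewrite /= mulr_gt0.
transitivity (\int[mu]_x ((Cb * (2 * Z))%:E * (rho x * x ^+ 2)%:E))%E.
  apply: eq_integral => x _; rewrite -EFinM mulrAC EFinM -(integral_chi2 Z2).
  rewrite -(nnm_intZ mu); last 2 first.
  - by rewrite lee_fin; have := i_rho_ge0 I x => rh; nneg.
  - exact: nnm_chi2.
  by apply: eq_integral => y _; rewrite -EFinM.
rewrite (nnm_intZ mu)// ?lee_fin ?mulr_ge0// ?(ltW Z0)// (betaE I) -EFinM.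
by congr EFin; rewrite /bnd mulrAC.
Qed.

Lemma integral_dens e Cb Z z : 0 < e -> 0 <= Cb -> 0 < Z -> nnm z ->
  (norm2 z < +oo)%E -> (forall p, 0 <= dens e Cb Z z p) ->
  nnm (fun p => (dens e Cb Z z p)%:E) /\
  (\int[mu2]_p (dens e Cb Z z p)%:E + energy z =
   (2^-1 * csq + e * beta)%:E * norm2 z + (bnd Cb Z)%:E)%E.
Proof.
move=> e0 Cb0 Z0 nz Tz d0.
have h0 : 0 <= (2 : R)^-1 by rewrite invr_ge0.
have [mw w0 wout wE] := w_facts h0 (ltW e0).
have nS := nnm_wstrain2 mw w0 wout nz.
have nC := nnm_cut Z Cb0.
have nF := nnm_F I nz.
have nd : nnm (fun p => (dens e Cb Z z p)%:E).
  apply: nnm_EFin => //; apply: measurable_funB; last first.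
    by have /measurable_EFinP := nF.1.
  apply: measurable_funD; first by have /measurable_EFinP := nS.1.
  by have /measurable_EFinP := nC.1.
split=> //; rewrite !energyE -nnm_intD//.
rewrite -wE -(integral_strain2 mw w0 wout nz Tz) -(integral_cut Cb0 Z0) -nnm_intD//.
by apply: eq_integral => p _; rewrite -!EFinD /dens subrK.
Qed.

(** Since the energies are at least [K], the integrals of [dens] along the sequence are at most
    [a * r n + bnd Cb Z - K]. Pointwise, the lower limit of [dens] is at least its value at [u]:
    [strain2] is lower semicontinuous, [cut] is constant and [F] is continuous in the convergent
    strain. *)
Lemma lsc_eps e : 0 < e ->
  (2^-1 * csq + e * beta) * fine (norm2 u) + K <=
  (2^-1 * csq + e * beta) * rlim + fine (energy u).
Proof.
move=> e0; have [Cb [Z [Cb0 Z0 d0]]] := dens_ge0 e0.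
set a := 2^-1 * csq + e * beta.
have a0 : 0 <= a.
  by have [h1 h2] := (csq_ge0 I, beta_ge0 I); rewrite /a; nneg.
have fv n := norm2_fin (vrm n); have fu := norm2_fin urm.
have [nd du] := integral_dens e0 Cb0 Z0 nu fu (fun p => d0 u p nu uu urm).
have ndv n := (integral_dens e0 Cb0 Z0 (nv n) (fv n) (fun p => d0 _ p (nv n) (uv n) (vrm n))).1.
have dv n := (integral_dens e0 Cb0 Z0 (nv n) (fv n) (fun p => d0 _ p (nv n) (uv n) (vrm n))).2.
have uE : norm2 u = (fine (norm2 u))%:E by rewrite fineK// ge0_fin_numE// norm2_ge0.
have eE : energy u = (fine (energy u))%:E.
  by rewrite fineK// ge0_fin_numE; [exact: energy_lty|exact: (nnm_ge0 mu2 (nnm_F I nu))].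
have cl : (a * r n + bnd Cb Z - K)%:E @[n --> \oo] --> (a * rlim + bnd Cb Z - K)%:E.
  apply: cvg_EFin; first by apply: nearW => n.
  apply: cvgB; last exact: cvg_cst.
  by apply: cvgD; [apply: cvgMr|exact: cvg_cst].
have cn n : (\int[mu2]_p (dens e Cb Z (v n) p)%:E <= (a * r n + bnd Cb Z - K)%:E)%E.
  rewrite EFinB leeBrDr//; apply: le_trans (leeD2l _ (vK n)) _.
  rewrite dv -/a [leRHS]EFinD; apply: leeD2r; rewrite EFinM lee_wpmul2l ?lee_fin//.
have : (\int[mu2]_p (dens e Cb Z u p)%:E <= (a * rlim + bnd Cb Z - K)%:E)%E.
  apply: le_trans (limn_einf_le_cvg cn cl).
  apply: fatou_ae => //; apply: aeW => p.
  apply: limn_einf_near_ge => t t0.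
  have [pin|pout] := boolP (0 < p.1 < delta); last first.
    apply: nearW => n; rewrite /dens /w (i_kap_out I)// (i_rho_out I)// !(i_F_out I)//.
    by rewrite !(mulr0, mul0r, add0r); lra.
  have p0 : 0 < p.1 by case/andP: pin.
  pose b := w e p.1 * p.1.
  have b0 : 0 <= b.
    have [rh kh] := (i_rho_ge0 I p.1, i_kap_ge0 I p.1).
    by rewrite /b /w; nneg.
  have b1 : 0 < 2 * (b + 1) by lra.
  have H1 := strain2_liminf nv nu vrm vu p (divr_gt0 t0 b1).
  have H2 : F (strain (v n) p) p.1 @[n --> \oo] --> F (strain u p) p.1.
    have h1 := strain_cvg nv nu vrm vu p0.
    have h2 : F x p.1 @[x --> strain u p] --> F (strain u p) p.1 by exact: (i_F_cont I).
    exact: (cvg_comp _ _ h1 h2).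
  move/cvgrPdist_lt : H2 => /(_ (t / 2) ltac:(by rewrite divr_gt0)) H2.
  near=> n.
  have h1 : strain2 u p - t / (2 * (b + 1)) < strain2 (v n) p by near: n.
  have : `|F (strain u p) p.1 - F (strain (v n) p) p.1| < t / 2 by near: n.
  rewrite ltr_distlC => /andP[h2 h3].
  rewrite /dens -/b.
  have h4 : b * (strain2 u p - t / (2 * (b + 1))) <= b * strain2 (v n) p.
    by rewrite ler_wpM2l// ltW.
  have h5 : b * (t / (2 * (b + 1))) <= t / 2.
    rewrite mulrA ler_pdivrMr//; nra.
  rewrite mulrBr in h4; lra.
move: du; rewrite uE eE; case: (integral _ _ _) => [x| |]//.
rewrite -EFinD -EFinM -EFinD -/a => -[] h; rewrite lee_fin.
move: (a * fine _) (a * rlim) (bnd _ _) h => aN ar bb; lra.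
Unshelve. all: by end_near. Qed.
End Lsc.
End LowerSemicontinuity.

(** * Existence of minimisers *)

Section Minimiser.
Context {R : realType}.
Local Notation mu := (@lebesgue_measure R).
Local Notation mu2 := (@plane_measure R).
Variables (delta : R) (F f : R -> R -> R) (kap rho phi : R -> R) (C0 : R).
Hypothesis I : interaction delta F f kap rho phi C0.
Local Notation energy := (energy F).
Local Notation csq := (csq kap).
Local Notation beta := (beta rho).

Definition scale (s : R) (u : R -> \bar R) (z : R) : \bar R := (s%:E * u z)%E.

Lemma nnm_scale s u : 0 <= s -> nnm u -> nnm (scale s u).
Proof. by move=> s0 nu; apply: nnmM nu; apply: nnm_cst; rewrite lee_fin. Qed.

Lemma unimodal_scale s u : 0 <= s -> unimodal u -> unimodal (scale s u).
Proof. by move=> s0 uu x y xy; rewrite lee_wpmul2l// ?lee_fin// uu. Qed.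

Lemma norm2_scale s u : 0 <= s -> nnm u -> norm2 (scale s u) = ((s ^+ 2)%:E * norm2 u)%E.
Proof.
move=> s0 nu; rewrite /norm2 -nnm_intZ ?lee_fin ?sqr_ge0//; last exact: nnm_sq.
by apply: eq_integral => z _; rewrite /scale !expe2 EFinM muleACA.
Qed.

Lemma strain_scale s u (p : R * R) : 0 <= s -> nnm u ->
  strain (scale s u) p = s * strain u p.
Proof.
move=> s0 nu; rewrite /strain boxZ ?lee_fin//.
case: (box u p) => [x| |]//=; move: s0; rewrite le_eqVlt => /predU1P[<-|s0];
  by rewrite ?mul0e ?mulr0 ?mul0r//= ?gt0_muley ?gt0_muleNy// lte_fin.
Qed.

Lemma energy_scale s u : 1 <= s -> nnm u ->
  ((s ^+ 2)%:E * energy u <= energy (scale s u))%E.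
Proof.
move=> s1 nu; have s0 : 0 <= s by lra.
rewrite !energyE -nnm_intZ ?lee_fin ?sqr_ge0//; last exact: (nnm_F I nu).
have nc : nnm (fun p : R * R => (s ^+ 2)%:E * (F (strain u p) p.1)%:E)%E.
  by apply: nnmM (nnm_F I nu); apply: nnm_cst; rewrite lee_fin sqr_ge0.
apply: (nnm_le mu2 nc (nnm_F I (nnm_scale s0 nu))) => p.
by rewrite strain_scale// -EFinM lee_fin (i_F_scale I)// strain_ge0.
Qed.

Definition admissible (K r : R) (u : R -> \bar R) :=
  [/\ nnm u, unimodal u, norm2 u = r%:E & (K%:E <= energy u)%E].

Lemma lsc_limit (v : nat -> R -> \bar R) (u : R -> \bar R) (r : nat -> R) (rmax rlim K : R) :
  (forall n, admissible K (r n) (v n)) -> (forall n, r n <= rmax) ->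
  r n @[n --> \oo] --> rlim -> nnm u -> unimodal u ->
  {ae mu, forall x, v n x @[n --> \oo] --> u x} ->
  exists N E : R, [/\ norm2 u = N%:E, energy u = E%:E, N <= rlim &
    csq / 2 * N + K <= csq / 2 * rlim + E].
Proof.
move=> va rr rl nu uu vu.
have nv n : nnm (v n) by have [] := va n.
have uv n : unimodal (v n) by have [] := va n.
have vr n : (norm2 (v n) <= (r n)%:E)%E by have [_ _ ->] := va n.
have vK n : (K%:E <= energy (v n))%E by have [] := va n.
have Nl : (norm2 u <= rlim%:E)%E.
  apply: le_trans (norm2_limit nv nu vu) _; apply: (limn_einf_le_cvg vr).
  by apply: cvg_EFin => //; apply: nearW.
have uE : norm2 u = (fine (norm2 u))%:E.
  by rewrite fineK// ge0_fin_numE; [exact: norm2_fin Nl|exact: norm2_ge0].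
have eE : energy u = (fine (energy u))%:E.
  rewrite fineK// ge0_fin_numE; last exact: (nnm_ge0 mu2 (nnm_F I nu)).
  exact: (energy_lty I nu (norm2_fin Nl)).
exists (fine (norm2 u)), (fine (energy u)); split => //.
  by rewrite -lee_fin -uE.
apply/ler_addgt0Pr => e e0.
have b0 := beta_ge0 I.
have Nl' : fine (norm2 u) <= rlim by rewrite -lee_fin -uE.
have Nu0 : 0 <= fine (norm2 u) by rewrite fine_ge0// norm2_ge0.
pose q := beta * (rlim - fine (norm2 u)).
have q0 : 0 <= q by rewrite mulr_ge0// subr_ge0.
(* With this weight in [lsc_eps], the error term, which is the weight times [q], is at most [e]. *)
have t0 : 0 < e / (q + 1) by rewrite divr_gt0//; lra.
have := lsc_eps I nv uv nu uu vr rr rl vK vu t0.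
have : e / (q + 1) * q <= e.
  rewrite mulrAC ler_pdivrMr ?ler_wpM2l//; lra.
rewrite /q; set t := e / _.
rewrite !mulrDl -!mulrA mulrBr; move: (fine _) (fine _) => N E.
by rewrite mulrBr; lra.
Qed.

Lemma admissible_ge0 K r u : admissible K r u -> 0 <= r.
Proof. by move=> [nu _ uE _]; rewrite -lee_fin -uE norm2_ge0. Qed.

Lemma admissible_bound K r rmax u x : admissible K r u -> r <= rmax -> x != 0 ->
  (u x <= (Num.sqrt (rmax / (2 * `|x|)))%:E)%E.
Proof.
move=> [nu uu uE _] rm x0.
have ux : u x = (fine (u x))%:E.
  by rewrite fineK// (unimodal_fin nu uu)// -/(norm2 u) uE ltry.
have xx : 0 < 2 * `|x| by rewrite mulr_gt0// normr_gt0.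
have := unimodal_bound x nu uu; rewrite -/(norm2 u) uE ux -EFin_expe -EFinM !lee_fin => H.
have u0 : 0 <= fine (u x) by rewrite fine_ge0// nu.2.
rewrite -(ger0_norm u0) -sqrtr_sqr ler_wsqrtr// ler_pdivlMr// mulrC.
exact: le_trans H rm.
Qed.

Lemma minimiser_exists K r0 w0 : admissible K r0 w0 -> csq / 2 * r0 < K ->
  exists (u : R -> \bar R) r, [/\ admissible K r u, r <= r0 &
    forall v s, admissible K s v -> r <= s].
Proof.
move=> adm0 r0K.
have c0 : 0 <= csq / 2 by rewrite divr_ge0// (csq_ge0 I).
pose S := [set r | exists v, admissible K r v].
have S0 : S r0 by exists w0.
have Slb : lbound S 0 by move=> x [v /admissible_ge0].
have hS : has_inf S by split; [exists r0|exists 0].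
have infle r : S r -> inf S <= r by move=> Sr; apply: ge_inf => //; exists 0.
have inf0 : 0 <= inf S by apply: lb_le_inf; [exists r0|exact: Slb].
have /choice[r rP] : forall n : nat, exists r, S r /\ r < inf S + n.+1%:R^-1.
  move=> n; have [r Sr rn] := @inf_adherent _ S n.+1%:R^-1 ltac:(by rewrite invr_gt0) hS.
  by exists r.
have /choice[v vP] : forall n, exists v, admissible K (r n) v by move=> n; have [] := rP n.
have rmax n : r n <= inf S + 1.
  by apply/ltW/(lt_le_trans (rP n).2); rewrite lerD2l invf_le1// ler1n.
have [u [s [sn uu u0 vu]]] := helly (fun n => let: And4 _ h _ _ := vP n in h)
  (fun n x => let: And4 h _ _ _ := vP n in h.2 x)
  (fun n x => admissible_bound (vP n) (rmax n)).
have nu := unimodal_nnm uu u0.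
have rs : r (s n) @[n --> \oo] --> inf S.
  apply/cvgrPdist_lt => e e0; near=> n.
  have Srn : inf S <= r (s n) by apply: infle; exists (v (s n)); exact: vP.
  rewrite ler0_norm ?subr_le0// opprB.
  rewrite ltrBlDl; apply: lt_trans (rP (s n)).2 _; rewrite ltrD2l.
  apply: (@le_lt_trans _ _ n.+1%:R^-1); first by rewrite lef_pV2 ?posrE// ler_nat ltnS.
  near: n; exact: near_infty_natSinv_lt (PosNum e0).
have [N [E [NE EE Nl H]]] := lsc_limit (fun n => vP (s n)) (fun n => rmax (s n)) rs nu uu vu.
have infr : inf S <= r0 by exact: infle.
have Kinf : csq / 2 * inf S < K by apply: le_lt_trans r0K; rewrite ler_wpM2l.
have N0 : 0 <= N by rewrite -lee_fin -NE norm2_ge0.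
(* A limit of norm zero would have no energy, so the lost norm [inf S] alone would have to carry [K]
   at the rate [csq / 2], which [Kinf] forbids. *)
have Npos : 0 < N.
  rewrite lt_def N0 andbT; apply/eqP => N00.
  have Nle : (norm2 u <= 0%:E)%E by rewrite NE N00.
  have := energy_le I nu Nle; rewrite NE N00 mule0 EE lee_fin => E0.
  by move: H; rewrite N00; lra.
(* Scaling by [t] restores the norm [inf S] and multiplies the energy by at least [t ^+ 2]. By [H]
   the energy becomes at least [csq / 2 * inf S + (K - csq / 2 * inf S) * t ^+ 2], and this is at
   least [K] because the bracket is positive and [t >= 1]. *)
pose t := Num.sqrt (inf S / N).
have t2 : t ^+ 2 = inf S / N by rewrite sqr_sqrtr// divr_ge0.
have t2_ge1 : 1 <= t ^+ 2 by rewrite t2 ler_pdivlMr// mul1r.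
have t0 : 0 <= t by exact: sqrtr_ge0.
have t1 : 1 <= t by rewrite -(@ler_sqr _ 1 t) ?nnegrE// expr1n.
have tN : t ^+ 2 * N = inf S by rewrite t2 divfK// gt_eqF.
exists (scale t u), (inf S); split; [|exact: infr|by move=> v' s' a; apply: infle; exists v'].
split; [exact: nnm_scale|exact: unimodal_scale| |].
  by rewrite norm2_scale// NE -EFinM tN.
apply: le_trans (energy_scale t1 nu); rewrite EE -EFinM lee_fin.
have h1 : csq / 2 * inf S + (K - csq / 2 * inf S) * t ^+ 2 <= t ^+ 2 * E.
  rewrite -[X in csq / 2 * X + _]tN.
  have -> : csq / 2 * (t ^+ 2 * N) + (K - csq / 2 * inf S) * t ^+ 2 =
    t ^+ 2 * (csq / 2 * N + K - csq / 2 * inf S) by ring.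
  by rewrite ler_wpM2l ?sqr_ge0//; lra.
have h2 : K - csq / 2 * inf S <= (K - csq / 2 * inf S) * t ^+ 2.
  by rewrite ler_peMr//; lra.
lra.
Unshelve. all: by end_near. Qed.

End Minimiser.

(** * Competitors of large energy *)

Section Threshold.
Context {R : realType}.
Local Notation mu := (@lebesgue_measure R).
Local Notation mu2 := (@plane_measure R).
Variables (delta : R) (F f : R -> R -> R) (kap rho phi : R -> R) (C0 : R).
Hypothesis I : interaction delta F f kap rho phi C0.
Local Notation energy := (energy F).
Local Notation csq := (csq kap).

Lemma integral_gt0 (h : R -> R) : nnm (fun x => (h x)%:E) ->
  (forall x, 0 < x < delta -> 0 < h x) -> (0 < \int[mu]_x (h x)%:E)%E.
Proof.
move=> nh hpos; rewrite lt_def (nnm_ge0 mu nh) andbT; apply/eqP => h0.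
have [N [mN N0 hN]] := nnm_int0 mu nh h0.
have : (mu `]0%R, delta[%classic <= mu N)%E.
  apply: le_measure; rewrite ?inE// => x /=; rewrite in_itv/= => xd.
  by apply: hN => /= /(_ Logic.I) [] hx; have := hpos x xd; rewrite hx ltxx.
rewrite N0 lebesgue_measure_itv/= lte_fin (i_delta_gt0 I) -EFinB lee_fin.
by have := i_delta_gt0 I; lra.
Qed.

Lemma measurable_diagonal : measurable_fun [set: R] (fun x => F x x).
Proof.
have m2 : measurable_fun [set: R] (fun x : R => (x, x)) by exact: measurable_fun_pair.
exact: (measurableT_comp (i_mF I) m2).
Qed.

(** Inside a plateau of height [1] a bond of length [x] has strain [x], so [F x x] is the energy
    density there. The strict gain over the quadratic energy comes from [i_F_strict]. *)
Lemma diagonal_energy : exists2 d : R, 0 < d &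
  ((csq / 2 + d)%:E <= \int[mu]_x (F x x)%:E)%E.
Proof.
have mFd : measurable_fun [set: R] (fun x => F x x).
  exact: measurable_diagonal.
have nk : nnm (fun x : R => (kap x / 2 * x ^+ 2)%:E).
  apply: nnm_EFin => [|x]; last by rewrite mulr_ge0 ?sqr_ge0// divr_ge0// (i_kap_ge0 I).
  by apply: measurable_funM; [apply: measurable_funM => //; exact: (i_mkap I)|exact: measurable_funX].
pose h x := F x x - kap x / 2 * x ^+ 2.
have nh : nnm (fun x => (h x)%:E).
  apply: nnm_EFin => [|x]; first by apply: measurable_funB => //; have /measurable_EFinP := nk.1.
  rewrite subr_ge0; have [x0|x0] := leP 0 x; first exact: (i_F_lb I _ x0).
  by rewrite (i_F_out I) ?(i_kap_out I) ?mul0r// negb_and -leNgt (ltW x0).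
have hpos x : 0 < x < delta -> 0 < h x by move=> xd; rewrite subr_gt0 (i_F_strict I).
have h0 := integral_gt0 nh hpos.
(* The gain may be infinite, in which case any positive number will do. *)
have [d d0 dh] : exists2 d : R, 0 < d & (d%:E <= \int[mu]_x (h x)%:E)%E.
  case: (integral _ _ _) h0 => [d| |]//; first by rewrite lte_fin => d0; exists d.
  by move=> _; exists 1; rewrite ?leey.
exists d => //; rewrite EFinD.
have -> : (\int[mu]_x (F x x)%:E = \int[mu]_x ((kap x / 2 * x ^+ 2)%:E + (h x)%:E))%E.
  by apply: eq_integral => x _; rewrite -EFinD /h; congr EFin; ring.
rewrite (nnm_intD mu nk nh); apply: leeD => //.
have -> : (csq / 2)%:E = (2^-1%:E * csq%:E)%E by rewrite -EFinM mulrC.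
rewrite -(csqE I) -nnm_intZ ?lee_fin ?invr_ge0//; last exact: (nnm_wx2 (i_mkap I) (i_kap_ge0 I)).
rewrite le_eqVlt; apply/orP; left; apply/eqP; apply: eq_integral => x _.
by rewrite -EFinM; congr EFin; ring.
Qed.

Definition plateau (n : R) (z : R) : \bar R := (chi (2 * n, 0) z)%:E.

Lemma plateau_unimodal n : unimodal (plateau n).
Proof.
move=> x y xy; rewrite /plateau /chi/= !subr0 lee_fin.
case: ifPn => yn; last by case: ifP.
by rewrite (le_lt_trans xy yn).
Qed.

Lemma plateau_norm2 n : 0 < n -> norm2 (plateau n) = (2 * n)%:E.
Proof.
move=> n0; rewrite -[RHS](@integral_chi2 _ (2 * n, 0)) /= ?mulr_gt0//.
apply: eq_integral => z _; rewrite /plateau -EFin_expe; congr EFin.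
by rewrite /chi; case: ifP => _; rewrite ?expr1n ?expr0n.
Qed.

(** Bonds with centre within [n - delta / 2] of [0] lie entirely inside the plateau; the others are
    discarded. *)
Lemma plateau_energy n : delta < 2 * n ->
  ((2 * n - delta)%:E * \int[mu]_x (F x x)%:E <= energy (plateau n))%E.
Proof.
move=> dn; have np : nnm (plateau n) by exact: nnm_chi2.
have d0 := i_delta_gt0 I.
have nF : nnm (fun x : R => (F x x)%:E).
  apply: nnm_EFin => [|x].
    exact: measurable_diagonal.
  have [x0|x0] := leP 0 x; first exact: (F_ge0 I _ x0).
  by rewrite (i_F_out I)// negb_and -leNgt (ltW x0).
rewrite energyE plane_tonelli; last exact: (nnm_F I np).
rewrite -nnm_intZ ?lee_fin ?subr_ge0 ?(ltW dn)//.
have nFt : nnm (fun x => \int[mu]_s (F (strain (plateau n) (x, s)) x)%:E)%E.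
  have [mf f0] := nnm_F I np; split.
    exact: (measurable_fun_fubini_tonelli_F (m2 := mu) _ mf f0).
  by move=> x; apply: integral_ge0 => s _; exact: (f0 (x, s)).
apply: (nnm_le mu (nnmM (nnm_cst _ _) nF) nFt) => [|x].
  by rewrite lee_fin subr_ge0 ltW.
have w0 : 0 < (2 * n - delta, 0 : R).1 by rewrite /= subr_gt0.
rewrite muleC -(integral_chi2 w0) -nnm_intZ ?nF.2//; last exact: nnm_chi2.
apply: nnm_le => [||s].
- by apply: nnmM (nnm_chi2 _); apply: nnm_cst; exact: nF.2.
- exact: (nnm_comp (nnm_F I np) (pair1_measurable x)).
have [xin|xout] := boolP (0 < x < delta); last by rewrite !(i_F_out I)// mul0e.
have /andP[x0 xd] := xin.
rewrite {1}/chi/= subr0; case: ifPn => sn; last first.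
  by rewrite mule0 lee_fin (F_ge0 I)// strain_ge0.
rewrite mule1 lee_fin (_ : strain _ _ = x)// /strain.
rewrite (_ : box _ _ = x%:E)// -[RHS](@integral_chi2 _ (x, s))//.
apply: eq_integral => z _; rewrite /plateau -EFinM; congr EFin.
rewrite /chi/= subr0; case: ifPn => [zs|_]; last by rewrite mul0r.
rewrite ifT ?mulr1//; have := ler_normD (z - s) s; rewrite subrK => zz.
apply: le_lt_trans zz _; lra.
Qed.

(** [K1] is the energy of one fixed plateau. Larger values of [K] are reached by scaling it up: the
    energy grows at least quadratically, so norm and [K] can be kept in the same ratio. *)
Lemma threshold : exists K1 : R, 0 <= K1 /\ forall K, K1 < K ->
  exists w r, admissible F K r w /\ csq / 2 * r < K.
Proof.
have [d d0 dF] := diagonal_energy.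
have dl := i_delta_gt0 I; have c0 := csq_ge0 I.
(* Discarding the bonds near the ends costs [delta * (csq / 2)]; this width makes the gain
   [(2 * n - delta) * d] larger than that. *)
pose n := delta + delta * (csq / 2) / d.
have q0 : 0 <= delta * (csq / 2) / d by rewrite !mulr_ge0// ?invr_ge0 ltW.
have dn : delta < 2 * n by rewrite /n; lra.
have n0 : 0 < n by rewrite /n; lra.
have np : nnm (plateau n) by exact: nnm_chi2.
have en := plateau_energy dn.
have nE := plateau_norm2 n0.
have eE : energy (plateau n) = (fine (energy (plateau n)))%:E.
  rewrite fineK// ge0_fin_numE; last exact: (nnm_ge0 mu2 (nnm_F I np)).
  by apply: (energy_lty I np); rewrite nE ltry.
set E := fine _ in eE.
have EE : csq / 2 * (2 * n) < E.
  rewrite -lte_fin -eE; apply: lt_le_trans en.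
  apply: (@lt_le_trans _ _ ((2 * n - delta)%:E * (csq / 2 + d)%:E)%E).
    rewrite -EFinM lte_fin.
    have -> : (2 * n - delta) * (csq / 2 + d) = csq / 2 * (2 * n) - delta * (csq / 2) + (2 * n - delta) * d by ring.
    suff : delta * (csq / 2) < (2 * n - delta) * d by lra.
    have -> : (2 * n - delta) * d = delta * d + 2 * (delta * (csq / 2)).
      by rewrite /n; field; rewrite gt_eqF.
    have : 0 < delta * d by rewrite mulr_gt0.
    have : 0 <= delta * (csq / 2) by rewrite mulr_ge0 ?divr_ge0// ltW.
    lra.
  by rewrite lee_wpmul2l// lee_fin subr_ge0 ltW.
have c2n : 0 <= csq / 2 * (2 * n) by rewrite mulr_ge0 ?divr_ge0 ?mulr_ge0// ltW.
have E0 : 0 < E by exact: le_lt_trans EE.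
exists E; split; [exact: ltW|move=> K EK].
pose t := Num.sqrt (K / E).
have t2 : t ^+ 2 = K / E by rewrite sqr_sqrtr// divr_ge0// ltW// (lt_trans E0).
have t0 : 0 <= t by exact: sqrtr_ge0.
have t1 : 1 <= t.
  by rewrite -(@ler_sqr _ 1 t) ?nnegrE// expr1n t2 ler_pdivlMr// mul1r ltW.
have tE : t ^+ 2 * E = K by rewrite t2 divfK// gt_eqF.
exists (scale t (plateau n)), (t ^+ 2 * (2 * n)); split.
  split; [exact: nnm_scale|exact: (unimodal_scale t0 (@plateau_unimodal _))| |].
    by rewrite norm2_scale// nE -EFinM.
  by apply: le_trans (energy_scale I t1 np); rewrite eE -EFinM lee_fin tE.
rewrite -tE mulrCA ltr_pM2l// t2 divr_gt0//; exact: lt_trans EK.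
Qed.

End Threshold.

(** * The Euler-Lagrange equation *)

Section EulerLagrange.
Context {R : realType}.
Local Notation mu := (@lebesgue_measure R).
Local Notation mu2 := (@plane_measure R).
Variables (delta : R) (F f : R -> R -> R) (kap rho phi : R -> R) (C0 : R).
Hypothesis I : interaction delta F f kap rho phi C0.
Local Notation energy := (energy F).
Local Notation csq := (csq kap).
Local Notation beta := (beta rho).

Definition stress (u : R -> \bar R) (p : R * R) : \bar R := (f (strain u p) p.1)%:E.
Definition gradient (u : R -> \bar R) : R -> \bar R := boxT (stress u).
(** Formally the derivative of the energy at [u] in the direction [v]. *)
Definition pairing (u v : R -> \bar R) : \bar R := (\int[mu]_z (gradient u z * v z))%E.

Lemma nnm_stress u : nnm u -> nnm (stress u).
Proof. exact: (nnm_f I). Qed.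

Lemma nnm_gradient u : nnm u -> nnm (gradient u).
Proof. by move=> nu; exact: (nnm_boxT (nnm_stress nu)). Qed.

Lemma strain_unimodal u (x s s' : R) : nnm u -> unimodal u -> (norm2 u < +oo)%E ->
  0 < x -> `|s| <= `|s'| -> strain u (x, s') <= strain u (x, s).
Proof.
move=> nu uu Tu x0 ss'; rewrite /strain fine_le// ?box_fin//.
apply: (box_unimodal x nu uu _ ss') => z z0.
by have := unimodal_fin nu uu Tu z0; rewrite ge0_fin_numE// nu.2.
Qed.

Lemma gradient_unimodal u : nnm u -> unimodal u -> (norm2 u < +oo)%E ->
  unimodal (gradient u).
Proof.
move=> nu uu Tu; apply: boxT_unimodal => [|x s s' ss'|p]; last by rewrite ltry.
  exact: nnm_stress.
rewrite lee_fin/=; have [/andP[x0 _]|xout] := boolP (0 < x < delta).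
  by rewrite (i_f_nd I)// ?strain_ge0// strain_unimodal.
by rewrite !(i_f_out I).
Qed.

Lemma pairingE u v : nnm u -> nnm v -> (norm2 v < +oo)%E ->
  pairing u v = (\int[mu2]_p (f (strain u p) p.1 * strain v p)%:E)%E.
Proof.
move=> nu nv Tv; rewrite /pairing /gradient boxT_adj//; last exact: nnm_stress.
apply: eq_integral => p _; rewrite /stress EFinM.
have [/andP[x0 _]|xout] := boolP (0 < p.1 < delta).
  by rewrite /strain fineK// box_fin.
by rewrite (i_f_out I)// !mul0e.
Qed.

Lemma nnm_pairing u v : nnm u -> nnm v ->
  nnm (fun p => (f (strain u p) p.1 * strain v p)%:E).
Proof.
move=> nu nv; apply: nnm_EFin => [|p].
  apply: measurable_funM; last exact: measurable_strain.
  by have /measurable_EFinP := (nnm_stress nu).1.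
by rewrite mulr_ge0 ?strain_ge0// (i_f_ge0 I)// strain_ge0.
Qed.

Lemma pairing_ge0 u v : nnm u -> nnm v -> (0 <= pairing u v)%E.
Proof.
by move=> nu nv; exact: (nnm_ge0 mu (nnmM (nnm_gradient nu) nv)).
Qed.

Lemma pairing_scale u v t : nnm u -> nnm v -> 0 <= t ->
  pairing u (scale t v) = (t%:E * pairing u v)%E.
Proof.
move=> nu nv t0; rewrite /pairing -nnm_intZ ?lee_fin//; last exact: nnmM (nnm_gradient nu) nv.
by apply: eq_integral => z _; rewrite /scale muleCA.
Qed.

(** Convexity of the energy, from [i_F_tangent] bond by bond, with the terms moved so that no
    difference of extended reals occurs. *)
Lemma energy_tangent u v : nnm u -> nnm v -> (norm2 u < +oo)%E -> (norm2 v < +oo)%E ->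
  (energy u + pairing u v <= energy v + pairing u u)%E.
Proof.
move=> nu nv Tu Tv; rewrite (pairingE nu nv Tv) (pairingE nu nu Tu) !energyE.
have F1 := nnm_F I nu; have F2 := nnm_F I nv.
have F3 := nnm_pairing nu nv; have F4 := nnm_pairing nu nu.
rewrite -(nnm_intD mu2 F1 F3) -(nnm_intD mu2 F2 F4).
apply: (nnm_le mu2 (nnmD F1 F3) (nnmD F2 F4)) => p; rewrite -!EFinD lee_fin.
have := i_F_tangent I p.1 (strain_ge0 p nu) (strain_ge0 p nv).
by rewrite mulrBr; lra.
Qed.

Lemma pairing_lty u : nnm u -> (norm2 u < +oo)%E -> (pairing u u < +oo)%E.
Proof.
move=> nu Tu; rewrite pairingE//.
have uE : norm2 u = (fine (norm2 u))%:E by rewrite fineK// ge0_fin_numE// norm2_ge0.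
set A := Num.sqrt (delta * fine (norm2 u)).
have ur : (norm2 u <= (fine (norm2 u))%:E)%E by rewrite -uE.
have A0 : 0 <= A by exact: sqrtr_ge0.
have phA := i_phi_ge0 I A0.
have [mw w0 wout wE] := w_facts I ler01 phA.
apply: (@le_lt_trans _ _ (\int[mu2]_p ((1 * kap p.1 + phi A * rho p.1) * p.1 * strain2 u p)%:E)%E).
  apply: (nnm_le mu2 (nnm_pairing nu nu) (nnm_wstrain2 mw w0 wout nu)) => p.
  rewrite lee_fin; have [pin|pout] := boolP (0 < p.1 < delta); last first.
    by rewrite (i_f_out I)// wout// !mul0r.
  have [_ sA] := strain_le nu ur pin; move/andP: pin => [p0 _].
  have s0 := strain_ge0 p nu.
  have [kh rh] := (i_kap_ge0 I p.1, i_rho_ge0 I p.1).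
  apply: (@le_trans _ _ ((1 * kap p.1 + phi A * rho p.1) * strain u p ^+ 2)).
    rewrite expr2 [leRHS]mulrA ler_wpM2r//; apply: le_trans (i_f_ub I p.1 s0) _.
    by rewrite ler_wpM2r// mul1r mulrC lerD2l mulrC [leRHS]mulrC ler_wpM2l// (i_phi_nd I).
  rewrite -[leRHS]mulrA ler_wpM2l ?strain_CS//.
by rewrite (integral_strain2 mw w0 wout nu Tu) wE uE -EFinM ltry.
Qed.

Lemma pairing_ge_energy u : nnm u -> (norm2 u < +oo)%E ->
  (2%:E * energy u <= pairing u u)%E.
Proof.
move=> nu Tu; rewrite pairingE// energyE -nnm_intZ ?lee_fin//; last exact: (nnm_F I nu).
have n2 : nnm (fun p : R * R => 2%:E * (F (strain u p) p.1)%:E)%E.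
  by apply: nnmM (nnm_F I nu); apply: nnm_cst; rewrite lee_fin.
apply: (nnm_le mu2 n2 (nnm_pairing nu nu)) => p.
by rewrite -EFinM lee_fin (i_F_f I)// strain_ge0.
Qed.

Section Minimiser.
Variables (K r : R) (u : R -> \bar R).
Hypothesis K0 : 0 < K.
Hypothesis au : admissible F K r u.
Hypothesis umin : forall v s, admissible F K s v -> r <= s.

Let nu : nnm u. Proof. by case: au. Qed.
Let uu : unimodal u. Proof. by case: au. Qed.
Let uE : norm2 u = r%:E. Proof. by case: au. Qed.
Let uK : (K%:E <= energy u)%E. Proof. by case: au. Qed.
Let Tu : (norm2 u < +oo)%E. Proof. by rewrite uE ltry. Qed.

Lemma minimal_norm_gt0 : 0 < r.
Proof.
have r0 : 0 <= r by rewrite -lee_fin -uE norm2_ge0.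
rewrite lt_def r0 andbT; apply/eqP => r00.
have Nle : (norm2 u <= 0%:E)%E by rewrite uE r00.
have := energy_le I nu Nle; rewrite uE r00 mule0 => E0.
by have := le_trans uK E0; rewrite lee_fin leNgt K0.
Qed.

Let P := fine (pairing u u).
Let PE : pairing u u = P%:E.
Proof. by rewrite fineK// ge0_fin_numE; [exact: pairing_lty|exact: pairing_ge0]. Qed.

Lemma pairing_ge2K : 2 * K <= P.
Proof.
rewrite -lee_fin -PE; apply: le_trans (pairing_ge_energy nu Tu).
by rewrite EFinM lee_wpmul2l// lee_fin.
Qed.

(* If [energy v] exceeded [K], a slight contraction of [v] would be a better competitor. *)
Lemma energy_le_K v s : nnm v -> unimodal v -> norm2 v = s%:E -> s <= r ->
  (energy v <= K%:E)%E.
Proof.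
move=> nv uv vE sr; have Tv : (norm2 v < +oo)%E by rewrite vE ltry.
have s0 : 0 <= s by rewrite -lee_fin -vE norm2_ge0.
have eE : energy v = (fine (energy v))%:E.
  rewrite fineK// ge0_fin_numE; last exact: (nnm_ge0 mu2 (nnm_F I nv)).
  exact: (energy_lty I nv Tv).
have pE : pairing v v = (fine (pairing v v))%:E.
  by rewrite fineK// ge0_fin_numE; [exact: pairing_lty|exact: pairing_ge0].
rewrite leNgt; apply/negP; rewrite eE lte_fin => KE.
set E := fine (energy v) in eE KE; set Q := fine _ in pE.
have Q0 : 0 <= Q by rewrite -lee_fin -pE pairing_ge0.
(* By [energy_tangent] contracting [v] by [t] loses at most [(1 - t) * Q] of energy; this [t < 1]
   keeps the loss below the surplus [E - K]. *)
pose t := 1 - (E - K) / (E - K + Q + 1).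
have den : 0 < E - K + Q + 1 by lra.
have t1 : t < 1 by rewrite /t ltrBlDr ltrDl divr_gt0// subr_gt0.
have t0 : 0 <= t by rewrite /t subr_ge0 ler_pdivrMr//; lra.
have tQ : (1 - t) * Q <= E - K.
  rewrite /t opprB addrC subrK mulrAC ler_pdivrMr// ler_wpM2l//; lra.
have nt := nnm_scale t0 nv.
have TE : norm2 (scale t v) = (t ^+ 2 * s)%:E by rewrite norm2_scale// vE.
have := energy_tangent nv nt Tv ltac:(by rewrite TE ltry).
rewrite pairing_scale// eE pE => H.
have Ktv : (K%:E <= energy (scale t v))%E.
  have : (0 <= energy (scale t v))%E by exact: (nnm_ge0 mu2 (nnm_F I nt)).
  move: H; case: (energy _) => [x| _ _|_]; [|by rewrite leey|by []].
  rewrite -EFinM -!EFinD !lee_fin; move: tQ; rewrite mulrBl mul1r; lra.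
have : r <= t ^+ 2 * s.
  by apply: (umin (v := scale t v)); split => //; exact: unimodal_scale.
apply/negP; rewrite -ltNge; apply: (@le_lt_trans _ _ (t ^+ 2 * r)).
  by rewrite ler_wpM2l ?sqr_ge0.
by rewrite gtr_pMl ?minimal_norm_gt0// expr_lt1.
Qed.

(** By convexity, a larger pairing would give [v] more energy than [u], hence more than [K] with no
    larger norm, against [energy_le_K]. *)
Lemma pairing_max v s : nnm v -> unimodal v -> norm2 v = s%:E -> s <= r ->
  (pairing u v <= P%:E)%E.
Proof.
move=> nv uv vE sr; have Tv : (norm2 v < +oo)%E by rewrite vE ltry.
have := energy_tangent nu nv Tu Tv; have := energy_le_K nv uv vE sr; rewrite PE.
have eE : energy u = (fine (energy u))%:E.
  rewrite fineK// ge0_fin_numE; last exact: (nnm_ge0 mu2 (nnm_F I nu)).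
  exact: (energy_lty I nu Tu).
have := uK; rewrite eE.
have := pairing_ge0 nu nv; have : (0 <= energy v)%E by exact: (nnm_ge0 mu2 (nnm_F I nv)).
case: (pairing u v) => [x| |]//; case: (energy v) => [y| |]//.
by rewrite -!EFinD !lee_fin; lra.
Qed.

(** Obtained from [pairing_max] by rescaling [v] to the norm [r]. *)
Lemma pairing_CS v s : nnm v -> unimodal v -> norm2 v = s%:E -> 0 < s ->
  (pairing u v <= (P * Num.sqrt (s / r))%:E)%E.
Proof.
move=> nv uv vE s0; have r0 := minimal_norm_gt0.
pose t := Num.sqrt (r / s).
have t0 : 0 < t by rewrite sqrtr_gt0 divr_gt0.
have tt : t * Num.sqrt (s / r) = 1.
  rewrite -sqrtrM ?divr_ge0 ?ltW// mulrA divfK ?gt_eqF// divff ?gt_eqF//.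
  by rewrite sqrtr1.
have nt := nnm_scale (ltW t0) nv.
have vE' : norm2 (scale t v) = r%:E.
  rewrite (norm2_scale (ltW t0) nv) vE -EFinM sqr_sqrtr ?divr_ge0// ?ltW//.
  by rewrite divfK// gt_eqF.
have := pairing_max nt (unimodal_scale (ltW t0) uv) vE' (lexx r).
have sr0 : 0 < Num.sqrt (s / r) by rewrite sqrtr_gt0 divr_gt0.
rewrite (pairing_scale nu nv (ltW t0)).
have := pairing_ge0 nu nv; case: (pairing u v) => [x|_|//].
  2: by rewrite gt0_muley ?lte_fin.
rewrite -EFinM !lee_fin => x0 txP; rewrite -[leLHS]mul1r -tt mulrAC.
by rewrite ler_wpM2r// ltW.
Qed.

Let g := gradient u.
Let ng : nnm g. Proof. exact: nnm_gradient. Qed.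
Let ug : unimodal g. Proof. exact: gradient_unimodal. Qed.

(** The gradient is not yet known to be square integrable, but its cutoffs are; as products of
    nonnegative unimodal functions they remain in the class on which [u] minimises. *)
Let cutoff (n : nat) (z : R) : \bar R :=
  (mine (g z) n.+1%:R%:E * (chi (2 * n.+1%:R, 0) z)%:E)%E.

Lemma cutoff_nnm n : nnm (cutoff n).
Proof.
apply: nnmM (nnm_chi2 _); split; first by apply: measurable_mine => //; exact: ng.1.
by move=> z; rewrite le_min ng.2 lee_fin ler0n.
Qed.

Lemma cutoff_unimodal n : unimodal (cutoff n).
Proof.
move=> x y xy; apply: lee_pmul.
- by rewrite le_min ng.2 lee_fin ler0n.
- by rewrite lee_fin chi_ge0.
- by rewrite le_min !ge_min ug//= lexx !orbT.
- exact: (@plateau_unimodal R n.+1%:R x y xy).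
Qed.

Lemma cutoff_le n z : (cutoff n z <= g z)%E /\ (cutoff n z <= n.+1%:R%:E * (chi (2 * n.+1%:R, 0) z)%:E)%E.
Proof.
split; last by rewrite lee_wpmul2r ?lee_fin ?chi_ge0// ge_min lexx orbT.
rewrite /cutoff -[leRHS]mule1; apply: lee_pmul => //.
- by rewrite le_min ng.2 lee_fin ler0n.
- by rewrite lee_fin chi_ge0.
- by rewrite ge_min lexx.
- by rewrite lee_fin chi_le1.
Qed.

Lemma cutoff_norm2 n : (norm2 (cutoff n) < +oo)%E.
Proof.
pose p : R * R := (2 * n.+1%:R, 0).
have p0 : 0 < p.1 by rewrite /= mulr_gt0// ltr0n.
have nc : nnm (fun z => (n.+1%:R ^+ 2)%:E * (chi p z)%:E)%E.
  by apply: nnmM (nnm_chi2 _); apply: nnm_cst; rewrite lee_fin sqr_ge0.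
apply: (@le_lt_trans _ _ (\int[mu]_z ((n.+1%:R ^+ 2)%:E * (chi p z)%:E))%E); last first.
  rewrite nnm_intZ ?lee_fin ?sqr_ge0//; last exact: nnm_chi2.
  by rewrite integral_chi2// -EFinM ltry.
apply: (nnm_le mu (nnm_sq (cutoff_nnm n)) nc) => z.
have [_ H] := cutoff_le n z; have c0 := (cutoff_nnm n).2 z.
rewrite expe2; apply: le_trans (lee_pmul c0 c0 H H) _; rewrite -!EFinM lee_fin -/p.
rewrite /chi; case: ifP => _; rewrite ?mulr1 ?mulr0 ?mul0r//.
Qed.

Lemma cutoff_cvg z : cutoff n z @[n --> \oo] --> g z.
Proof.
have H : \forall n \near \oo, (cutoff n z = mine (g z) n.+1%:R%:E)%E.
  near=> n; rewrite /cutoff /chi/= subr0 ifT ?mule1//.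
  have : `|z| < n%:R by near: n; exact: nbhs_infty_gtr.
  by rewrite mulrC mulKf// => /lt_le_trans; apply; rewrite ler_nat.
have g0 := ng.2 z.
have [gr|gi] := eqVneq (g z) +oo%E.
  rewrite gr; apply/cvgeyPge => A; near=> n.
  rewrite (_ : cutoff n z = n.+1%:R%:E); last first.
    have -> : cutoff n z = mine (g z) n.+1%:R%:E by near: n.
    by rewrite gr minye.
  rewrite lee_fin (@le_trans _ _ n%:R)//; last by rewrite ler_nat.
  by near: n; exact: nbhs_infty_ger.
have gE : g z = (fine (g z))%:E by rewrite fineK// ge0_fin_numE// lt_neqAle gi leey.
apply: cvg_near_cst; near=> n.
have -> : cutoff n z = mine (g z) n.+1%:R%:E by near: n.
rewrite gE; apply/min_idPl; rewrite lee_fin (@le_trans _ _ n%:R)//; last by rewrite ler_nat.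
by near: n; exact: nbhs_infty_ger.
Unshelve. all: by end_near. Qed.

(** For the norm [s] of a cutoff, [s <= pairing u (cutoff n) <= P * Num.sqrt (s / r)], hence
    [s <= P ^+ 2 / r] uniformly in [n]; Fatou's lemma passes to [g]. *)
Lemma gradient_norm2 : (norm2 g <= (P ^+ 2 / r)%:E)%E.
Proof.
have r0 := minimal_norm_gt0.
have P0 : 0 <= P by apply: le_trans pairing_ge2K; rewrite mulr_ge0// ltW.
have cn n : (norm2 (cutoff n) <= (P ^+ 2 / r)%:E)%E.
  set s := fine (norm2 (cutoff n)).
  have sE : norm2 (cutoff n) = s%:E.
    by rewrite fineK// ge0_fin_numE ?cutoff_norm2// norm2_ge0//; exact: cutoff_nnm.
  have s0 : 0 <= s by rewrite -lee_fin -sE norm2_ge0//; exact: cutoff_nnm.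
  have [s00|spos] := leP s 0.
    by rewrite sE lee_fin (le_trans s00)// divr_ge0 ?sqr_ge0// ltW.
  have := pairing_CS (cutoff_nnm n) (@cutoff_unimodal n) sE spos.
  have : (norm2 (cutoff n) <= pairing u (cutoff n))%E.
    apply: (nnm_le mu (nnm_sq (cutoff_nnm n)) (nnmM ng (cutoff_nnm n))) => z.
    rewrite expe2 lee_wpmul2r//; first exact: (cutoff_nnm n).2.
    by have [] := cutoff_le n z.
  move=> /le_trans h /h{h}; rewrite sE !lee_fin.
  set q := Num.sqrt (s / r) => sq.
  have q0 : 0 < q by rewrite sqrtr_gt0 divr_gt0.
  have sqE : s = q ^+ 2 * r by rewrite sqr_sqrtr ?divfK// ?gt_eqF// divr_ge0// ltW.
  have qrP : q * r <= P.
    by rewrite -(ler_pM2r q0); apply: le_trans sq; rewrite sqE expr2 mulrAC.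
  rewrite sqE ler_pdivlMr// -mulrA -expr2 -exprMn ler_sqr ?nnegrE//.
  by rewrite mulr_ge0// ltW.
apply: le_trans (limn_einf_le_cvg (c := fun=> (P ^+ 2 / r)%:E) cn (cvg_cst _)).
apply: fatou_ae => [n||]; [exact: (nnm_sq (cutoff_nnm n))|exact: (nnm_sq ng)|].
apply: aeW => z.
have H := cvge_sq (fun n => (cutoff_nnm n).2 z) (ng.2 z) (@cutoff_cvg z).
by rewrite (cvg_limn_einf_sup H).1.
Qed.

(** The equality case of Cauchy-Schwarz: with [c = P / r], the integral of [(g - c u)^2] is at most
    [P^2 / r - 2 c P + c^2 r = 0]. The mixed term stays on the side of the square, where it is
    nonnegative. *)
Lemma euler_lagrange : {ae mu, forall z, gradient u z = ((P / r)%:E * u z)%E}.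
Proof.
have r0 := minimal_norm_gt0.
have P0 : 0 <= P by apply: le_trans pairing_ge2K; rewrite mulr_ge0// ltW.
have Tg : (norm2 g < +oo)%E by apply: le_lt_trans gradient_norm2 _; rewrite ltry.
set c := P / r; have c0 : 0 <= c by rewrite divr_ge0// ltW.
pose h z := (fine (g z) - c * fine (u z)) ^+ 2.
have mfine (w : R -> \bar R) : nnm w -> measurable_fun [set: R] (fun z => fine (w z)).
  by move=> nw; apply: measurableT_comp nw.1; exact: fine_measurable.
have nh : nnm (fun z => (h z)%:E).
  apply: nnm_EFin => [|z]; last exact: sqr_ge0.
  apply: measurable_funX; apply: measurable_funB; first exact: mfine.
  by apply: measurable_funM => //; exact: mfine.
have ngu := nnmM ng nu.
have c2 : (0 <= (2 * c)%:E :> \bar R)%E by rewrite lee_fin mulr_ge0.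
have cc : (0 <= (c ^+ 2)%:E :> \bar R)%E by rewrite lee_fin sqr_ge0.
have n1 := nnmD nh (nnmM (nnm_cst _ c2) ngu).
have n2 := nnmD (nnm_sq ng) (nnmM (nnm_cst _ cc) (nnm_sq nu)).
have fin z : z != 0 -> g z = (fine (g z))%:E /\ u z = (fine (u z))%:E.
  by move=> z0; rewrite !fineK// ?(unimodal_fin nu uu Tu)// (unimodal_fin ng ug Tg).
have ae0 : {ae mu, forall z, z != 0}.
  exists [set 0]; split => //; first exact: lebesgue_measure_set1.
  by move=> z /= /negP; rewrite negbK => /eqP.
have : (\int[mu]_z ((h z)%:E + (2 * c)%:E * (g z * u z)) =
        \int[mu]_z (g z ^+ 2 + (c ^+ 2)%:E * u z ^+ 2))%E.
  apply: (nnm_ae_eq mu n1 n2); move: ae0; apply: filterS => z z0 _.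
  have [-> ->] := fin z z0; rewrite -!EFin_expe -!EFinM -!EFinD; congr EFin.
  by rewrite /h; ring.
rewrite (nnm_intD mu nh (nnmM (nnm_cst _ c2) ngu)).
rewrite (nnm_intD mu (nnm_sq ng) (nnmM (nnm_cst _ cc) (nnm_sq nu))).
rewrite (nnm_intZ mu _ c2 ngu) (nnm_intZ mu _ cc (nnm_sq nu)).
rewrite -/(norm2 g) -/(norm2 u) uE -/(pairing u u) PE => H.
have h0 : (\int[mu]_z (h z)%:E = 0)%E.
  apply/eqP; rewrite eq_le (nnm_ge0 mu nh) andbT.
  have := leeD2r ((c ^+ 2)%:E * r%:E)%E gradient_norm2; rewrite -H.
  case: (integral _ _ _) => [x| |]//.
  rewrite -!EFinM -!EFinD !lee_fin.
  have -> : P ^+ 2 / r + c ^+ 2 * r = 2 * c * P by rewrite /c; field; rewrite gt_eqF.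
  lra.
move: ae0 (nnm_int0 mu nh h0); apply: filterS2 => z z0 /(_ Logic.I) [] /eqP.
rewrite sqrf_eq0 subr_eq0 => /eqP hz.
by have [gz uz] := fin z z0; rewrite -/g gz uz hz -EFinM.
Qed.

End Minimiser.
End EulerLagrange.

(** * Regularity of minimisers *)

Section Boundedness.
Context {R : realType}.
Local Notation mu := (@lebesgue_measure R).
Local Notation mu2 := (@plane_measure R).

Lemma boxT_le h1 h2 (z : R) : nnm h1 -> nnm h2 -> (forall p, (h1 p <= h2 p)%E) ->
  (boxT h1 z <= boxT h2 z)%E.
Proof.
move=> n1 n2 h12; apply: (nnm_le mu2 (nnmM (nnm_chi1 z) n1) (nnmM (nnm_chi1 z) n2)) => p.
by rewrite lee_wpmul2l// lee_fin chi_ge0.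
Qed.

Lemma boxTD h1 h2 (z : R) : nnm h1 -> nnm h2 ->
  boxT (fun p => h1 p + h2 p)%E z = (boxT h1 z + boxT h2 z)%E.
Proof.
move=> n1 n2; rewrite /boxT -(nnm_intD mu2 (nnmM (nnm_chi1 z) n1) (nnmM (nnm_chi1 z) n2)).
by apply: eq_integral => p _; rewrite ge0_muleDr ?n1.2 ?n2.2.
Qed.

Lemma boxT_fst (w : R -> R) (z : R) : measurable_fun [set: R] w -> (forall x, 0 <= w x) ->
  (forall x, x <= 0 -> w x = 0) ->
  boxT (fun p => (w p.1)%:E) z = (\int[mu]_x (w x * x)%:E)%E.
Proof.
move=> mw w0 wout.
have nw : nnm (fun p : R * R => (w p.1)%:E).
  by apply: nnm_EFin => //; exact: measurableT_comp mw measurable_fst.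
rewrite boxT_iter//; apply: eq_integral => x _ /=.
have [x0|x0] := leP x 0; last by rewrite box_cst// ?lee_fin// -EFinM.
rewrite wout// mul0r; apply: integral0_eq => s _; by rewrite mule0.
Qed.

Variables (delta : R) (F f : R -> R -> R) (kap rho phi : R -> R) (C0 : R).
Hypothesis I : interaction delta F f kap rho phi C0.
Local Notation csq := (csq kap).
Local Notation beta := (beta rho).
Local Notation gradient := (gradient f).
Local Notation stress := (stress f).

Lemma integral_x3 C : 0 <= C ->
  (\int[mu]_x (C * (rho x * x ^+ 2) * x)%:E <= (delta * C * beta)%:E)%E.
Proof.
move=> C00.
have nr := nnm_wx2 (i_mrho I) (i_rho_ge0 I).
have dC : (0 <= (delta * C)%:E :> \bar R)%E by rewrite lee_fin mulr_ge0// ltW// (i_delta_gt0 I).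
rewrite EFinM -(betaE I) -(nnm_intZ mu _ dC nr).
have nn : nnm (fun x : R => (C * (rho x * x ^+ 2) * x)%:E).
  apply: nnm_EFin => [|x].
    apply: measurable_funM => //; apply: measurable_funM => //.
    by have /measurable_EFinP := nr.1.
  have rh := i_rho_ge0 I x; have [x0|x0] := leP 0 x; first by nneg.
  by rewrite (i_rho_out I) ?(mul0r, mulr0)// negb_and -leNgt (ltW x0).
apply: (nnm_le mu nn (nnmM (nnm_cst _ dC) nr)) => x.
rewrite -EFinM lee_fin; have [/andP[x0 xd]|xout] := boolP (0 < x < delta); last first.
  by rewrite (i_rho_out I)// !(mul0r, mulr0).
have rh := i_rho_ge0 I x.
by rewrite mulrC -[leRHS]mulrA; apply: ler_wpM2r; [nneg|exact: ltW].
Qed.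

Lemma boxT_tail C z : 0 <= C ->
  (boxT (fun p => (C * (rho p.1 * p.1 ^+ 2))%:E) z <= (delta * C * beta)%:E)%E.
Proof.
move=> C00; rewrite (@boxT_fst (fun x => C * (rho x * x ^+ 2)))//; first exact: integral_x3.
- apply: measurable_funM => //.
  by have /measurable_EFinP := (nnm_wx2 (i_mrho I) (i_rho_ge0 I)).1.
- by move=> x; have rh := i_rho_ge0 I x; nneg.
- by move=> x x0; rewrite (i_rho_out I) ?(mul0r, mulr0)// negb_and -leNgt x0.
Qed.

Lemma margin c2 : csq < c2 -> exists e d, [/\ 0 < e, 0 < d, phi d <= e & csq + e * beta < c2].
Proof.
move=> cc; have b0 := beta_ge0 I.
have b1 : 0 < 2 * (beta + 1) by lra.
pose e := (c2 - csq) / (2 * (beta + 1)).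
have e0 : 0 < e by rewrite divr_gt0// subr_gt0.
have [d d0 pd] := i_phi_small I e0.
exists e, d; split => //.
have : e * beta < c2 - csq; last by lra.
by rewrite /e mulrAC ltr_pdivrMr// ltr_pM2l ?subr_gt0//; lra.
Qed.

Lemma weight_facts e : 0 < e -> exists w : R -> R,
  [/\ forall x, w x = kap x + e * rho x, measurable_fun [set: R] w, forall x, 0 <= w x,
      forall x, ~~ (0 < x < delta) -> w x = 0 &
      (\int[mu]_x (w x * x ^+ 2)%:E = (csq + e * beta)%:E)%E].
Proof.
move=> e0; have [mw w0 wout wE] := w_facts I ler01 (ltW e0).
exists (fun x => 1 * kap x + e * rho x); split => //; first by move=> x; rewrite mul1r.
by rewrite wE mul1r.
Qed.

(** The force is at most a linear one of total mass [b < c2] plus a bounded remainder. The excess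
    [v] of [u] over a suitable [M] then satisfies [c2 * v <= boxT (w * box v)]; integrating gives
    [c2] times the integral of [v] at most [b] times it, so [v] vanishes almost everywhere. *)
Lemma gradient_bounded u c2 : nnm u -> unimodal u -> (norm2 u < +oo)%E -> csq < c2 ->
  {ae mu, forall z, gradient u z = (c2%:E * u z)%E} ->
  exists M, [/\ 0 < M, forall z, (gradient u z <= (c2 * M)%:E)%E &
    {ae mu, forall z, (u z <= M%:E)%E}].
Proof.
move=> nu uu Tu cc EL.
have [e [d [e0 d0 phid bc]]] := margin cc.
have uE : norm2 u = (fine (norm2 u))%:E by rewrite fineK// ge0_fin_numE// norm2_ge0.
set r := fine _ in uE.
have r0 : 0 <= r by rewrite -lee_fin -uE norm2_ge0.
have ur : (norm2 u <= r%:E)%E by rewrite uE.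
have dl := i_delta_gt0 I; have c00 := csq_ge0 I; have b0 := beta_ge0 I.
set A := Num.sqrt (delta * r).
have A0 : 0 <= A by exact: sqrtr_ge0.
have phA := i_phi_ge0 I A0.
(* A strain above [d] forces [p.1 >= eps] by Cauchy-Schwarz; [C] then pays for the whole force there
   through [p.1 ^+ 2 / eps ^+ 2 >= 1]. *)
pose eps := d ^+ 2 / (r + 1).
have eps0 : 0 < eps by rewrite divr_gt0 ?exprn_gt0// ltr_wpDl.
pose C := (C0 + phi A) * A / eps ^+ 2.
have C_0 : 0 <= C by have h := i_C0_ge0 I; rewrite /C; nneg.
have [w [wdef mw w0 wout wE]] := weight_facts e0.
set b := csq + e * beta in bc wE.
have b_0 : 0 <= b by rewrite /b; nneg.
have fbound p : f (strain u p) p.1 <= w p.1 * strain u p + C * (rho p.1 * p.1 ^+ 2).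
  have [pin|pout] := boolP (0 < p.1 < delta); last first.
    by rewrite (i_f_out I)// wout// (i_rho_out I)// !(mul0r, mulr0) addr0.
  have [sr sA] := strain_le nu ur pin; move/andP: pin => [p0 _].
  have s0 := strain_ge0 p nu.
  have [kh rh] := (i_kap_ge0 I p.1, i_rho_ge0 I p.1).
  have Cr : 0 <= C * (rho p.1 * p.1 ^+ 2) by nneg.
  have fub := i_f_ub I p.1 s0.
  have [sd|ds] := leP (strain u p) d.
    apply: le_trans fub _; rewrite -[leLHS]addr0; apply: lerD => //.
    rewrite ler_wpM2r// wdef lerD2l mulrC ler_wpM2r//.
    exact: le_trans (i_phi_nd I s0 sd) phid.
  have epsx : eps <= p.1.
    rewrite /eps ler_pdivrMr ?ltr_wpDl//.
    have : d ^+ 2 <= strain u p ^+ 2 by rewrite ler_sqr ?nnegrE// ltW.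
    by rewrite mulrDr mulr1; move: (p.1 * r) sr => qq; lra.
  have h1 : f (strain u p) p.1 <= (C0 + phi A) * A * rho p.1.
    apply: le_trans fub _.
    have -> : (C0 + phi A) * A * rho p.1 = (C0 * rho p.1 + rho p.1 * phi A) * A by ring.
    apply: ler_pM => //; first by rewrite addr_ge0// mulr_ge0// (i_phi_ge0 I).
    by apply: lerD; [exact: (i_kap_rho I)|rewrite ler_wpM2l// (i_phi_nd I)].
  have h2 : (C0 + phi A) * A * rho p.1 <= C * (rho p.1 * p.1 ^+ 2).
    have -> : C * (rho p.1 * p.1 ^+ 2) = (C0 + phi A) * A * rho p.1 * (p.1 ^+ 2 / eps ^+ 2).
      by rewrite /C; field; rewrite gt_eqF.
    rewrite ler_peMr//; first by have h := i_C0_ge0 I; nneg.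
    by rewrite ler_pdivlMr ?exprn_gt0// mul1r ler_sqr ?nnegrE// ltW.
  have : 0 <= w p.1 * strain u p by rewrite mulr_ge0.
  lra.
pose B := delta * C * beta.
have B0 : 0 <= B by rewrite /B; nneg.
have cb : 0 < c2 - b by rewrite subr_gt0.
(* Chosen so that [c2 * M] exceeds [b * M + B], which lets the constants drop out of the inequality
   for the excess. *)
pose M := (B + 1) / (c2 - b).
have M0 : 0 < M by rewrite divr_gt0//; lra.
have cM : c2 * M = b * M + B + 1.
  have : (c2 - b) * M = B + 1 by rewrite mulrC divfK// gt_eqF.
  by rewrite mulrBl; lra.
have nw1 : nnm (fun p : R * R => (w p.1)%:E).
  by apply: nnm_EFin => [|p]; [exact: measurableT_comp mw measurable_fst|exact: w0].
have nC : nnm (fun p : R * R => (C * (rho p.1 * p.1 ^+ 2))%:E).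
  apply: nnm_EFin => [|p]; last by have rh := i_rho_ge0 I p.1; nneg.
  apply: measurable_funM => //.
  have /measurable_EFinP mr := (nnm_wx2 (i_mrho I) (i_rho_ge0 I)).1.
  exact: measurableT_comp mr measurable_fst.
(* Kept general in [v] because it serves twice: with the excess of [u] over [M], and, once this is
   known to vanish, with [0], which bounds the gradient at every point. *)
have gle (v : R -> \bar R) z : nnm v -> (forall p, 0 < p.1 -> (box u p <= M%:E * p.1%:E + box v p)%E) ->
    (gradient u z <= (b * M + B)%:E + boxT (fun p => (w p.1)%:E * box v p)%E z)%E.
  move=> nv uv.
  have nwv := nnmM nw1 (nnm_box nv).
  have nwM : nnm (fun p : R * R => (M * (w p.1 * p.1))%:E).
    have mw' : measurable_fun [set: R * R] (fun p : R * R => w p.1).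
      exact: measurableT_comp mw measurable_fst.
    apply: nnm_EFin => [|p].
      by apply: measurable_funM => //; apply: measurable_funM.
    have [p0|p0] := leP 0 p.1; first by have h := w0 p.1; nneg.
    by rewrite wout ?mul0r ?mulr0// negb_and -leNgt (ltW p0).
  apply: (@le_trans _ _ (boxT (fun p => ((M * (w p.1 * p.1))%:E + (C * (rho p.1 * p.1 ^+ 2))%:E) +
      (w p.1)%:E * box v p) z)%E).
    apply: boxT_le; [exact: (nnm_f I)|exact: nnmD (nnmD nwM nC) nwv|move=> p].
    have [pin|pout] := boolP (0 < p.1 < delta); last first.
      rewrite /stress (i_f_out I)// adde_ge0//; last exact: nwv.2.
      by rewrite adde_ge0 ?nwM.2 ?nC.2.
    have /andP[p0 _] := pin.
    apply: (@le_trans _ _ ((w p.1 * strain u p + C * (rho p.1 * p.1 ^+ 2))%:E)).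
      by rewrite lee_fin fbound.
    rewrite EFinD addeAC; apply: leeD2r; rewrite EFinM /strain fineK ?box_fin//.
    apply: le_trans (lee_wpmul2l _ (uv p p0)) _; first by rewrite lee_fin.
    rewrite ge0_muleDr ?(nnm_box nv).2 ?mule_ge0 ?lee_fin ?(ltW M0) ?(ltW p0)//.
    by rewrite -!EFinM mulrCA.
  rewrite (boxTD _ (nnmD nwM nC) nwv) (boxTD _ nwM nC); apply: leeD2r.
  rewrite EFinD; apply: leeD; last exact: boxT_tail.
  rewrite (@boxT_fst (fun x => M * (w x * x))) => [|||x x0].
  - have M1 : (0 <= M%:E :> \bar R)%E by rewrite lee_fin ltW.
    rewrite mulrC EFinM -wE -(nnm_intZ mu _ M1 (nnm_wx2 mw w0)).
    rewrite le_eqVlt; apply/orP; left; apply/eqP; apply: eq_integral => x _.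
    by rewrite -EFinM; congr EFin; ring.
  - by apply: measurable_funM => //; apply: measurable_funM.
  - move=> x; have [p0|p0] := leP 0 x; first by have h := w0 x; nneg.
    by rewrite wout ?mul0r ?mulr0// negb_and -leNgt (ltW p0).
  - by rewrite wout ?mul0r ?mulr0// negb_and -leNgt x0.
have M0' : (0 <= M%:E :> \bar R)%E by rewrite lee_fin ltW.
pose v z := maxe (u z - M%:E)%E 0%E.
have v0 z : (0 <= v z)%E by rewrite le_max lexx orbT.
have nv : nnm v.
  split => //; apply: measurable_maxe => //; apply: emeasurable_funB => //; exact: nu.1.
have uMv z : (u z <= M%:E + v z)%E.
  by rewrite addeC -leeBlDr// le_max lexx.
have buv p : 0 < p.1 -> (box u p <= M%:E * p.1%:E + box v p)%E.
  move=> p0; rewrite -box_cst// -(boxD _ (nnm_cst _ M0') nv).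
  by apply: box_le => //; exact: (nnmD (nnm_cst _ M0') nv).
have nwv := nnmM nw1 (nnm_box nv).
have c2_0 : 0 < c2 by lra.
have vle : {ae mu, forall z, (c2%:E * v z <= boxT (fun p => (w p.1)%:E * box v p) z)%E}.
  move: EL; apply: filterS => z uz.
  have := gle v z nv buv; rewrite uz /v; have := nu.2 z.
  have bT0 := (nnm_boxT nwv).2 z; rewrite -/v.
  case: (u z) => [x _|_|//].
    rewrite -EFinB -EFin_max -!EFinM; case: (boxT _ _) bT0 => [y|_ _|//]; last by rewrite leey.
    rewrite -EFinD !lee_fin => y0 xy; have [xM|Mx] := leP (x - M) 0; first by rewrite mulr0.
    by rewrite mulrBr; lra.
  rewrite addye// gt0_muley ?lte_fin//; case: (boxT _ _) bT0 => [y|_ _|//]; last by rewrite leey.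
  by rewrite -EFinD leye_eq.
have nv1 : nnm (fun z => (M^-1)%:E * u z ^+ 2)%E.
  by apply: nnmM (nnm_sq nu); apply: nnm_cst; rewrite lee_fin invr_ge0 ltW.
(* Finiteness, from [v <= u ^+ 2 / M], is what allows the integral of [v] to be cancelled below. *)
have vfin : (\int[mu]_z v z < +oo)%E.
  apply: (@le_lt_trans _ _ (\int[mu]_z ((M^-1)%:E * u z ^+ 2))%E).
    apply: (nnm_le mu nv nv1) => z; rewrite /v; have := nu.2 z.
    case: (u z) => [x x0|_|//]; last by rewrite expe2 mulyy gt0_muley ?leey ?lte_fin ?invr_gt0.
    rewrite -EFinB -EFin_max -EFin_expe -EFinM lee_fin ge_max.
    have h : 0 <= M^-1 * x ^+ 2 by rewrite mulr_ge0 ?sqr_ge0// invr_ge0 ltW.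
    rewrite h andbT mulrC ler_pdivlMr//; rewrite lee_fin in x0.
    by have := sqr_ge0 (x - M); nra.
  rewrite (nnm_intZ mu) ?lee_fin ?invr_ge0 ?(ltW M0)//; last exact: nnm_sq.
  by rewrite -/(norm2 u) uE -EFinM ltry.
have v_int0 : (\int[mu]_z v z = 0)%E.
  have n1 : nnm (fun _ : R => 1%:E : \bar R) by exact: nnm_cst.
  have c2E : (0 <= c2%:E :> \bar R)%E by rewrite lee_fin ltW.
  have H1 : (c2%:E * \int[mu]_z v z <= \int[mu]_z boxT (fun p => (w p.1)%:E * box v p) z)%E.
    rewrite -(nnm_intZ mu _ c2E nv); apply: ae_ge0_le_integral => //.
    - by move=> z _; rewrite mule_ge0.
    - exact: (nnmM (nnm_cst _ c2E) nv).1.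
    - by move=> z _; exact: (nnm_boxT nwv).2.
    - exact: (nnm_boxT nwv).1.
    - by move: vle; apply: filterS => z ? _.
  have H2 : (\int[mu]_z boxT (fun p => (w p.1)%:E * box v p) z = b%:E * \int[mu]_z v z)%E.
    transitivity (\int[mu]_z (boxT (fun p => (w p.1)%:E * box v p) z * 1%:E))%E.
      by apply: eq_integral => z _; rewrite mule1.
    rewrite (boxT_adj nwv n1) -wE.
    have wx0 x : 0 <= w x * x.
      have [x0|x0] := leP 0 x; first by rewrite mulr_ge0.
      by rewrite wout ?mul0r// negb_and -leNgt (ltW x0).
    have <- : (\int[mu2]_p ((w p.1 * p.1)%:E * box v p) = (\int[mu]_x (w x * x ^+ 2)%:E) * \int[mu]_z v z)%E.
      rewrite (@integral_box _ (fun x => (w x * x)%:E) v) => [|||//].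
      - by congr (_ * _)%E; apply: eq_integral => x _; rewrite -EFinM -mulrA expr2.
      - by apply: nnm_EFin => //; exact: measurable_funM.
      - by move=> x x0; rewrite wout ?mul0r// negb_and -leNgt x0.
    apply: eq_integral => p _.
    have [pin|pout] := boolP (0 < p.1 < delta); last by rewrite wout// mul0r !mul0e.
    have /andP[p0 _] := pin.
    by rewrite box_cst// mul1e muleAC EFinM.
  rewrite H2 in H1; have vi0 := nnm_ge0 mu nv; move: H1 vfin vi0.
  case: (integral _ _ _) => [x| |]//.
  rewrite -!EFinM !lee_fin => xb _ x0; congr EFin.
  have : (c2 - b) * x <= 0 by rewrite mulrBl; lra.
  by rewrite pmulr_rle0// => xle; apply/eqP; rewrite eq_le xle x0.
have uM : {ae mu, forall z, (u z <= M%:E)%E}.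
  move: (nnm_int0 mu nv v_int0); apply: filterS => z /(_ Logic.I) vz.
  by have := uMv z; rewrite vz /= adde0.
exists M; split => // z.
have n0 : nnm (fun _ : R => 0%E : \bar R) by exact: nnm_cst.
have bu0 p : 0 < p.1 -> (box u p <= M%:E * p.1%:E + box (fun=> 0%E) p)%E.
  move=> p0; rewrite box_cst// mul0e adde0 -box_cst//.
  apply: ae_ge0_le_integral => //.
  - by move=> y _; exact: (nnmM (nnm_chi2 p) nu).2.
  - exact: (nnmM (nnm_chi2 p) nu).1.
  - by move=> y _; rewrite mule_ge0// lee_fin chi_ge0.
  - exact: (nnmM (nnm_chi2 p) (nnm_cst _ M0')).1.
  - by move: uM; apply: filterS => y uy _; rewrite lee_wpmul2l// lee_fin chi_ge0.
apply: le_trans (gle _ z n0 bu0) _.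
rewrite (_ : boxT _ _ = 0%E); last first.
  apply: integral0_eq => p _; rewrite (_ : box _ _ = 0%E) ?mule0//.
  by apply: integral0_eq => y _; rewrite mule0.
by rewrite adde0 lee_fin cM; lra.
Qed.

End Boundedness.

(** * Lipschitz continuity *)

Section Lipschitz.
Context {R : realType}.
Local Notation mu := (@lebesgue_measure R).
Local Notation mu2 := (@plane_measure R).

Lemma box_shift (u : R -> \bar R) (x s t : R) : nnm u ->
  box u (x, s + t) = box (fun z => u (z + t)%R) (x, s).
Proof.
move=> nu; rewrite /box -[LHS](integral_shift t); last exact: (nnmM (nnm_chi2 _) nu).
by apply: eq_integral => z _; rewrite /chi/= opprD addrACA subrr addr0.
Qed.

Lemma boxT_shift (h : R * R -> \bar R) (z t : R) : nnm h ->
  boxT h (z + t) = boxT (fun p => h (p.1, p.2 + t)%R) z.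
Proof.
move=> nh.
have mt : measurable_fun [set: R * R] (fun p : R * R => (p.1, p.2 + t)).
  by apply: measurable_fun_pair => //; apply: measurable_funD.
rewrite (boxT_iter (z + t) nh) (boxT_iter z (nnm_comp nh mt)).
apply: eq_integral => x _ /=; rewrite box_shift//.
exact: (nnm_comp nh (pair1_measurable x)).
Qed.

(** The points gained by the shift lie between an end of the old window and its translate, and the
    extra window is centred midway. Its width is twice [|t|] so that the open window also contains
    the end point. *)
Lemma chi_shift (x s t z : R) :
  chi (x, s + t) z <= chi (x, s) z + chi (2 * `|t|, s + (Num.sg t * x + t) / 2) z.
Proof.
have c0 := chi_ge0 (2 * `|t|, s + (Num.sg t * x + t) / 2) z.
rewrite {1 2}/chi/=; case: ifPn => [h1|_]; last by rewrite addr_ge0//; case: ifP.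
case: ifPn => [_|h2]; first by rewrite lerDl.
rewrite add0r /chi/= ifT// [ltRHS]mulrC mulKf//.
move: h1 h2; rewrite -leNgt ltr_distl ler_normr => /andP[h1 h3] h2.
have [t0|t0|t0] := ltgtP t 0.
- rewrite (ltr0_sg t0) (ltr0_norm t0) ltr_distl; apply/andP; case/orP: h2 => h2; split; lra.
- rewrite (gtr0_sg t0) (gtr0_norm t0) ltr_distl; apply/andP; case/orP: h2 => h2; split; lra.
- by move: h1 h3 h2; rewrite t0 => h1 h3 /orP[]; lra.
Qed.

Variables (delta : R) (F f : R -> R -> R) (kap rho phi : R -> R) (C0 : R).
Hypothesis I : interaction delta F f kap rho phi C0.
Local Notation energy := (energy F).
Local Notation csq := (csq kap).
Local Notation beta := (beta rho).
Local Notation gradient := (gradient f).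
Local Notation stress := (stress f).

Lemma box_ae u v (p : R * R) : nnm u -> nnm v ->
  {ae mu, forall z, u z = v z} -> box u p = box v p.
Proof.
move=> nu nv uv.
apply: (nnm_ae_eq mu (nnmM (nnm_chi2 p) nu) (nnmM (nnm_chi2 p) nv)).
by move: uv; apply: filterS => z -> _.
Qed.

(** Strains do not see null sets, so replacing [u] by its gradient divided by [c2] turns an equation
    valid almost everywhere into one valid everywhere. *)
Lemma regular_representative u c2 : nnm u -> unimodal u -> (norm2 u < +oo)%E -> csq < c2 ->
  {ae mu, forall z, gradient u z = (c2%:E * u z)%E} ->
  exists (U : R -> R) M, [/\ 0 < M, forall z, 0 <= U z <= M,
    unimodal (EFin \o U), energy (EFin \o U) = energy u &
    forall z, gradient (EFin \o U) z = (c2 * U z)%:E].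
Proof.
move=> nu uu Tu cc EL.
have [M [M0 gM uM]] := gradient_bounded I nu uu Tu cc EL.
have c20 : 0 < c2 by exact: le_lt_trans (csq_ge0 I) cc.
have ng : nnm (gradient u) := nnm_gradient I nu.
have ug := gradient_unimodal I nu uu Tu.
pose U z := fine (gradient u z) / c2.
have gE z : gradient u z = (c2 * U z)%:E.
  rewrite /U mulrC divfK ?gt_eqF// fineK// ge0_fin_numE ?ng.2//.
  by apply: le_lt_trans (gM z) _; rewrite ltry.
have uUn : unimodal (EFin \o U).
  move=> x y xy; rewrite lee_fin -(ler_pM2l c20) -lee_fin -!gE.
  exact: ug.
have U0 z : 0 <= U z by rewrite -(pmulr_rge0 _ c20) -lee_fin -gE ng.2.
have nU : nnm (EFin \o U) by apply: unimodal_nnm => // z; rewrite lee_fin.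
have uU : {ae mu, forall z, u z = (EFin \o U) z}.
  move: EL; apply: filterS => z; rewrite gE => uz /=.
  have : (c2%:E * (U z)%:E = c2%:E * u z)%E by rewrite -EFinM.
  have := nu.2 z; case: (u z) => [x _|_|//]; last by rewrite gt0_muley ?lte_fin// -EFinM.
  by rewrite -!EFinM => -[] /mulfI -> //; rewrite gt_eqF.
have bE p : box u p = box (EFin \o U) p by exact: box_ae.
have sE : strain u = strain (EFin \o U) by apply/funext => p; rewrite /strain bE.
exists U, M; split; [exact: M0| |exact: uUn| |].
- by move=> z; rewrite U0/= -(ler_pM2l c20) -lee_fin -gE.
- by rewrite !energyE sE.
- by move=> z; rewrite -gE /gradient /stress sE.
Qed.

Section Estimate.
Variables (U : R -> R) (M c2 : R).
Hypothesis M0 : 0 < M.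
Hypothesis U0M : forall z, 0 <= U z <= M.
Hypothesis mU : measurable_fun [set: R] U.
Hypothesis cc : csq < c2.
Hypothesis gU : forall z, gradient (EFin \o U) z = (c2 * U z)%:E.
Let u := EFin \o U.

Let nu : nnm u.
Proof. by apply: nnm_EFin => // z; have /andP[] := U0M z. Qed.

Lemma box_strain (p : R * R) : 0 < p.1 -> box u p = (strain u p)%:E.
Proof.
move=> p0; rewrite /strain fineK// ge0_fin_numE ?(nnm_box nu).2//.
apply: (@le_lt_trans _ _ (box (fun=> M%:E) p)).
  apply: box_le => // [|z]; first by apply: nnm_cst; rewrite lee_fin ltW.
  by rewrite lee_fin; have /andP[] := U0M z.
by rewrite box_cst ?lee_fin ?ltW// -EFinM ltry.
Qed.

Lemma strain_leM (p : R * R) : 0 < p.1 -> strain u p <= M * p.1.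
Proof.
move=> p0; rewrite -lee_fin -box_strain// EFinM -box_cst ?lee_fin ?(ltW M0)//.
apply: box_le => // [|z]; first by apply: nnm_cst; rewrite lee_fin ltW.
by rewrite lee_fin; have /andP[] := U0M z.
Qed.

Lemma strain_shift_D (x s t D : R) : 0 < x -> 0 <= D -> (forall z, U (z + t) <= U z + D) ->
  strain u (x, s + t) <= strain u (x, s) + D * x.
Proof.
move=> x0 D0 UD; rewrite -lee_fin EFinD -!box_strain// box_shift//.
have D0' : (0 <= D%:E :> \bar R)%E by rewrite lee_fin.
rewrite EFinM -(@box_cst _ _ (x, s))// -(boxD _ nu (nnm_cst _ D0')).
apply: box_le => [||z].
- have mt : measurable_fun [set: R] (fun z : R => z + t) by exact: measurable_funD.
  exact: (nnm_comp nu mt).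
- exact: (nnmD nu (nnm_cst _ D0')).
- by rewrite -EFinD lee_fin UD.
Qed.

Lemma strain_shift_M (x s t : R) : 0 < x ->
  strain u (x, s + t) <= strain u (x, s) + M * (2 * `|t|).
Proof.
move=> x0; have [->|t0] := eqVneq t 0.
  by rewrite addr0 normr0 !mulr0 addr0.
rewrite -lee_fin EFinD -!box_strain//.
pose p := (2 * `|t|, s + (Num.sg t * x + t) / 2).
have p0 : 0 < p.1 by rewrite /= mulr_gt0// normr_gt0.
have M0' : (0 <= M%:E :> \bar R)%E by rewrite lee_fin ltW.
have nM : nnm (fun _ : R => M%:E) by exact: nnm_cst.
have -> : (M * (2 * `|t|))%:E = box (fun=> M%:E) p by rewrite box_cst// -EFinM.
rewrite /box -(nnm_intD mu (nnmM (nnm_chi2 _) nu) (nnmM (nnm_chi2 _) nM)).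
apply: (nnm_le mu (nnmM (nnm_chi2 _) nu) (nnmD (nnmM (nnm_chi2 _) nu) (nnmM (nnm_chi2 _) nM))) => z.
rewrite -!EFinM -EFinD lee_fin.
have /andP[U0 UM] := U0M z.
have h := chi_shift x s t z; have h0 := chi_ge0 p z.
apply: (@le_trans _ _ ((chi (x, s) z + chi p z) * U z)); first by rewrite ler_wpM2r.
by rewrite mulrDl lerD2l ler_wpM2l.
Qed.

(** A bound [D] on all increments by [t] is improved by the equation to [(b * D + L1 * |t|) / c2].
    Since [b < c2], the least such bound, when positive, is at most [L1 / (c2 - b) * |t|]. *)
Lemma lipschitz : exists2 L, 0 <= L & forall z t, `|U (z + t) - U z| <= L * `|t|.
Proof.
have [e [d [e0 d0 phid bc]]] := margin I cc.
have [w [wdef mw w0 wout wE]] := weight_facts I e0.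
set b := csq + e * beta in bc wE.
have dl := i_delta_gt0 I; have c00 := csq_ge0 I; have b0 := beta_ge0 I.
have b_0 : 0 <= b by rewrite /b; nneg.
have A0 : 0 <= M * delta by nneg.
have phA := i_phi_ge0 I A0.
have C00 := i_C0_ge0 I.
pose C (t : R) : R := (C0 + phi (M * delta)) * (M * (2 * `|t|)) * (M ^+ 2 / d ^+ 2).
have C_0 t : 0 <= C t by rewrite /C; nneg.
have nwD D : 0 <= D -> nnm (fun p : R * R => (w p.1 * p.1 * D)%:E).
  move=> D0; apply: nnm_EFin => [|p].
    apply: measurable_funM => //; apply: measurable_funM => //.
    exact: measurableT_comp mw measurable_fst.
  have [p0|p0] := leP 0 p.1; first by have h := w0 p.1; nneg.
  by rewrite wout ?mul0r// negb_and -leNgt (ltW p0).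
have nC t : nnm (fun p : R * R => (C t * (rho p.1 * p.1 ^+ 2))%:E).
  apply: nnm_EFin => [|p]; last by have rh := i_rho_ge0 I p.1; have h := C_0 t; nneg.
  apply: measurable_funM => //.
  have /measurable_EFinP mr := (nnm_wx2 (i_mrho I) (i_rho_ge0 I)).1.
  exact: measurableT_comp mr measurable_fst.
(* The strain increment has two bounds. Where the shifted strain is at most [d], the bound [D * x]
   is used with the slope [w x]. Where it exceeds [d], the bound [2 * M * |t|] is used: then
   [d <= M * x], and the factor [(M * x) ^+ 2 / d ^+ 2 >= 1] supplies the two powers of [x]. *)
have step t D : 0 <= D -> (forall z, U (z + t) <= U z + D) ->
    forall z, c2 * U (z + t) <= c2 * U z + b * D + delta * C t * beta.
  move=> D0 UD z.
  have ns : nnm (stress u) := nnm_f I nu.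
  have mt : measurable_fun [set: R * R] (fun p : R * R => (p.1, p.2 + t)).
    by apply: measurable_fun_pair => //; apply: measurable_funD.
  rewrite -lee_fin !EFinD -!gU /gradient boxT_shift//.
  apply: (@le_trans _ _ (boxT (fun p => (stress u p + (w p.1 * p.1 * D)%:E) +
      (C t * (rho p.1 * p.1 ^+ 2))%:E) z)%E).
    apply: boxT_le; [exact: (nnm_comp ns mt)|exact: (nnmD (nnmD ns (nwD D D0)) (nC t))|].
    move=> [x s]; rewrite /stress/= -!EFinD lee_fin.
    have [pin|pout] := boolP (0 < x < delta); last first.
      by rewrite !(i_f_out I)// wout// (i_rho_out I)// !(mul0r, mulr0) !addr0.
    have /andP[x0 xd] := pin.
    have [kh rh] := (i_kap_ge0 I x, i_rho_ge0 I x).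
    have sD := strain_shift_D s x0 D0 UD; have sM := strain_shift_M s t x0.
    have a0 := strain_ge0 (x, s) nu; have a'0 := strain_ge0 (x, s + t) nu.
    have aM' := @strain_leM (x, s + t) x0.
    rewrite -/u; move: (strain u (x, s)) (strain u (x, s + t)) sD sM a0 a'0 aM' => a a' sD sM a0 a'0 /= aM'.
    have h1 : 0 <= w x * x * D by have h := w0 x; nneg.
    have h2 : 0 <= C t * (rho x * x ^+ 2) by have h := C_0 t; nneg.
    have [aa|aa] := leP a' a; first by have := i_f_nd I x a'0 aa; lra.
    have lip := i_f_lip I x a0 (ltW aa).
    have [ad|da] := leP a' d.
      have : (kap x + rho x * phi a') * (a' - a) <= w x * x * D; last by lra.
      rewrite -mulrA; apply: ler_pM; rewrite ?subr_ge0 ?(ltW aa)//; last by lra.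
        by rewrite addr_ge0// mulr_ge0// (i_phi_ge0 I).
      by rewrite wdef lerD2l mulrC ler_wpM2r// (le_trans (i_phi_nd I a'0 ad)).
    have xdM : d <= M * x by lra.
    have : (kap x + rho x * phi a') * (a' - a) <= C t * (rho x * x ^+ 2); last by lra.
    have -> : C t * (rho x * x ^+ 2) =
      ((C0 * rho x + rho x * phi (M * delta)) * (M * (2 * `|t|))) * ((M * x) ^+ 2 / d ^+ 2).
      by rewrite /C; field; rewrite gt_eqF.
    have r1 : 1 <= (M * x) ^+ 2 / d ^+ 2.
      by rewrite ler_pdivlMr ?exprn_gt0// mul1r ler_sqr ?nnegrE//; nneg.
    have h3 : (kap x + rho x * phi a') * (a' - a) <=
       (C0 * rho x + rho x * phi (M * delta)) * (M * (2 * `|t|)).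
      apply: ler_pM; rewrite ?subr_ge0 ?(ltW aa)//; last by lra.
        by rewrite addr_ge0// mulr_ge0// (i_phi_ge0 I).
      apply: lerD; first exact: (i_kap_rho I).
      rewrite ler_wpM2l// (i_phi_nd I)//; apply: le_trans aM' _.
      by rewrite ler_wpM2l// ltW.
    by apply: le_trans h3 _; rewrite ler_peMr//; nneg.
  rewrite (boxTD _ (nnmD ns (nwD D D0)) (nC t)) (boxTD _ ns (nwD D D0)).
  apply: leeD; last exact: (boxT_tail I).
  apply: leeD2l; rewrite (@boxT_fst _ (fun x => w x * x * D)) => [|||x x0].
  - have D0' : (0 <= D%:E :> \bar R)%E by rewrite lee_fin.
    rewrite mulrC EFinM -wE -(nnm_intZ mu _ D0' (nnm_wx2 mw w0)).
    rewrite le_eqVlt; apply/orP; left; apply/eqP; apply: eq_integral => x _.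
    by rewrite -EFinM; congr EFin; ring.
  - by apply: measurable_funM => //; apply: measurable_funM.
  - move=> x; have [p0|p0] := leP 0 x; first by have h := w0 x; nneg.
    by rewrite wout ?mul0r// negb_and -leNgt (ltW p0).
  - by rewrite wout ?mul0r// negb_and -leNgt x0.
have c2b : 0 < c2 - b by rewrite subr_gt0.
have c20 : 0 < c2 by lra.
pose L1 := delta * ((C0 + phi (M * delta)) * (M * 2) * (M ^+ 2 / d ^+ 2)) * beta.
have CL t : delta * C t * beta = L1 * `|t| by rewrite /L1 /C; ring.
have L10 : 0 <= L1 by rewrite /L1; nneg.
pose L := L1 / (c2 - b).
have L0 : 0 <= L by rewrite /L; apply: divr_ge0 => //; exact: ltW.
have one z t : U (z + t) - U z <= L * `|t|.
  pose S := [set U (y + t) - U y | y in [set: R]].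
  have hub : has_ubound S.
    exists M => _ [y _ <-]; have /andP[h1 h2] := U0M y; have /andP[h3 h4] := U0M (y + t); lra.
  have inS y : U (y + t) - U y <= sup S by apply: ub_le_sup => //; exists y.
  apply: le_trans (inS z) _.
  have [sn|sp] := leP (sup S) 0; first by apply: le_trans sn _; rewrite mulr_ge0.
  have UD y : U (y + t) <= U y + sup S by have := inS y; lra.
  have st := step t (sup S) (ltW sp) UD.
  have : sup S <= (b * sup S + L1 * `|t|) / c2.
    apply: ge_sup; first by exists (U (z + t) - U z); exists z.
    move=> _ [y _ <-]; rewrite ler_pdivlMr//; have := st y; rewrite CL mulrBl; lra.
  rewrite ler_pdivlMr// => h; rewrite /L mulrAC ler_pdivlMr// mulrBr.
  by move: h; rewrite [b * _]mulrC; lra.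
exists L => // z t; rewrite ler_norml; apply/andP; split; last exact: one.
have := one (z + t) (- t); rewrite addrK normrN; lra.
Qed.

End Estimate.
End Lipschitz.

(** * Primitives on the whole line *)

Section Primitive.
Context {R : realType}.
Local Notation mu := (@lebesgue_measure R).

Lemma integrable_itv (k : R -> R) (a b : itv_bound R) (x y : R) : continuous k ->
  [set` Interval a b] `<=` `[x, y] -> measurable [set` Interval a b] ->
  mu.-integrable [set` Interval a b] (EFin \o k).
Proof.
move=> ck sub mI; apply: (@integrableS _ _ _ mu `[x, y]%classic) => //.
apply: continuous_compact_integrable; first exact: segment_compact.
exact: continuous_subspaceT.
Qed.

Lemma primitive_exists (k : R -> R) : continuous k ->
  exists Q : R -> R, forall z : R, is_derive z (1 : R) Q (k z).
Proof.
move=> ck.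
(* Starting the integrals at [- N] avoids oriented integrals for negative [z]. The value does not
   depend on [N > |z|], so near a given point [N] can be fixed and the fundamental theorem
   applied. *)
pose G (N z : R) : R := \int[mu]_(t in `](- N), z]) k t - \int[mu]_(t in `](- N), 0%R]) k t.
have int N y : mu.-integrable `](- N), y] (EFin \o k).
  by apply: (@integrable_itv _ _ _ (- N) y) => // t; rewrite /= !in_itv/= => /andP[/ltW -> ->].
have GN N N' z : `|z| < N -> N <= N' -> G N' z = G N z.
  move=> zN NN'; have N0 : 0 < N by exact: le_lt_trans zN.
  have H y : - N < y -> \int[mu]_(t in `](- N), y]) k t =
      \int[mu]_(t in `](- N'), y]) k t - \int[mu]_(t in `](- N'), (- N)]) k t.
    move=> Ny; rewrite -(@Rintegral_itvB _ k (BRight (- N')) (BRight y) (- N))//.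
    - by rewrite bnd_simp lerN2.
    - by rewrite bnd_simp ltW.
  have Nz : - N < z by move: zN; rewrite ltr_norml => /andP[].
  have N00 : - N < 0 by rewrite oppr_lt0.
  by rewrite /G (H z Nz) (H 0 N00); ring.
exists (fun z => G (`|z| + 1) z) => z.
pose N := `|z| + 2.
have Nz : - N < z by rewrite /N; have := ler_norm (- z); rewrite normrN; lra.
have zu : z < z + 1 by rewrite ltrDl.
have [d1 d2] := @continuous_FTC1 _ k (BRight (- N)) z (z + 1) zu (int _ _) Nz (ck z).
have dG : is_derive z (1 : R) (G N) (k z).
  have dF : is_derive z (1 : R) (fun x => \int[mu]_(t in `](- N), x]) k t) (k z).
    by split; [exact: d1|rewrite -derive1E; exact: d2].
  rewrite -[k z]subr0; apply: is_deriveB.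
apply: near_eq_is_derive dG; near=> y.
have yz : `|z - y| < 1 by near: y; exact: (@nbhsx_ballx _ R z 1 ltr01).
apply: GN; first by rewrite ltrDl.
by rewrite /N; have := lerB_dist y z; rewrite distrC; lra.
Unshelve. all: by end_near. Qed.

Lemma box_primitive (k Q : R -> R) (x s : R) : continuous k -> (forall z, 0 <= k z) ->
  (forall z : R, is_derive z (1 : R) Q (k z)) -> 0 < x ->
  box (EFin \o k) (x, s) = (Q (s + x / 2) - Q (s - x / 2))%:E.
Proof.
move=> ck k0 dQ x0; rewrite /box.
transitivity (\int[mu]_(z in `](s - x / 2)%R, (s + x / 2)%R[) (k z)%:E)%E.
  rewrite [RHS]integral_mkcond; apply: eq_integral => z _.
  by rewrite chiE indicE patchE/=; case: ifP => _; rewrite ?mul1e ?mul0e.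
rewrite -(@integral_itv_bndoo _ _ _ _ true false); last first.
  by apply/measurable_EFinP; apply: measurable_funTS; exact: continuous_measurable_fun.
have cQ : continuous Q.
  by move=> z; apply: differentiable_continuous; apply/derivable1_diffP; have [] := dQ z.
rewrite (@continuous_FTC2 _ k Q) ?EFinB//.
- by lra.
- exact: continuous_subspaceT.
- split; first by move=> z _; have [] := dQ z.
    by apply: cvg_at_right_filter; exact: cQ.
  by apply: cvg_at_left_filter; exact: cQ.
- by move=> z _; rewrite derive1E; have [_ ->] := dQ z.
Qed.

End Primitive.

(** * From the derivative to the wave profile *)

Section WaveProfile.
Context {R : realType}.
Local Notation mu := (@lebesgue_measure R).
Local Notation mu2 := (@plane_measure R).

Lemma lipschitz_continuous (k : R -> R) L :
  (forall z t, `|k (z + t) - k z| <= L * `|t|) -> continuous k.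
Proof.
move=> kL z; apply/cvgrPdist_lt => e e0.
have L0 : 0 <= L by have := kL 0 1; rewrite normr1 mulr1; apply: le_trans.
have L1 : 0 < L + 1 by lra.
near=> y.
have yz : `|z - y| < e / (L + 1).
  by near: y; apply: (@nbhsx_ballx _ R z); rewrite divr_gt0.
have zy : z + (y - z) = y by ring.
have := kL z (y - z); rewrite zy distrC (distrC y) => h.
apply: le_lt_trans h _; apply: (@le_lt_trans _ _ ((L + 1) * `|z - y|)).
  by rewrite ler_wpM2r// lerDl.
by rewrite mulrC -ltr_pdivlMr.
Unshelve. all: by end_near. Qed.

Variables (delta : R) (F f : R -> R -> R) (kap rho phi : R -> R) (C0 : R).
Hypothesis I : interaction delta F f kap rho phi C0.
Local Notation energy := (energy F).
Local Notation csq := (csq kap).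
Local Notation gradient := (gradient f).
Local Notation stress := (stress f).
Variables (U : R -> R) (M L c2 : R).
Hypothesis M0 : 0 < M.
Hypothesis L0 : 0 <= L.
Hypothesis c20 : 0 < c2.
Hypothesis U0M : forall z, 0 <= U z <= M.
Hypothesis UL : forall z t, `|U (z + t) - U z| <= L * `|t|.
Hypothesis gU : forall z, gradient (EFin \o U) z = (c2 * U z)%:E.
Let u := EFin \o U.

Let cU : continuous U. Proof. exact: lipschitz_continuous UL. Qed.
Let mU : measurable_fun [set: R] U. Proof. exact: continuous_measurable_fun. Qed.
Let nu : nnm u.
Proof. by apply: nnm_EFin => // z; have /andP[] := U0M z. Qed.
Let U0 z : 0 <= U z. Proof. by have /andP[] := U0M z. Qed.

Variable Q : R -> R.
Hypothesis dQ : forall z : R, is_derive z (1 : R) Q (U z).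

Lemma continuous_Q : continuous Q.
Proof.
by move=> z; apply: differentiable_continuous; apply/derivable1_diffP; have [] := dQ z.
Qed.

Lemma strainE (x s : R) : 0 < x -> strain u (x, s) = Q (s + x / 2) - Q (s - x / 2).
Proof. by move=> x0; rewrite /strain (box_primitive s cU U0 dQ x0). Qed.

Lemma Q_nondecreasing : {homo Q : x y / x <= y}.
Proof.
move=> x y; rewrite le_eqVlt => /predU1P[->//|xy].
have := strain_ge0 (y - x, (x + y) / 2) nu; rewrite strainE ?subr_gt0//.
have -> : (x + y) / 2 + (y - x) / 2 = y by field.
have -> : (x + y) / 2 - (y - x) / 2 = x by field.
by rewrite subr_ge0.
Qed.

(** A Lipschitz constant of [f] in its first argument on [[0, M * delta]], which contains all
    strains of bonds of length below [delta]. *)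
Let W x := kap x + rho x * phi (M * delta).

Let W_ge0 x : 0 <= W x.
Proof.
have dl := i_delta_gt0 I; have Md : 0 <= M * delta by nneg.
have h1 := i_kap_ge0 I x; have h2 := i_rho_ge0 I x; have h3 := i_phi_ge0 I Md.
by rewrite /W; nneg.
Qed.

Lemma f_strain_lip x s s' B : 0 < x < delta ->
  `|strain u (x, s') - strain u (x, s)| <= B ->
  `|f (strain u (x, s')) x - f (strain u (x, s)) x| <= W x * B.
Proof.
move=> /andP[x0 xd].
have dl := i_delta_gt0 I.
have aM r : 0 <= strain u (x, r) <= M * delta.
  rewrite strain_ge0//= (le_trans (strain_leM M0 U0M mU (p := (x, r)) x0))//.
  by rewrite ler_wpM2l// ltW.
have key a b : 0 <= a -> a <= b -> b <= M * delta -> b - a <= B ->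
    0 <= f b x - f a x <= W x * B.
  move=> a0 ab bM abB; rewrite subr_ge0 (i_f_nd I)//=.
  apply: le_trans (i_f_lip I x a0 ab) _; apply: ler_pM => //.
  - by rewrite addr_ge0 ?(i_kap_ge0 I)// mulr_ge0 ?(i_rho_ge0 I)// (i_phi_ge0 I)// (le_trans a0).
  - by rewrite subr_ge0.
  - by rewrite /W lerD2l ler_wpM2l ?(i_rho_ge0 I)// (i_phi_nd I)// (le_trans a0).
have /andP[h1 h2] := aM s; have /andP[h3 h4] := aM s'.
have [ss|ss] := leP (strain u (x, s)) (strain u (x, s')).
  rewrite ger0_norm ?subr_ge0// => hB.
  by have /andP[h5 h6] := key _ _ h1 ss h4 hB; rewrite ger0_norm.
rewrite distrC ger0_norm ?subr_ge0 ?(ltW ss)// => hB.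
by have /andP[h5 h6] := key _ _ h3 (ltW ss) h2 hB; rewrite distrC ger0_norm.
Qed.

Lemma strain_dist_M x s t : 0 < x ->
  `|strain u (x, s + t) - strain u (x, s)| <= 2 * M * `|t|.
Proof.
move=> x0; have h1 := strain_shift_M M0 U0M mU s t x0.
have := strain_shift_M M0 U0M mU (s + t) (- t) x0; rewrite addrK normrN.
by rewrite ler_norml => h2; apply/andP; split; lra.
Qed.

Lemma strain_dist_L x s : 0 < x ->
  `|strain u (x, s + x) - strain u (x, s)| <= L * x * x.
Proof.
move=> x0; have Lx : 0 <= L * x by rewrite mulr_ge0// ltW.
have UD t z : `|t| = x -> U (z + t) <= U z + L * x.
  by move=> tx; have := UL z t; rewrite tx ler_norml => /andP[]; lra.
have h1 := strain_shift_D M0 U0M mU s x0 Lx (fun z => UD x z (gtr0_norm x0)).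
have xn : `|- x| = x by rewrite normrN gtr0_norm.
have := strain_shift_D M0 U0M mU (s + x) x0 Lx (fun z => UD (- x) z xn).
by rewrite addrK ler_norml => h2; apply/andP; split; lra.
Qed.

Let k x s := f (strain u (x, s)) x.

Let k_ge0 x s : 0 <= k x s.
Proof. by rewrite (i_f_ge0 I)// strain_ge0. Qed.

Lemma continuous_k x : 0 < x < delta -> continuous (k x).
Proof.
move=> xin; have /andP[x0 _] := xin.
apply: (@lipschitz_continuous _ (W x * (2 * M))) => z t.
rewrite -mulrA; apply: f_strain_lip => //; exact: strain_dist_M.
Qed.

(** The contribution of bonds of length [x] to the gradient at [z]. It integrates the stress over a
    window about [z], so its derivative in [z] is the difference of the stresses at the two ends,
    namely [D]. *)
Let H z x := fine (box (fun s => stress u (x, s)) (x, z)).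
Let D z x := f (Q (z + x) - Q z) x - f (Q z - Q (z - x)) x.

Let DE z x : 0 < x < delta -> D z x = k x (z + x / 2) - k x (z - x / 2).
Proof.
move=> /andP[x0 _]; rewrite /D /k !strainE//.
have -> : z + x / 2 + x / 2 = z + x by field.
have -> : z + x / 2 - x / 2 = z by field.
have -> : z - x / 2 + x / 2 = z by field.
by have -> : z - x / 2 - x / 2 = z - x by field.
Qed.

Lemma H_out z x : ~~ (0 < x < delta) -> box (fun s => stress u (x, s)) (x, z) = 0%E.
Proof.
move=> xout; apply: integral0_eq => s _; rewrite /stress (i_f_out I)//.
by rewrite mule0.
Qed.

Lemma H_fin z x : box (fun s => stress u (x, s)) (x, z) = (H z x)%:E.
Proof.
have [xin|xout] := boolP (0 < x < delta); last by rewrite /H H_out.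
have /andP[x0 _] := xin.
have [Phi dPhi] := primitive_exists (continuous_k xin).
by rewrite /H (box_primitive z (continuous_k xin) (k_ge0 x) dPhi x0).
Qed.

Lemma H_derive z x : is_derive z (1 : R) (H ^~ x) (D z x).
Proof.
have [xin|xout] := boolP (0 < x < delta); last first.
  have -> : H ^~ x = cst 0 by apply/funext => y; rewrite /H H_out.
  by rewrite /D !(i_f_out I)// subrr; exact: is_derive_cst.
have /andP[x0 _] := xin.
have [Phi dPhi] := primitive_exists (continuous_k xin).
have -> : H ^~ x = (fun y => Phi (y + x / 2)) - (fun y => Phi (y - x / 2)).
  apply/funext => y.
  by rewrite /H (box_primitive y (continuous_k xin) (k_ge0 x) dPhi x0).
have sh c : is_derive z (1 : R) (fun y => Phi (y + c)) (k x (z + c)).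
  have h : is_derive z (1 : R) (fun y : R => y + c) 1.
    by rewrite -[X in is_derive _ _ _ X]addr0; apply: is_deriveD.
  have := @is_derive1_comp _ Phi (fun y : R => y + c) z _ _ (dPhi (z + c)) h.
  by rewrite mulr1.
by rewrite DE//; apply: is_deriveB; exact: sh.
Qed.

(** The two bonds have centres at distance [x], so the Lipschitz bound on [U] makes their strains
    differ by at most [L * x ^+ 2]. Boundedness of [U] alone would yield one power of [x], too few
    for the integrability that is assumed. *)
Lemma D_bound z x : `|D z x| <= W x * (L * x ^+ 2).
Proof.
have [xin|xout] := boolP (0 < x < delta); last first.
  by rewrite /D !(i_f_out I)// subrr normr0 mulr_ge0// mulr_ge0// sqr_ge0.
have /andP[x0 _] := xin.
rewrite DE// /k; apply: f_strain_lip => //.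
have := strain_dist_L (z - x / 2) x0; rewrite expr2 mulrA.
by have -> : z - x / 2 + x = z + x / 2 by field.
Qed.

Let G x := W x * (L * x ^+ 2).

Lemma G_integrable : mu.-integrable [set: R] (EFin \o G).
Proof.
have dl := i_delta_gt0 I; have Md : 0 <= M * delta by nneg.
have [mw w0 wout wE] := w_facts I ler01 (i_phi_ge0 I Md).
have L0' : (0 <= L%:E :> \bar R)%E by rewrite lee_fin.
have GE x : (EFin \o G) x = (L%:E * ((1 * kap x + phi (M * delta) * rho x) * x ^+ 2)%:E)%E.
  by rewrite /= -EFinM; congr EFin; rewrite /G /W; ring.
have nw := nnm_wx2 mw w0.
have nG := nnmM (nnm_cst _ L0') nw.
apply/integrableP; split.
  rewrite (_ : EFin \o G =
    fun x => L%:E * ((1 * kap x + phi (M * delta) * rho x) * x ^+ 2)%:E)%E.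
    exact: nG.1.
  by apply/funext.
under eq_integral do rewrite GE gee0_abs ?nG.2//.
by rewrite (nnm_intZ mu _ L0' nw) wE -EFinM ltry.
Qed.

Lemma D_integrable z : mu.-integrable [set: R] (EFin \o D z).
Proof.
apply: (le_integrable measurableT _ _ G_integrable); last first.
  move=> x _; rewrite lee_fin; apply: le_trans (D_bound z x) _.
  by rewrite ler_norm.
apply/measurable_EFinP; have mQ : measurable_fun [set: R] Q.
  exact: continuous_measurable_fun continuous_Q.
have mf (h : R -> R) : measurable_fun [set: R] h -> measurable_fun [set: R] (fun x => f (h x) x).
  move=> mh; have mp : measurable_fun [set: R] (fun x : R => (h x, x)) by exact: measurable_fun_pair.
  exact: (measurableT_comp (i_mf I) mp).
apply: measurable_funB; apply: mf; apply: measurable_funB => //.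
  by apply: measurableT_comp => //; exact: measurable_funD.
by apply: measurableT_comp => //; exact: measurable_funB.
Qed.

Lemma H_integral z : (\int[mu]_x (H z x)%:E)%E = (c2 * U z)%:E.
Proof.
rewrite -gU /gradient (boxT_iter _ (nnm_f I nu)).
by apply: eq_integral => x _; rewrite -H_fin.
Qed.

Lemma H_integrable z : mu.-integrable [set: R] (EFin \o H z).
Proof.
have ns : nnm (stress u) := nnm_f I nu.
have H0 x : 0 <= H z x.
  rewrite fine_ge0//; apply: integral_ge0 => s _.
  by rewrite mule_ge0 ?ns.2// lee_fin chi_ge0.
apply/integrableP; split.
  have [mf f0] := nnmM (nnm_chi1 z) ns.
  have := measurable_fun_fubini_tonelli_F (m2 := mu) _ mf f0.
  rewrite (_ : fubini_F _ _ = EFin \o H z)//.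
  apply/funext => x /=; rewrite -H_fin; apply: eq_integral => s _ /=.
  by rewrite chi_sym.
under eq_integral do rewrite /= ger0_norm//.
by rewrite H_integral ltry.
Qed.

Lemma U_derive z : derivable U z 1 /\ c2 * U^`()%classic z = \int[mu]_x D z x.
Proof.
have zI : `]z - 1, z + 1[%classic z by rewrite /= in_itv/=; apply/andP; split; lra.
have dH y x : derivable (H ^~ x) y 1 by have [] := H_derive y x.
have d1 y x : partial1of2 H y x = D y x.
  by rewrite partial1of2E; have [_] := H_derive y x.
have G0 x : 0 <= G x by rewrite /G mulr_ge0// mulr_ge0// sqr_ge0.
have UE : U = (fun y => c2^-1 * \int[mu]_x H y x).
  by apply/funext => y; rewrite /Rintegral H_integral/= mulKf// gt_eqF.
have dd := @derivable_under_integral _ _ _ mu H setT measurableT z (z - 1) (z + 1) zI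
  (fun y _ => H_integrable y) (fun y x _ _ => dH y x) G G0 G_integrable
  (fun y x _ _ => ltac:(rewrite d1; exact: D_bound)).
have de := @differentiation_under_integral _ _ _ mu H setT measurableT z (z - 1) (z + 1) zI
  (fun y _ => H_integrable y) (fun y x _ _ => dH y x) G G0 G_integrable
  (fun y x _ _ => ltac:(rewrite d1; exact: D_bound)).
split; first by rewrite UE; apply: derivableM; [exact: derivable_cst|exact: dd].
rewrite {1}UE derive1Ml// de mulVKf ?gt_eqF//.
by apply: eq_Rintegral => x _; rewrite d1.
Qed.

Lemma U'_continuous : continuous U^`()%classic.
Proof.
move=> z.
have zI : z \in `]z - 1, z + 1[%classic.
  by rewrite inE/= in_itv/=; apply/andP; split; lra.
have -> : U^`()%classic = (fun y => c2^-1 * \int[mu]_x D y x).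
  by apply/funext => y; have [_ <-] := U_derive y; rewrite mulKf// gt_eqF.
apply: cvgMr.
have := @continuity_under_integral _ _ _ mu D setT measurableT (z - 1) (z + 1)
  (fun y _ => D_integrable y) _ G G_integrable _ z zI; apply.
- apply: aeW => x _ y _.
  have [xin|xout] := boolP (0 < x < delta); last first.
    rewrite (_ : D ^~ x = cst 0); first exact: cvg_cst.
    by apply/funext => t; rewrite /D !(i_f_out I)// subrr.
  rewrite (_ : D ^~ x = (fun t => k x (t + x / 2) - k x (t - x / 2))); last first.
    by apply/funext => t; rewrite DE.
  have ck := continuous_k xin.
  have sh c : {for y, continuous (fun t : R => k x (t + c))}.
    have h : t + c @[t --> y] --> y + c by apply: cvgD; [exact: cvg_id|exact: cvg_cst].
    exact: (cvg_comp _ _ h (ck (y + c))).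
  by apply: cvgB; exact: sh.
- by move=> y _; apply: aeW => x _; exact: D_bound.
Qed.

(** A bond is labelled by its centre in [energy] and by its left end here; a translation by [x / 2]
    at fixed [x] relates the two. *)
Lemma energy_profile :
  energy u = (\int[mu]_z \int[mu]_x (F (Q (z + x)%R - Q z) x)%:E)%E.
Proof.
have mQ : measurable_fun [set: R] Q by exact: continuous_measurable_fun continuous_Q.
have nF := nnm_F I nu.
have nG2 : nnm (fun p : R * R => (F (Q (p.2 + p.1) - Q p.2) p.1)%:E).
  apply: nnm_EFin => [|p].
    have mp : measurable_fun [set: R * R] (fun p : R * R => (Q (p.2 + p.1) - Q p.2, p.1)).
      apply: measurable_fun_pair => //; apply: measurable_funB.
        by apply: measurableT_comp => //; exact: measurable_funD.
      exact: measurableT_comp.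
    exact: (measurableT_comp (i_mF I) mp).
  have [/andP[x0 _]|xout] := boolP (0 < p.1 < delta); last by rewrite (i_F_out I).
  by rewrite (F_ge0 I)// subr_ge0 Q_nondecreasing// lerDl ltW.
rewrite energyE (plane_tonelli nF) -(plane_swap nG2).
apply: eq_integral => x _ /=.
rewrite -(integral_shift (x / 2)); last exact: (nnm_comp nF (pair1_measurable x)).
apply: eq_integral => s _ /=.
have [xin|xout] := boolP (0 < x < delta); last by rewrite !(i_F_out I).
have /andP[x0 _] := xin; rewrite strainE//.
have -> : s + x / 2 + x / 2 = s + x by field.
by have -> : s + x / 2 - x / 2 = s by field.
Qed.

Lemma wave_profile :
  [/\ forall x, derivable Q x 1, forall x, derivable Q^`()%classic x 1,
      continuous Q^`(2)%classic &
      forall z, (c2 * Q^`(2)%classic z)%:E =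
        (\int[mu]_x (f (Q (z + x)%R - Q z) x - f (Q z - Q (z - x)%R) x)%:E)%E].
Proof.
have Q1 : Q^`()%classic = U.
  by apply/funext => z; rewrite derive1E; have [_ ->] := dQ z.
have Q2 : Q^`(2)%classic = U^`()%classic by rewrite /= Q1.
split.
- by move=> x; have [] := dQ x.
- by move=> x; rewrite Q1; have [] := U_derive x.
- by rewrite Q2; exact: U'_continuous.
- move=> z; rewrite Q2; have [_ ->] := U_derive z.
  by rewrite /Rintegral fineK//; exact: integrable_fin_num (D_integrable z).
Qed.

End WaveProfile.

(** * One-sided potentials and their kernels *)

Section OneSidedPotential.
Context {R : realType}.
Variables (V V1 V2 S : R -> R).
Hypothesis dV : forall x : R, is_derive x (1 : R) V (V1 x).
Hypothesis dV1 : forall x : R, is_derive x (1 : R) V1 (V2 x).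
Hypothesis cV2 : continuous V2.
Hypothesis V_0 : V 0 = 0.
Hypothesis V1_0 : V1 0 = 0.
Hypothesis V2_0 : 0 < V2 0.
Hypothesis V_cvx : forall a b t, 0 <= a -> 0 <= b -> 0 <= t <= 1 ->
  V (t * a + (1 - t) * b) <= t * V a + (1 - t) * V b.
Hypothesis V_sq : forall x y, 0 < x -> x < y -> V x / x ^+ 2 < V y / y ^+ 2.
Hypothesis S_nd : forall x y, 0 <= x -> x <= y -> S x <= S y.
Hypothesis V2_le : forall x, 0 <= x -> V2 x <= V2 0 + S x.

Lemma is_derive_continuous (g g1 : R -> R) :
  (forall x : R, is_derive x (1 : R) g (g1 x)) -> continuous g.
Proof.
by move=> dg z; apply: differentiable_continuous; apply/derivable1_diffP; have [] := dg z.
Qed.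

Let cV1 := is_derive_continuous dV1.

Lemma mean_value (g g1 : R -> R) a b : (forall x : R, is_derive x (1 : R) g (g1 x)) ->
  a < b -> exists2 c, a < c < b & g b - g a = g1 c * (b - a).
Proof.
move=> dg ab; have [c] := @MVT _ g g1 a b ab (fun x _ => dg x)
  (continuous_subspaceT (is_derive_continuous dg)).
by rewrite in_itv/=; exists c.
Qed.

(** If the chord slope from [a] to [b] were below [V1 a], it would be below [V1] near [a]. Convexity
    keeps the graph under the chord, so the mean value theorem on a step of proportion [t], short
    enough to stay within [e] of [a], gives a contradiction. *)
Lemma pot_tangent a b : 0 <= a -> 0 <= b -> V a + V1 a * (b - a) <= V b.
Proof.
move=> a0 b0; have [->|ab] := eqVneq a b; first by rewrite subrr mulr0 addr0.
rewrite leNgt; apply/negP => H.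
have ba0 : 0 < `|b - a| by rewrite normr_gt0 subr_eq0 eq_sym.
have : \forall y \near a, V b - V a < V1 y * (b - a).
  have c : V1 y * (b - a) @[y --> a] --> V1 a * (b - a) by apply: cvgMl; exact: cV1.
  move/cvgr_gt : c; apply; lra.
move=> /nbhs_ballP[e /= e0 ae].
pose t := Num.min (1 / 2) (e / (2 * `|b - a|)).
have t0 : 0 < t by rewrite lt_min; apply/andP; split; rewrite divr_gt0// mulr_gt0.
have t1 : t <= 1 / 2 by rewrite ge_min lexx.
have te : t * `|b - a| <= e / 2.
  apply: (@le_trans _ _ (e / (2 * `|b - a|) * `|b - a|)).
    by rewrite ler_wpM2r// ge_min lexx orbT.
  by rewrite le_eqVlt; apply/orP; left; apply/eqP; field; rewrite gt_eqF.
have h1 : V (a + t * (b - a)) <= V a + t * (V b - V a).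
  have := @V_cvx b a t b0 a0 ltac:(apply/andP; split; lra).
  have -> : t * b + (1 - t) * a = a + t * (b - a) by ring.
  lra.
have [c ca cE] : exists2 c, `|a - c| < e & V (a + t * (b - a)) - V a = V1 c * (t * (b - a)).
  have [altb|bltA|] := ltgtP a b; last by move=> abE; rewrite abE eqxx in ab.
  - have tp : 0 < t * (b - a) by rewrite mulr_gt0// subr_gt0.
    have at_ : a < a + t * (b - a) by rewrite ltrDl.
    have [c /andP[ac cb] cE] := mean_value dV at_.
    rewrite gtr0_norm ?subr_gt0// in te.
    by exists c; [rewrite ltr0_norm; lra|rewrite cE; congr (_ * _); ring].
  - have tp : t * (b - a) < 0 by rewrite pmulr_rlt0// subr_lt0.
    have at_ : a + t * (b - a) < a by rewrite gtrDl.
    have [c /andP[ac cb] cE] := mean_value dV at_.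
    rewrite ltr0_norm ?subr_lt0// in te.
    exists c; first by rewrite gtr0_norm; lra.
    by rewrite -opprB cE; ring.
have := ae c ca; rewrite /= => h2.
have : t * (V b - V a) < t * (V1 c * (b - a)) by rewrite ltr_pM2l.
have -> : t * (V1 c * (b - a)) = V1 c * (t * (b - a)) by ring.
rewrite -cE; lra.
Qed.

Lemma pot_V1_nd a b : 0 <= a -> a <= b -> V1 a <= V1 b.
Proof.
move=> a0; rewrite le_eqVlt => /predU1P[->//|ab].
have b0 : 0 <= b by lra.
have h1 := pot_tangent a0 b0; have h2 := pot_tangent b0 a0.
have : 0 <= (V1 b - V1 a) * (b - a) by rewrite mulrBl; lra.
by rewrite pmulr_lge0 ?subr_gt0// subr_ge0.
Qed.

Lemma pot_V1_ge0 a : 0 <= a -> 0 <= V1 a.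
Proof. by move=> a0; rewrite -V1_0 pot_V1_nd. Qed.

Lemma pot_V1_lip a b : 0 <= a -> a <= b -> V1 b - V1 a <= (V2 0 + S b) * (b - a).
Proof.
move=> a0; rewrite le_eqVlt => /predU1P[->|ab]; first by rewrite !subrr mulr0.
have [c /andP[ac cb] ->] := mean_value dV1 ab.
have c0 : 0 <= c by lra.
by rewrite ler_wpM2r ?subr_ge0 ?(ltW ab)// (le_trans (V2_le c0))// lerD2l S_nd// ltW.
Qed.

Lemma pot_V1_ub a : 0 <= a -> V1 a <= (V2 0 + S a) * a.
Proof. by move=> a0; have := pot_V1_lip (lexx 0) a0; rewrite V1_0 !subr0. Qed.

Lemma is_derive_sq (c x : R) : is_derive x (1 : R) (fun t : R => c / 2 * t ^+ 2) (c * x).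
Proof.
have h := is_deriveZ (c / 2) (is_deriveX 2 (is_derive_id x (1 : R))).
by apply: (is_derive_eq h); rewrite expr1 /GRing.scale/= mulr1; field.
Qed.

Lemma pot_ub a : 0 <= a -> V a <= (V2 0 + S a) / 2 * a ^+ 2.
Proof.
rewrite le_eqVlt => /predU1P[<-|a0]; first by rewrite V_0 expr0n mulr0.
have dg (x : R) : is_derive x (1 : R) (fun t => (V2 0 + S a) / 2 * t ^+ 2 - V t)
    ((V2 0 + S a) * x - V1 x).
  by apply: is_deriveB; exact: is_derive_sq.
have [c /andP[c0 ca]] := mean_value dg a0.
rewrite V_0 expr0n mulr0 !subr0 => h.
have : 0 <= ((V2 0 + S a) * c - V1 c) * a.
  rewrite mulr_ge0 ?(ltW a0)// subr_ge0; apply: le_trans (pot_V1_ub (ltW c0)) _.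
  by rewrite ler_wpM2r ?(ltW c0)// lerD2l S_nd// ltW.
by rewrite -h; lra.
Qed.

(** The limit of [V x / x ^+ 2] at [0] is [V2 0 / 2], and the quotient increases strictly. If it
    were below the limit at [y], the choice of [eta] makes [(V2 0 - eta) / 2] its value there, while
    [V2 > V2 0 - eta] near [0] makes it at least as large at some smaller [z]. Comparison with
    [x / 2] gives strictness. *)
Lemma pot_lb_strict x : 0 < x -> V2 0 / 2 * x ^+ 2 < V x.
Proof.
move=> x0.
suff H y : 0 < y -> V2 0 / 2 <= V y / y ^+ 2.
  have x2 : 0 < x / 2 by lra.
  have h : V (x / 2) / (x / 2) ^+ 2 < V x / x ^+ 2 by apply: V_sq; lra.
  by rewrite -ltr_pdivlMr ?exprn_gt0//; apply: le_lt_trans (H _ x2) h.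
move=> y0; rewrite leNgt; apply/negP => Hy.
pose eta := V2 0 - 2 * (V y / y ^+ 2).
have eta0 : 0 < eta by rewrite /eta; lra.
have : \forall z \near (0 : R), V2 0 - eta < V2 z.
  by have /cvgr_gt := cV2 (x := 0); apply; lra.
move=> /nbhs_ballP[e /= e0 He].
pose z := Num.min (e / 2) (y / 2).
have z0 : 0 < z by rewrite lt_min; apply/andP; split; lra.
have ze : z <= e / 2 by rewrite ge_min lexx.
have zy : z <= y / 2 by rewrite ge_min lexx orbT.
have h1 c : 0 < c -> c < z -> (V2 0 - eta) * c <= V1 c.
  move=> c0 cz; have [t /andP[t0 tc]] := mean_value dV1 c0.
  rewrite V1_0 !subr0 => ->; rewrite ler_wpM2r ?(ltW c0)//; apply/ltW/He.
  by rewrite /ball/= sub0r normrN gtr0_norm//; lra.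
have dg (t : R) : is_derive t (1 : R) (fun t => V t - (V2 0 - eta) / 2 * t ^+ 2)
    (V1 t - (V2 0 - eta) * t).
  by apply: is_deriveB; exact: is_derive_sq.
have [c /andP[c0 cz]] := mean_value dg z0.
rewrite V_0 expr0n mulr0 !subr0 => h.
have h2 : 0 <= (V1 c - (V2 0 - eta) * c) * z.
  by rewrite mulr_ge0 ?(ltW z0)// subr_ge0 h1.
have h3 : (V2 0 - eta) / 2 <= V z / z ^+ 2.
  by rewrite ler_pdivlMr ?exprn_gt0//; rewrite -h in h2; lra.
have h4 : V z / z ^+ 2 < V y / y ^+ 2 by apply: V_sq => //; lra.
by move: h3 h4; rewrite /eta; move: (V z / _) (V y / _) => A B; lra.
Qed.

Lemma pot_lb x : 0 <= x -> V2 0 / 2 * x ^+ 2 <= V x.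
Proof.
rewrite le_eqVlt => /predU1P[<-|x0]; first by rewrite V_0 expr0n mulr0.
exact/ltW/pot_lb_strict.
Qed.

Lemma pot_scale s x : 1 <= s -> 0 <= x -> s ^+ 2 * V x <= V (s * x).
Proof.
rewrite le_eqVlt => /predU1P[<- _|s1]; first by rewrite expr1n !mul1r.
rewrite le_eqVlt => /predU1P[<-|x0]; first by rewrite V_0 !mulr0 V_0.
have s0 : 0 < s by lra.
have sx : x < s * x by rewrite ltr_pMl.
have := V_sq x0 sx; rewrite exprMn ltr_pdivrMr ?exprn_gt0// => h.
have -> : V (s * x) = V (s * x) / (s ^+ 2 * x ^+ 2) * x ^+ 2 * s ^+ 2.
  by field; rewrite !gt_eqF.
by rewrite mulrC ler_wpM2r ?sqr_ge0// ltW.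
Qed.

(** The derivative of [V x / x ^+ 2] is nonnegative. Here this is read off by comparing, at
    [(1 - t) * x], the tangent at [x] with the superquadratic bound: a defect [D > 0] would satisfy
    [D <= t * V x], and the chosen [t] makes the right side at most [D / 2]. *)
Lemma pot_V1_double x : 0 <= x -> 2 * V x <= V1 x * x.
Proof.
rewrite le_eqVlt => /predU1P[<-|x0]; first by rewrite V_0 !mulr0.
rewrite leNgt; apply/negP => H.
have Vx : 0 <= V x by apply: le_trans (pot_lb (ltW x0)); rewrite mulr_ge0 ?sqr_ge0// divr_ge0// ltW.
pose D := 2 * V x - V1 x * x.
have D0 : 0 < D by rewrite /D; lra.
pose t := D / (2 * (V x + D)).
have den : 0 < 2 * (V x + D) by lra.
have t0 : 0 < t by rewrite divr_gt0.
have t1 : t < 1 by rewrite ltr_pdivrMr//; lra.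
have y0 : 0 < (1 - t) * x by rewrite mulr_gt0//; lra.
have h1 := pot_tangent (ltW x0) (ltW y0).
have h2 : V ((1 - t) * x) <= (1 - t) ^+ 2 * V x.
  have yx : (1 - t) * x < x by rewrite gtr_pMl//; lra.
  have := V_sq y0 yx; rewrite ltr_pdivrMr ?exprn_gt0// => /ltW h; apply: le_trans h _.
  by rewrite le_eqVlt; apply/orP; left; apply/eqP; field; rewrite gt_eqF.
have h3 : t * D <= t * (t * V x).
  have -> : t * D = 2 * (t * V x) - t * (V1 x * x) by rewrite /D; ring.
  have e1 : V1 x * ((1 - t) * x - x) = - (t * (V1 x * x)) by ring.
  have e2 : (1 - t) ^+ 2 * V x = V x - 2 * (t * V x) + t * (t * V x) by ring.
  rewrite e1 in h1; rewrite e2 in h2; lra.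
have h4 : D <= t * V x by rewrite -(ler_pM2l t0).
have h5 : t * V x <= D / 2.
  rewrite /t mulrAC ler_pdivrMr//.
  have -> : D / 2 * (2 * (V x + D)) = D * V x + D * D by field.
  by rewrite lerDl mulr_ge0// ltW.
lra.
Qed.

End OneSidedPotential.

(** * Solitary waves of an abstract interaction *)

Theorem solitary_wave (R : realType) (delta : R) (F f : R -> R -> R) (kap rho phi : R -> R)
    (C0 : R) : interaction delta F f kap rho phi C0 ->
  exists K1, forall K, K1 < K -> exists (c2 : R) (Q : R -> R),
    [/\ csq kap < c2,
        [/\ forall x, derivable Q x 1, forall x, derivable Q^`()%classic x 1 &
            continuous Q^`(2)%classic],
        {homo Q : x y / x <= y} /\
        (forall z, lebesgue_measure.-integrable setT
          (fun x => (f (Q (z + x)%R - Q z) x - f (Q z - Q (z - x)%R) x)%:E)),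
        (\int[lebesgue_measure]_z \int[lebesgue_measure]_x
           (F (Q (z + x)%R - Q z) x)%:E = K%:E)%E &
        forall z, (c2 * Q^`(2)%classic z)%:E = (\int[lebesgue_measure]_x
           (f (Q (z + x)%R - Q z) x - f (Q z - Q (z - x)%R) x)%:E)%E].
Proof.
move=> I; have [K1 [K10 H]] := threshold I.
exists K1 => K KK; have [w [r0 [aw wK]]] := H K KK.
have K0 : 0 < K by exact: le_lt_trans KK.
have [u [r [au rr umin]]] := minimiser_exists I aw wK.
have r_gt0 := minimal_norm_gt0 I K0 au.
have [nu uu uE uK] := au.
have Tu : (norm2 u < +oo)%E by rewrite uE ltry.
have eu : energy F u = K%:E.
  apply/eqP; rewrite eq_le uK andbT.
  exact: (energy_le_K I K0 au umin nu uu uE (lexx r)).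
have EL := euler_lagrange I K0 au umin.
set P := fine (pairing f u u) in EL.
have P2K : 2 * K <= P := pairing_ge2K I au.
have cc : csq kap < P / r.
  rewrite ltr_pdivlMr//; have := csq_ge0 I => c0.
  have : csq kap / 2 * r <= csq kap / 2 * r0 by rewrite ler_wpM2l// divr_ge0.
  have -> : csq kap / 2 * r = csq kap * r / 2 by ring.
  lra.
have c20 : 0 < P / r by exact: le_lt_trans (csq_ge0 I) cc.
have [U [M [M0 U0M uU eU gU]]] := regular_representative I nu uu Tu cc EL.
have mU : measurable_fun [set: R] U.
  by apply/measurable_EFinP; exact: unimodal_measurable.
have [L L0 UL] := lipschitz I M0 U0M mU cc gU.
have [Q dQ] := primitive_exists (lipschitz_continuous UL).
have [d1 d2 d3 eqQ] := wave_profile I M0 L0 c20 U0M UL gU dQ.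
exists (P / r), Q; split; [exact: cc|by split| | |exact: eqQ].
  split; first exact: (Q_nondecreasing U0M UL dQ).
  exact: (D_integrable I M0 L0 U0M UL dQ).
by rewrite -(energy_profile I U0M UL dQ) eU eu.
Qed.

Lemma mem_pos_half_line (R : realType) (x : R) : (x \in pos_half_line R) = (0 <= x).
Proof. by rewrite /pos_half_line in_itv/= andbT. Qed.

(** * The interaction of a potential and a kernel *)

Section KernelInteraction.
Context {R : realType}.
Local Notation mu := (@lebesgue_measure R).
Variables (delta g1 g2 c1 c2 : R) (k m V V1 V2 : R -> R).
Hypothesis delta0 : 0 < delta.
Hypothesis Hkm : kernel_hyp delta g2 k m.
Hypothesis c1_ge0 : 0 <= c1.
Hypothesis c2_gt0 : 0 < c2.
Hypothesis g1_gt0 : 0 < g1.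
Hypothesis g12 : g1 <= g2.
Let S (x : R) := c1 * x `^ g1 + c2 * x `^ g2.
Hypothesis dV : forall x : R, is_derive x (1 : R) V (V1 x).
Hypothesis dV1 : forall x : R, is_derive x (1 : R) V1 (V2 x).
Hypothesis cV2 : continuous V2.
Hypothesis V_0 : V 0 = 0.
Hypothesis V1_0 : V1 0 = 0.
Hypothesis V2_0 : 0 < V2 0.
Hypothesis V_cvx : forall a b t, 0 <= a -> 0 <= b -> 0 <= t <= 1 ->
  V (t * a + (1 - t) * b) <= t * V a + (1 - t) * V b.
Hypothesis V_sq : forall x y, 0 < x -> x < y -> V x / x ^+ 2 < V y / y ^+ 2.
Hypothesis V2_le : forall x, 0 <= x -> V2 x <= V2 0 + S x.

Let g2_gt0 : 0 < g2. Proof. exact: lt_le_trans g12. Qed.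

Lemma growth_nd x y : 0 <= x -> x <= y -> S x <= S y.
Proof.
move=> x0 xy; have y0 : 0 <= y by exact: le_trans xy.
by apply: lerD; rewrite ler_wpM2l ?(ltW c2_gt0)// ge0_ler_powR// ?nnegrE// ltW.
Qed.

Lemma m_gt0 x : 0 < x -> 0 < m x.
Proof.
move=> x0; rewrite lt_neqAle; apply/andP; split.
  by apply/eqP => /esym /(m_eq0 Hkm) E; rewrite E ltxx in x0.
have <- : m 0 = 0 by apply/(m_eq0 Hkm).
by apply: (m_nondecreasing Hkm); rewrite ?mem_pos_half_line ?lexx ?(ltW x0).
Qed.

Lemma k_gt0 x : 0 < x -> 0 < k x.
Proof.
move=> x0; rewrite lt_neqAle; apply/andP; split.
  by apply/eqP => /esym /(k_eq0 Hkm) E; rewrite E ltxx in x0.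
have <- : k 0 = 0 by apply/(k_eq0 Hkm).
by apply: (k_nondecreasing Hkm); rewrite ?mem_pos_half_line ?lexx ?(ltW x0).
Qed.

(** Monotonicity is known on [[0, +oo[] only; composing with the positive part gives functions
    monotone on the line, hence measurable, that agree with [m] and [k] on []0, delta[]. *)
Let m' x := m (Num.max 0 x).
Let k' x := k (Num.max 0 x).

Lemma measurable_nd_pos (g : R -> R) :
  {in pos_half_line R &, {homo g : x y / x <= y}} ->
  measurable_fun [set: R] (fun x => g (Num.max 0 x)).
Proof.
move=> g_nd; apply: nondecreasing_measurable => // x y xy.
have max_le : Num.max 0 x <= Num.max 0 y.
  by rewrite ge_max !le_max lexx xy orbT.
by apply: g_nd => //; rewrite mem_pos_half_line le_max lexx.
Qed.

Let mk' : measurable_fun [set: R] k'.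
Proof. exact: measurable_nd_pos (k_nondecreasing Hkm). Qed.

Let m'_ge0 x : 0 <= m' x.
Proof.
rewrite /m'; have [x0|x0] := leP x 0; last exact/ltW/m_gt0.
by have /(m_eq0 Hkm) -> : 0 = 0 :> R by [].
Qed.

Let mm' : measurable_fun [set: R] m'.
Proof. exact: measurable_nd_pos (m_nondecreasing Hkm). Qed.

Let mmV : measurable_fun [set: R] (fun x => (m' x)^-1).
Proof.
have -> : (fun x => (m' x)^-1) = (fun y : R => y `^ (-1)) \o m'.
  by apply/funext => x /=; rewrite powR_inv1.
exact: measurableT_comp (measurable_powR _) mm'.
Qed.

Let inn (x : R) := 0 < x < delta.

Let minn : measurable_fun [set: R] inn.
Proof.
by apply: measurable_and; apply: measurable_fun_ltr;
  [exact: measurable_cst|exact: measurable_id|exact: measurable_id|exact: measurable_cst].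
Qed.

Let m'E x : inn x -> m' x = m x.
Proof. by move=> /andP[x0 _]; rewrite /m' max_r// ltW. Qed.
Let k'E x : inn x -> k' x = k x.
Proof. by move=> /andP[x0 _]; rewrite /k' max_r// ltW. Qed.

Definition trunc_potential a x := if 0 < x < delta then V (a / m x) * k x else 0.
Definition trunc_force a x := if 0 < x < delta then V1 (a / m x) * (k x / m x) else 0.
Definition trunc_stiffness x := if 0 < x < delta then V2 0 * (k x / m x ^+ 2) else 0.
Definition trunc_weight x := if 0 < x < delta then k x / m x `^ (g2 + 2) else 0.
Definition growth_const := c1 * m delta `^ (g2 - g1) + c2.

Lemma measurable_off (h : R -> R) : measurable_fun [set: R] h ->
  measurable_fun [set: R] (fun x => if 0 < x < delta then h x else 0).
Proof. by move=> mh; apply: measurable_fun_ifT. Qed.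

Lemma measurable_off2 (h : R * R -> R) : measurable_fun [set: R * R] h ->
  measurable_fun [set: R * R] (fun p => if 0 < p.2 < delta then h p else 0).
Proof.
by move=> mh; apply: measurable_fun_ifT => //; exact: measurableT_comp minn measurable_snd.
Qed.

Let mquot : measurable_fun [set: R * R] (fun p : R * R => p.1 / m' p.2).
Proof.
by apply: measurable_funM => //; exact: measurableT_comp mmV measurable_snd.
Qed.

(** The power [g1] is brought to the common denominator [m x]^ g2[at the price of]m x [^ (g2 - g1)],
    which monotonicity bounds by its value at [delta]; this is the origin of [growth_const]. The
    common factor left is the weight whose second moment [int_growth] makes finite. *)
Lemma phi_powE a x : inn x -> 0 <= a ->
  S (a / m x) * (k x / m x ^+ 2) <=
  trunc_weight x * (growth_const * (a `^ g1 + a `^ g2)).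
Proof.
move=> /[dup] ix /andP[x0 xd] a0; rewrite /trunc_weight /S ifT//.
have mx := m_gt0 x0; have kx := k_gt0 x0; have md := m_gt0 delta0.
have mxd : m x <= m delta.
  by apply: (m_nondecreasing Hkm); rewrite ?mem_pos_half_line ?(ltW x0) ?(ltW delta0) ?(ltW xd).
have mV : 0 <= (m x)^-1 by rewrite invr_ge0 ltW.
have pV g : (a / m x) `^ g = a `^ g / m x `^ g.
  rewrite powRM//; congr (_ * _).
  by rewrite -powR_inv1 ?(ltW mx)// -powRrM mulN1r powRN.
rewrite !pV.
have E2 : m x `^ (g2 + 2) = m x `^ g2 * m x ^+ 2.
  rewrite powRD; last by rewrite (gt_eqF mx) implybT.
  by rewrite (powR_mulrn 2 (ltW mx)).
have E1 : m x `^ g2 = m x `^ g1 * m x `^ (g2 - g1).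
  rewrite -powRD; first by congr (_ `^ _); ring.
  by rewrite (gt_eqF mx) implybT.
rewrite E2.
have A1 : 0 < m x `^ g1 by exact: powR_gt0.
have A2 : 0 < m x `^ g2 by exact: powR_gt0.
have A3 : 0 < m x `^ (g2 - g1) by exact: powR_gt0.
have A4 : m x `^ (g2 - g1) <= m delta `^ (g2 - g1).
  by rewrite ge0_ler_powR// ?nnegrE ?subr_ge0// ltW.
have p1 : 0 <= a `^ g1 by exact: powR_ge0.
have p2 : 0 <= a `^ g2 by exact: powR_ge0.
set w := k x / (m x `^ g2 * m x ^+ 2).
have w0 : 0 < w by rewrite divr_gt0// mulr_gt0// exprn_gt0.
have -> : (c1 * (a `^ g1 / m x `^ g1) + c2 * (a `^ g2 / m x `^ g2)) * (k x / m x ^+ 2)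
  = w * (c1 * m x `^ (g2 - g1) * a `^ g1 + c2 * a `^ g2).
  by rewrite /w E1; field; rewrite !gt_eqF// E1.
rewrite ler_wpM2l ?(ltW w0)// /growth_const.
have B1 : c1 * m x `^ (g2 - g1) * a `^ g1 <= c1 * m delta `^ (g2 - g1) * a `^ g1.
  by rewrite ler_wpM2r// ler_wpM2l.
have B2 : 0 <= c2 * a `^ g1 by rewrite mulr_ge0// ltW.
have B3 : 0 <= c1 * m delta `^ (g2 - g1) * a `^ g2.
  by rewrite mulr_ge0// mulr_ge0// powR_ge0.
by rewrite !(mulrDr, mulrDl); lra.
Qed.

Let weight_split x : 0 < x -> k x / m x `^ (g2 + 2) = k x / m x ^+ 2 / m x `^ g2.
Proof.
move=> x0; have mx := m_gt0 x0; rewrite powRD; last by rewrite (gt_eqF mx) implybT.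
by rewrite (powR_mulrn 2 (ltW mx)) invfM [_^-1 * _]mulrC mulrA.
Qed.

Lemma kernel_interaction : interaction delta trunc_potential trunc_force
  trunc_stiffness trunc_weight (fun a => growth_const * (a `^ g1 + a `^ g2))
  (V2 0 * m delta `^ g2).
Proof.
have md := m_gt0 delta0.
have C_gt0 : 0 < growth_const.
  by rewrite /growth_const ltr_wpDl// mulr_ge0// powR_ge0.
have gm : {in inn, forall x, [/\ 0 < x, 0 < m x, 0 < k x & m x <= m delta]}.
  move=> x; rewrite /in_mem/= => /andP[x0 xd].
  split=> //; [exact: m_gt0|exact: k_gt0|].
  by apply: (m_nondecreasing Hkm); rewrite ?mem_pos_half_line ?(ltW x0) ?(ltW delta0) ?(ltW xd).
have quot_ge0 x a : inn x -> 0 <= a -> 0 <= a / m x.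
  by move=> /gm[_ mx _ _] a0; rewrite divr_ge0// ltW.
have phi_le x a : inn x -> 0 <= a ->
    (V2 0 + S (a / m x)) * (k x / m x ^+ 2) <=
    trunc_stiffness x + trunc_weight x * (growth_const * (a `^ g1 + a `^ g2)).
  move=> ix a0; rewrite mulrDl; apply: lerD; last exact: phi_powE.
  by rewrite /trunc_stiffness ifT.
have SN := @growth_nd.
split => //.
- rewrite (_ : (fun _ => _) = fun p => if 0 < p.2 < delta then V (p.1 / m' p.2) * k' p.2 else 0).
    apply: measurable_off2; apply: measurable_funM; last exact: measurableT_comp mk' measurable_snd.
    apply: measurableT_comp mquot; apply: continuous_measurable_fun.
    exact: is_derive_continuous dV.
  by apply/funext => p; rewrite /trunc_potential; case: ifP => // ip; rewrite m'E// k'E.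
- rewrite (_ : (fun _ => _) = fun p => if 0 < p.2 < delta then V1 (p.1 / m' p.2) * (k' p.2 / m' p.2) else 0).
    apply: measurable_off2; apply: measurable_funM.
      apply: measurableT_comp mquot; apply: continuous_measurable_fun.
      exact: is_derive_continuous dV1.
    apply: measurable_funM; first exact: measurableT_comp mk' measurable_snd.
    exact: measurableT_comp mmV measurable_snd.
  by apply/funext => p; rewrite /trunc_force; case: ifP => // ip; rewrite m'E// k'E.
- rewrite (_ : trunc_stiffness = fun x => if 0 < x < delta then V2 0 * (k' x * (m' x)^-1 ^+ 2) else 0).
    apply: measurable_off; apply: measurable_funM => //; apply: measurable_funM => //.
    exact: measurable_funX.
  by apply/funext => x; rewrite /trunc_stiffness; case: ifP => // ix; rewrite m'E// k'E// exprVn.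
- rewrite (_ : trunc_weight = fun x => if 0 < x < delta then k' x * (m' x `^ (- (g2 + 2))) else 0).
    apply: measurable_off; apply: measurable_funM => //.
    exact: measurableT_comp (measurable_powR _) mm'.
  by apply/funext => x; rewrite /trunc_weight; case: ifP => // ix; rewrite m'E// k'E// powRN.
- move=> x; rewrite /trunc_stiffness; case: ifP => // /gm[_ mx kx _].
  by rewrite mulr_ge0 ?(ltW V2_0)// divr_ge0 ?sqr_ge0// ltW.
- move=> x; rewrite /trunc_weight; case: ifP => // /gm[_ mx kx _].
  by rewrite divr_ge0 ?powR_ge0// ltW.
- by move=> x /negbTE nx; rewrite /trunc_stiffness nx.
- by move=> x /negbTE nx; rewrite /trunc_weight nx.
- by move=> a x /negbTE nx; rewrite /trunc_potential nx.
- by move=> a x /negbTE nx; rewrite /trunc_force nx.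
- by rewrite mulr_ge0 ?powR_ge0// ltW.
- move=> x; rewrite /trunc_stiffness /trunc_weight; case: ifP; last by rewrite mulr0.
  move=> /gm[x0 mx kx mxd]; rewrite weight_split// -mulrA ler_wpM2l ?(ltW V2_0)//.
  have -> : m delta `^ g2 * (k x / m x ^+ 2 / m x `^ g2) =
            (m delta `^ g2 / m x `^ g2) * (k x / m x ^+ 2) by ring.
  rewrite ler_peMl ?divr_ge0 ?sqr_ge0 ?(ltW kx)// ler_pdivlMr ?powR_gt0// mul1r.
  by rewrite ge0_ler_powR// ?nnegrE// ltW.
- apply: le_lt_trans (int_growth Hkm); rewrite le_eqVlt; apply/orP; left; apply/eqP.
  rewrite [RHS]integral_mkcond; apply: eq_integral => x _; rewrite patchE /trunc_weight.
  rewrite mem_setE in_itv/=.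
  by case: ifP => _; rewrite ?mul0r// mulrC mulrA.
- by move=> a a0; rewrite mulr_ge0 ?(ltW C_gt0)// addr_ge0// powR_ge0.
- move=> a b a0 ab; have b0 : 0 <= b by exact: le_trans ab.
  by rewrite ler_wpM2l ?(ltW C_gt0)// lerD// ge0_ler_powR// ?nnegrE// ltW.
(* As [r <= 1], the point with [g1]-th power [r] has [g2]-th power at most [r], so [phi] is at most
   [2 * growth_const * r] there. *)
- move=> e e0; pose r := Num.min 1 (e / (2 * growth_const)).
  have den : 0 < 2 * growth_const by rewrite mulr_gt0.
  have r0 : 0 < r by rewrite lt_min ltr01 divr_gt0.
  exists (r `^ g1^-1); first exact: powR_gt0.
  have r1 : r `^ g1^-1 <= 1.
    have <- : (1 : R) `^ g1^-1 = 1 by rewrite powR1.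
    by rewrite ge0_ler_powR// ?nnegrE ?invr_ge0 ?ge_min ?lexx// ltW.
  have E1 : (r `^ g1^-1) `^ g1 = r by rewrite -powRrM mulVf ?gt_eqF// powRr1// ltW.
  have E2 : (r `^ g1^-1) `^ g2 <= r.
    rewrite -[leRHS]E1; set s := r `^ _ in r1 *.
    have -> : g2 = g1 + (g2 - g1) by ring.
    have s0 : 0 < s by exact: powR_gt0.
    rewrite powRD; last by rewrite (gt_eqF s0) implybT.
    rewrite ler_piMr ?powR_ge0//.
    have <- : (1 : R) `^ (g2 - g1) = 1 by rewrite powR1.
    by rewrite ge0_ler_powR// ?nnegrE ?subr_ge0// ltW.
  apply: (@le_trans _ _ (growth_const * (2 * r))).
    by rewrite ler_wpM2l ?(ltW C_gt0)//; lra.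
  have : r <= e / (2 * growth_const) by rewrite ge_min lexx orbT.
  rewrite ler_pdivlMr// => h; apply: le_trans h.
  by rewrite le_eqVlt; apply/orP; left; apply/eqP; ring.
- move=> a x a0; rewrite /trunc_potential /trunc_stiffness; case: ifP; last by rewrite !mul0r.
  move=> ix; have [x0 mx kx _] := gm x ix.
  have -> : V2 0 * (k x / m x ^+ 2) / 2 * a ^+ 2 = V2 0 / 2 * (a / m x) ^+ 2 * k x.
    by field; rewrite gt_eqF.
  by rewrite ler_wpM2r ?(ltW kx)// (pot_lb dV dV1 cV2 V_0 V1_0 V_sq)// quot_ge0.
- move=> a x a0; have [ix|/negbTE nx] := boolP (0 < x < delta); last first.
    by rewrite /trunc_potential /trunc_stiffness /trunc_weight nx !mul0r addr0 !mul0r.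
  have [x0 mx kx _] := gm x ix.
  apply: (@le_trans _ _ ((V2 0 + S (a / m x)) * (k x / m x ^+ 2) / 2 * a ^+ 2)); last first.
    by rewrite ler_wpM2r ?sqr_ge0// ler_wpM2r// phi_le.
  have -> : (V2 0 + S (a / m x)) * (k x / m x ^+ 2) / 2 * a ^+ 2 =
     (V2 0 + S (a / m x)) / 2 * (a / m x) ^+ 2 * k x by field; rewrite gt_eqF.
  rewrite /trunc_potential ix ler_wpM2r ?(ltW kx)//.
  by rewrite (pot_ub dV dV1 V_0 V1_0 SN V2_le)// quot_ge0.
- move=> a x a0; rewrite /trunc_force; case: ifP => // ix.
  have [x0 mx kx _] := gm x ix.
  by rewrite mulr_ge0 ?divr_ge0 ?(ltW kx) ?(ltW mx)// (pot_V1_ge0 dV dV1 V1_0 V_cvx)// quot_ge0.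
- move=> a x a0; have [ix|/negbTE nx] := boolP (0 < x < delta); last first.
    by rewrite /trunc_force /trunc_stiffness /trunc_weight nx !mul0r addr0 !mul0r.
  have [x0 mx kx _] := gm x ix.
  apply: (@le_trans _ _ ((V2 0 + S (a / m x)) * (k x / m x ^+ 2) * a)); last first.
    by rewrite ler_wpM2r// phi_le.
  have -> : (V2 0 + S (a / m x)) * (k x / m x ^+ 2) * a =
     (V2 0 + S (a / m x)) * (a / m x) * (k x / m x) by field; rewrite gt_eqF.
  rewrite /trunc_force ix ler_wpM2r ?divr_ge0 ?(ltW kx) ?(ltW mx)//.
  by rewrite (pot_V1_ub dV1 V1_0 SN V2_le)// quot_ge0.
- move=> a x a0; rewrite /trunc_force /trunc_potential; case: ifP; last by rewrite mulr0 mul0r.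
  move=> ix; have [x0 mx kx _] := gm x ix.
  have -> : V1 (a / m x) * (k x / m x) * a = V1 (a / m x) * (a / m x) * k x by ring.
  by rewrite mulrA ler_wpM2r ?(ltW kx)// (pot_V1_double dV dV1 cV2 V_0 V1_0 V2_0 V_cvx V_sq)// quot_ge0.
- move=> a b x a0 b0; rewrite /trunc_force /trunc_potential; case: ifP; last by rewrite mul0r addr0.
  move=> ix; have [x0 mx kx _] := gm x ix.
  have -> : V (a / m x) * k x + V1 (a / m x) * (k x / m x) * (b - a) =
    (V (a / m x) + V1 (a / m x) * (b / m x - a / m x)) * k x by ring.
  by rewrite ler_wpM2r ?(ltW kx)// (pot_tangent dV dV1 V_cvx)// quot_ge0.
- move=> a b x a0 ab; rewrite /trunc_force; case: ifP => // ix.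
  have [x0 mx kx _] := gm x ix.
  rewrite ler_wpM2r ?divr_ge0 ?(ltW kx) ?(ltW mx)// (pot_V1_nd dV dV1 V_cvx)// ?quot_ge0//.
  by rewrite ler_wpM2r// invr_ge0 ltW.
- move=> a b x a0 ab; have b0 : 0 <= b by exact: le_trans ab.
  have [ix|/negbTE nx] := boolP (0 < x < delta); last first.
    by rewrite /trunc_force /trunc_stiffness /trunc_weight nx !mul0r addr0 subrr mul0r.
  have [x0 mx kx _] := gm x ix.
  apply: (@le_trans _ _ ((V2 0 + S (b / m x)) * (k x / m x ^+ 2) * (b - a))); last first.
    by rewrite ler_wpM2r ?subr_ge0// phi_le.
  have -> : (V2 0 + S (b / m x)) * (k x / m x ^+ 2) * (b - a) =
     (V2 0 + S (b / m x)) * (b / m x - a / m x) * (k x / m x) by field; rewrite gt_eqF.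
  rewrite /trunc_force ix -mulrBl ler_wpM2r ?divr_ge0 ?(ltW kx) ?(ltW mx)//.
  rewrite (pot_V1_lip dV1 SN V2_le)// ?quot_ge0//.
  by rewrite ler_wpM2r// invr_ge0 ltW.
- move=> s a x s1 a0; rewrite /trunc_potential; case: ifP; last by rewrite mulr0.
  move=> ix; have [x0 mx kx _] := gm x ix.
  have -> : s * a / m x = s * (a / m x) by rewrite mulrA.
  by rewrite [leLHS]mulrA ler_wpM2r ?(ltW kx)// (pot_scale V_0 V_sq)// quot_ge0.
- move=> x; have [ix|/negbTE nx] := boolP (0 < x < delta); last first.
    have -> : trunc_potential ^~ x = fun=> 0 by apply/funext => a; rewrite /trunc_potential nx.
    exact: cst_continuous.
  have -> : trunc_potential ^~ x = fun a => V (a / m x) * k x.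
    by apply/funext => a; rewrite /trunc_potential ix.
  move=> a; apply: cvgMl.
  have h : {for a, continuous (V \o (fun b => b / m x))}.
    apply: continuous_comp; first by apply: cvgMl; exact: cvg_id.
    exact: (is_derive_continuous dV).
  exact: h.
- move=> x ix; rewrite /trunc_potential /trunc_stiffness ix.
  have [x0 mx kx _] := gm x ix.
  have -> : V2 0 * (k x / m x ^+ 2) / 2 * x ^+ 2 = V2 0 / 2 * (x / m x) ^+ 2 * k x.
    by field; rewrite gt_eqF.
  by rewrite ltr_pM2r// (pot_lb_strict dV dV1 cV2 V_0 V1_0 V_sq)// divr_gt0.
Qed.

End KernelInteraction.

(** * Reflection *)

Section Reflection.
Context {R : realType}.
Local Notation mu := (@lebesgue_measure R).
Variables (delta : R) (V k m : R -> R) (I : interval R) (c1 c2 gamma1 gamma2 s : R).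
Hypothesis delta_gt0 : 0 < delta.
Hypothesis V_C2 : C2 V.
Hypothesis HV : potential_hyp V I c1 c2 gamma1 gamma2.
Hypothesis Hkm : kernel_hyp delta gamma2 k m.
Hypothesis ss : s * s = 1.
Hypothesis sI : forall x, (s * x \in I) = (0 <= x).

Let s_neq0 : s != 0.
Proof. by apply/eqP => s0; move: ss; rewrite s0 mul0r => /eqP; rewrite eq_sym oner_eq0. Qed.

Let normMs x : `|s * x| = `|x|.
Proof.
have : `|s| ^+ 2 == 1 by rewrite real_normK ?num_real// expr2 ss.
by rewrite sqrp_eq1// normrM => /eqP ->; rewrite mul1r.
Qed.

Let is_deriveV (x : R) : is_derive x (1 : R) V (V^`()%classic x).
Proof. by case: V_C2 => d _ _; rewrite derive1E; exact: derivableP. Qed.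

Let is_deriveV' (x : R) : is_derive x (1 : R) V^`()%classic (V^`(2)%classic x).
Proof.
case: V_C2 => _ d _.
have -> : V^`(2)%classic x = (V^`()^`())%classic x by [].
by rewrite derive1E; exact: derivableP.
Qed.

Let is_derive_reflect (x : R) : is_derive x (1 : R) (fun x => s * x) s.
Proof.
by have := is_deriveZ s (is_derive_id x (1 : R)); rewrite /GRing.scale/= mulr1.
Qed.

(** The sign [s] is [1] or [-1] according to the half-line. As [s * s = 1], the second derivative of
    the reflected potential is that of [V] at the reflected point, and the growth bound, stated in
    absolute values, is unaffected. *)
Lemma reflected_interaction : interaction delta
  (trunc_potential delta k m (fun x => V (s * x)))
  (trunc_force delta k m (fun x => s * V^`()%classic (s * x)))
  (trunc_stiffness delta k m (fun x => V^`(2)%classic (s * x)))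
  (trunc_weight delta gamma2 k m)
  (fun a => growth_const delta gamma1 gamma2 c1 c2 m * (a `^ gamma1 + a `^ gamma2))
  (V^`(2)%classic (s * 0) * m delta `^ gamma2).
Proof.
have c1_ge0 := le_trans ler01 (c1_ge1 HV).
have c2_gt0 := lt_le_trans ltr01 (c2_ge1 HV).
apply: (kernel_interaction delta_gt0 Hkm c1_ge0 c2_gt0 (gamma1_gt0 HV) (gamma1_le_gamma2 HV)).
- move=> x; have := is_derive1_comp (is_deriveV (s * x)) (is_derive_reflect x).
  by rewrite mulrC.
- move=> x; have := is_deriveZ s (is_derive1_comp (is_deriveV' (s * x)) (is_derive_reflect x)).
  by rewrite /GRing.scale/= mulrCA ss mulr1.
- move=> x; have [_ _ c] := V_C2.
  apply: (@continuous_comp _ _ _ (fun x : R => s * x)); last exact: c.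
  by apply: cvgMr; exact: cvg_id.
- by rewrite mulr0 (V_at0 HV).
- by rewrite mulr0 (V'_at0 HV) mulr0.
- by rewrite mulr0 (V''_at0 HV).
- move=> a b t a0 b0 /andP[t0 t1].
  have := V_convex HV (Itv01 t0 t1) (x := s * a) (y := s * b).
  rewrite !inE/= !sI a0 b0 => /(_ isT isT).
  rewrite !convRE /unstable.onem/= => h.
  by have -> : s * (t * a + (1 - t) * b) = t * (s * a) + (1 - t) * (s * b) by ring.
- move=> x y x0 xy; have y0 : 0 < y by exact: lt_trans xy.
  have := V_superquadratic HV (x := s * x) (y := s * y).
  rewrite !sI !mulf_eq0 !negb_or s_neq0 (gt_eqF x0) (gt_eqF y0) (ltW x0) (ltW y0).
  by rewrite !normMs !gtr0_norm// !exprMn expr2 ss !mul1r; apply.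
- move=> x x0; rewrite mulr0 addrA -{2 3}(ger0_norm x0) -(normMs x).
  exact: V''_growth HV _.
Qed.

Local Notation stiffness := (trunc_stiffness delta k m (fun x => V^`(2)%classic (s * x))).

Lemma sound_speedE : sound_speed delta V k m = Num.sqrt (csq stiffness).
Proof.
have V20 := V''_at0 HV; have HI := reflected_interaction.
rewrite /sound_speed; congr (Num.sqrt _).
have nk := nnm_wx2 (i_mkap HI) (i_kap_ge0 HI).
have -> : \int[mu]_(x in `]0%R, delta[) (k x * x ^+ 2 / m x ^+ 2) =
    (V^`(2)%classic 0)^-1 * csq stiffness.
  rewrite /Rintegral integral_mkcond.
  rewrite (_ : (\int[mu]_x _ = \int[mu]_x ((V^`(2)%classic 0)^-1%:E * (stiffness x * x ^+ 2)%:E))%E).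
    rewrite ge0_integralZl//; last 3 first.
    - exact: nk.1.
    - by move=> x _; exact: nk.2.
    - by rewrite lee_fin invr_ge0 ltW.
    by rewrite (csqE HI) -EFinM.
  apply: eq_integral => x _; rewrite patchE mem_setE in_itv/= /trunc_stiffness mulr0 -EFinM.
  case: ifP => [/andP[x0 _]|_]; last by rewrite mul0r mulr0.
  by congr (_%:E); field; rewrite !gt_eqF//; exact: (m_gt0 Hkm).
by rewrite mulrA divff ?gt_eqF// mul1r.
Qed.

Lemma reflected_wave : exists K1 : R, forall K, K1 < K -> exists (c : R) (Q : R -> R),
  [/\ sound_speed delta V k m < c, C2 (fun z => s * Q z),
      potential_energy delta V k m (fun z => s * Q z) = K%:E,
      travelling_wave_eq delta V k m c (fun z => s * Q z) &
      {homo Q : x y / x <= y}].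
Proof.
have HI := reflected_interaction.
have [K1 HK] := solitary_wave HI; exists K1 => K /HK[cc [Q [cQ [dQ dQ' cQ'] [ndQ iQ] eQ wQ]]].
have dq : (fun z => s * Q z)^`()%classic = fun z => s * Q^`()%classic z.
  by apply/funext => z; rewrite derive1Ml.
have dq2 : (fun z => s * Q z)^`(2)%classic = fun z => s * Q^`(2)%classic z.
  apply/funext => z.
  have -> : (fun z => s * Q z)^`(2)%classic z = ((fun z => s * Q z)^`()^`())%classic z by [].
  by rewrite dq derive1Ml.
have c0 := csq_ge0 HI.
exists (Num.sqrt cc), Q; split; last exact: ndQ.
- by rewrite sound_speedE ltr_sqrt// (le_lt_trans c0 cQ).
- split; rewrite ?dq ?dq2.
  + by move=> x; apply: derivableM.
  + by move=> x; apply: derivableM.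
  + by move=> x; apply: cvgMr; exact: cQ'.
- rewrite -eQ /potential_energy; apply: eq_integral => z _.
  rewrite integral_mkcond; apply: eq_integral => x _.
  rewrite patchE mem_setE in_itv/= /trunc_potential /micropotential.
  by case: ifP => // _; rewrite mulrA mulrBr.
- move=> z; rewrite dq2 sqr_sqrtr; last exact: le_trans (ltW cQ).
  rewrite mulrCA EFinM wQ -integralZl// [RHS]integral_mkcond; apply: eq_integral => x _.
  have [dV _ _] := V_C2.
  rewrite patchE mem_setE in_itv/= /trunc_force !force_densityE//.
  case: ifP => _; last by rewrite subr0 mule0.
  have argE a b w : (s * a - s * b) / w = s * ((a - b) / w) by rewrite -mulrBr mulrA.
  by rewrite !argE -EFinM mulrBr !(mulrA s) ss !mul1r.
Qed.

End Reflection.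

Theorem theorem1 (R : realType) (delta : R) (V k m : R -> R) (I : interval R)
    (c1 c2 gamma1 gamma2 : R)
    (delta_gt0 : 0 < delta)
    (V_C2 : C2 V)
    (I_half_line : I = neg_half_line R \/ I = pos_half_line R)
    (HV : potential_hyp V I c1 c2 gamma1 gamma2)
    (Hkm : kernel_hyp delta gamma2 k m) :
  exists K1 : R, forall K : R, K1 < K ->
    exists (c : R) (q : R -> R),
      [/\ sound_speed delta V k m < c,
          C2 q,
          potential_energy delta V k m q = K%:E,
          travelling_wave_eq delta V k m c q &
          (I = pos_half_line R -> {homo q : x y / x <= y}) /\
          (I = neg_half_line R -> {homo q : x y / x <= y >-> y <= x})].
Proof.
have ne : neg_half_line R <> pos_half_line R by [].
case: I_half_line => IE; rewrite IE in HV *.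
  have sI (x : R) : (-1 * x \in neg_half_line R) = (0 <= x).
    by rewrite /neg_half_line in_itv/= mulN1r oppr_le0.
  have ss : (-1) * (-1) = 1 :> R by rewrite mulrNN mulr1.
  have [K1 HK] := reflected_wave delta_gt0 V_C2 HV Hkm ss sI.
  exists K1 => K /HK[c [Q [H1 H2 H3 H4 ndQ]]]; exists c, (fun z => -1 * Q z); split => //.
  by split=> // _ x y xy; rewrite !mulN1r lerN2 ndQ.
have sI (x : R) : (1 * x \in pos_half_line R) = (0 <= x).
  by rewrite mul1r mem_pos_half_line.
have [K1 HK] := reflected_wave delta_gt0 V_C2 HV Hkm (mulr1 1) sI.
exists K1 => K /HK[c [Q [H1 H2 H3 H4 ndQ]]]; exists c, (fun z => 1 * Q z); split => //.
by split=> [_ x y xy|/esym//]; rewrite !mul1r ndQ.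
Qed.
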